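(* Let $k$ be an arbitrary field and let $Y,Z$ be objects of $\mathcal S_2(k)$ of the same partition type $(\alpha,\beta,\gamma)$. The following are equivalent: (1) $Y\leq_{\rm arc}Z$; (2) $Y\leq_{\rm ext}Z$; (3) $Y\leq_{\rm hom}Z$. If moreover $k$ is algebraically closed, these are also equivalent to (4) $Y\leq_{\rm deg}Z$.
   Context: For a partition $\alpha$ let $N_\alpha=\bigoplus_ik[T]/(T^{\alpha_i})$. $\mathcal S(k)$: objects are triples $(N_\alpha,N_\beta,f)$, $f$ an injective $k[T]$-homomorphism; morphisms $(N_\alpha,N_\beta,f)\to(N_{\alpha'},N_{\beta'},f')$ are pairs $(\psi_1,\psi_2)$ of $k[T]$-maps with $f'\psi_1=\psi_2f$. $\mathcal S_2(k)$: full subcategory with $\alpha_1\le2$. Partition type $(\alpha,\beta,\gamma)$: $\operatorname{Coker}f\cong N_\gamma$. Short exact sequences in $\mathcal S(k)$ are sequences of morphisms exact in both components. Orders: $Y\leq_{\rm ext}Z$ if there exist objects $M_i,U_i,V_i$ of $\mathcal S(k)$ and short exact sequences $0\to U_i\to M_i\to V_i\to0$ with $Y\cong M_1$, $U_i\oplus V_i\cong M_{i+1}$ ($1\le i\le s$), $Z\cong M_{s+1}$. $Y\leq_{\rm hom}Z$ if $\dim_k\operatorname{Hom}(X,Y)\le\dim_k\operatorname{Hom}(X,Z)$ for all objects $X$ of $\mathcal S(k)$. For $k$ algebraically closed, $Y=(N_\alpha,N_\beta,f)\leq_{\rm deg}Z=(N_\alpha,N_\beta,g)$ (after identifying with objects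 having these underlying modules) if the orbit of $g$ under $\operatorname{Aut}_{k[T]}(N_\alpha)\times\operatorname{Aut}_{k[T]}(N_\beta)$, acting by $(a,h)\cdot f=hfa^{-1}$, is contained in the Zariski closure of the orbit of $f$ within the set of injective $k[T]$-maps $N_\alpha\to N_\beta$ with cokernel $\cong N_\gamma$ (a subset of $\operatorname{Hom}_k(N_\alpha,N_\beta)$). Arc order: the indecomposable objects of $\mathcal S_2(k)$ are the pickets $P_\ell^m=(N_{(\ell)},N_{(m)},\iota)$, $0\le\ell\le\min\{2,m\}$, and the bipickets $B_2^{m,r}=(N_{(2)},N_{(m,r)},\delta)$, $1\le r\le m-2$, $\delta(1)=(T^{m-2},T^{r-1})$; each object is uniquely a direct sum of these. Its arc diagram is the multiset with an arc $(m,r)$ for each summand $B_2^{m,r}$, an arc $(m,m-1)$ for each $P_2^m$, and a pole at $m$ for each $P_1^m$. Moves: for $m>n>r>s$, (A) replaces arcs $(m,r),(n,s)$ by $(m,s),(n,r)$; (C) replaces arcs $(m,r),(n,s)$ by $(m,n),(r,s)$; for $m>r>s$, (B) replaces arc $(m,s)$ and pole at $r$ by arc $(m,r)$ and pole at $s$; (D) replaces arc $(m,s)$ and pole at $r$ by pole at $m$ and arc $(r,s)$. $Y\leq_{\rm arc}Z$ if the arc diagram of $Y$ is obtained from that of $Z$ by a finite (possibly empty) sequence of moves. *)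

(* Defs.v *)
From HB Require Import structures.
From mathcomp Require Import all_boot all_order all_algebra.
From mathcomp Require Import mpoly.
From Stdlib Require Import Permutation.
Set Implicit Arguments. Unset Strict Implicit. Unset Printing Implicit Defensive.
Import Order.TTheory GRing.Theory.
Local Open Scope ring_scope.

(* Conventions: N_a = (+)_i k[T]/(T^{a_i}) is modelled as k^(sumn a) (row
   vectors) with basis T^j e_i listed block by block; T acts by right
   multiplication with the nilpotent Jordan matrix [jm a].  k[T]-linear maps
   are matrices commuting with these operators; x |-> x *m A, so the
   composite "first A then B" is A *m B. *)

Section SCat.
Variable k : fieldType.

(* partitions: nonincreasing sequences of naturals (zero parts allowed,
   N_(0) = 0, needed for the pickets P_0^m) *)
Definition is_part (a : seq nat) : bool := sorted geq a.

Definition psums (a : seq nat) : seq nat :=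
  [seq sumn (take i a) | i <- iota 0 (size a).+1].

Definition jm (a : seq nat) : 'M[k]_(sumn a) :=
  \matrix_(i, j) ((((j : nat) == i.+1) && ((j : nat) \notin psums a)) %:R).

Record sobj := SObj { sa : seq nat; sb : seq nat;
                      smap : 'M[k]_(sumn sa, sumn sb) }.

Definition is_obj_map (a b : seq nat) (f : 'M[k]_(sumn a, sumn b)) : bool :=
  row_free f && (jm a *m f == f *m jm b).

Definition valid (X : sobj) : bool :=
  [&& is_part (sa X), is_part (sb X) & is_obj_map (smap X)].

Definition is_mor (X X' : sobj) (p1 : 'M[k]_(sumn (sa X), sumn (sa X')))
  (p2 : 'M[k]_(sumn (sb X), sumn (sb X'))) : bool :=
  [&& jm (sa X) *m p1 == p1 *m jm (sa X'),
      jm (sb X) *m p2 == p2 *m jm (sb X') &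
      p1 *m smap X' == smap X *m p2].

Definition iso (X X' : sobj) : Prop :=
  exists p1 p2 q1 q2, [/\ @is_mor X X' p1 p2, @is_mor X' X q1 q2,
    p1 *m q1 = 1%:M /\ q1 *m p1 = 1%:M & p2 *m q2 = 1%:M /\ q2 *m p2 = 1%:M].

Definition dsum (X X' : sobj) : sobj :=
  SObj (castmx (esym (sumn_cat (sa X) (sa X')), esym (sumn_cat (sb X) (sb X')))
        (block_mx (smap X) 0 0 (smap X'))).

Definition zero_obj : sobj := @SObj [::] [::] 0.

Definition dsum_list (xs : seq sobj) : sobj := foldr dsum zero_obj xs.

Definition ses (U M V : sobj) : Prop :=
  exists u1 u2 v1 v2, [/\ @is_mor U M u1 u2, @is_mor M V v1 v2,
    [&& row_free u1, row_full v1 & (u1 == kermx v1)%MS] &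
    [&& row_free u2, row_full v2 & (u2 == kermx v2)%MS]].

Definition coker_type (a b c : seq nat) (f : 'M[k]_(sumn a, sumn b)) : Prop :=
  exists pi : 'M[k]_(sumn b, sumn c),
    [&& jm b *m pi == pi *m jm c, row_full pi & (f == kermx pi)%MS].

Definition leq_ext (Y Z : sobj) : Prop :=
  exists (s : nat) (M U V : nat -> sobj),
    [/\ forall i, 1 <= i <= s.+1 -> valid (M i),
        forall i, 1 <= i <= s -> valid (U i) /\ valid (V i),
        iso Y (M 1%N),
        forall i, 1 <= i <= s -> ses (U i) (M i) (V i) /\ iso (dsum (U i) (V i)) (M i.+1)
      & iso Z (M s.+1)]%N.

Definition hom_eqs (X X' : sobj)
  (p : 'M[k]_(sumn (sa X), sumn (sa X')) * 'M[k]_(sumn (sb X), sumn (sb X'))) :=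
  (jm (sa X) *m p.1 - p.1 *m jm (sa X'),
   jm (sb X) *m p.2 - p.2 *m jm (sb X'),
   p.1 *m smap X' - smap X *m p.2).

Definition dim_hom (X X' : sobj) : nat := \dim (lker (linfun (@hom_eqs X X'))).

Definition leq_hom (Y Z : sobj) : Prop :=
  forall X, valid X -> (dim_hom X Y <= dim_hom X Z)%N.

Definition is_aut (a : seq nat) (u : 'M[k]_(sumn a)) : bool :=
  (jm a *m u == u *m jm a) && (u \in unitmx).

Definition orbit (a b : seq nat) (f h : 'M[k]_(sumn a, sumn b)) : Prop :=
  exists (u : 'M[k]_(sumn a)) (w : 'M[k]_(sumn b)),
    [/\ is_aut u, is_aut w & h = invmx u *m f *m w].

Definition zariski_cl (m n : nat) (S : 'M[k]_(m, n) -> Prop) (x : 'M[k]_(m, n)) : Prop :=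
  forall p : {mpoly k[m * n]},
    (forall y, S y -> p.@[fun i => mxvec y 0 i] = 0) -> p.@[fun i => mxvec x 0 i] = 0.

Definition Vset (a b c : seq nat) (h : 'M[k]_(sumn a, sumn b)) : Prop :=
  is_obj_map h /\ coker_type c h.

Definition leq_deg (a b c : seq nat) (f g : 'M[k]_(sumn a, sumn b)) : Prop :=
  forall h, orbit g h -> Vset c h /\ zariski_cl (orbit f) h.

Definition picket (l m : nat) : sobj :=
  @SObj [:: l] [:: m] (\matrix_(i < sumn [:: l], j < sumn [:: m])
                        (((j : nat) == i + (m - l)%N)%N %:R)).

(* B_2^{m,r} : delta(1) = (T^{m-2}, T^{r-1}) *)
Definition bipicket (m r : nat) : sobj :=
  @SObj [:: 2%N] [:: m; r] (\matrix_(i < sumn [:: 2%N], j < sumn [:: m; r])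
     ((((j : nat) == i + (m - 2)%N)%N || ((j : nat) == m + r.-1 + i)%N) %:R)).

End SCat.

Inductive item := Arc of nat & nat | Pole of nat.

Definition item_ok (x : item) : bool :=
  match x with Arc m r => (1 <= r <= m.-1)%N | Pole m => (1 <= m)%N end.

Definition item_obj (k : fieldType) (x : item) : sobj k :=
  match x with
  | Arc m r => if r == m.-1 then picket k 2 m else bipicket k m r
  | Pole m => picket k 1 m
  end.

Definition arcdiag (k : fieldType) (Y : sobj k) (D : seq item) : Prop :=
  all item_ok D /\
  exists zs : seq nat,
    iso Y (dsum (dsum_list (map (@item_obj k) D)) (dsum_list (map (picket k 0) zs))).

Definition move_pair (x y x' y' : item) : Prop :=
  (exists m n r s, (s < r < n)%N /\ (n < m)%N /\ x = Arc m r /\ y = Arc n s /\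
     ((x' = Arc m s /\ y' = Arc n r)
      \/ (x' = Arc m n /\ y' = Arc r s)))
  \/ (exists m r s, (s < r < m)%N /\ x = Arc m s /\ y = Pole r /\
     ((x' = Arc m r /\ y' = Pole s)
      \/ (x' = Pole m /\ y' = Arc r s))).

Definition arc_move (D D' : seq item) : Prop :=
  exists x y x' y' rest, Permutation D (x :: y :: rest) /\
    Permutation D' (x' :: y' :: rest) /\ move_pair x y x' y'.

Inductive arc_moves : seq item -> seq item -> Prop :=
| am_refl D : arc_moves D D
| am_step D D' D'' : arc_move D D' -> arc_moves D' D'' -> arc_moves D D''.

Definition leq_arc (k : fieldType) (Y Z : sobj k) : Prop :=
  exists DY DZ, arcdiag Y DY /\ arcdiag Z DZ /\ arc_moves DZ DY.

(* Main.v *)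
Require Import Defs.
From HB Require Import structures.
From mathcomp Require Import all_boot all_order all_algebra.
From mathcomp Require Import mpoly.
From mathcomp Require Import zify.
From Stdlib Require Import Permutation.
Set Implicit Arguments. Unset Strict Implicit. Unset Printing Implicit Defensive.
Import GRing.Theory.

(* An arc diagram with poles is a system of chords on a line, a pole being a chord to a
   vertex beyond all others.  If Y and Z have the same endpoints and no interval [r, m)
   is cut by more chords of Y than of Z, then Y arises from Z by resolving crossings:
   after cancelling common chords, take a shortest chord of Y and the Z-chord leaving
   one of its ends; submodularity of the cut function provides a Z-chord crossing it
   that can be resolved without violating the cut inequalities.

   The cuts are visible to Hom: dim Hom(B_2^{m,r}, X) is a constant of the type plus the
   dimension of A /\ (T^{m-2} ker T^m + T^{r-1} ker T^r), A the submodule of X, and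
   twice the latter equals the number of arcs and poles cut by [r, m) plus type
   constants dim (A /\ T^v N_beta).  So hom implies arc, once every object is known to
   be a sum of pickets and bipickets, which is proved by splitting off cyclic or
   two-generated summands with the help of functionals that detect heights.

   Conversely each move is realised by an explicit extension of the two crossing
   summands, hence arc implies ext, and rescaling the extension class to 0 gives deg.
   Finally ext implies hom by left exactness of Hom(X, -), and deg implies hom because
   dim Hom(X, -) is upper semicontinuous. *)

(** Reading poles as chords to a far vertex makes (B) and (D) the instances of (A) and (C) with that
    vertex as largest endpoint. An interval and its complement are cut by the same chords, so the
    cut inequalities live on a circle; there (A) and (C) become one operation, and an end of the
    shortest chord may serve as origin. Among the crossings available for resolution, the one
    reaching farthest is taken. Every interval whose cut then drops has slack 2 beforehand: the
    shortest chord of [Y] is a defect in the submodularity for [Y], while [Z] has no defect there.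
    On the algebraic side, direct sums concatenate type sequences, so bases and sizes do not match.
    Objects are therefore compared through the images of ambient module and submodule in one fixed
    space, and a dimension count gives the isomorphism. The arc (m, m-1) is a picket and not a
    bipicket; adding the empty picket P_0^{m-1} turns it into the bipicket formula with r = m-1, so
    all arcs are treated alike. The empty pickets are recovered at the end from ranks of powers of
    T, without a unique decomposition theorem. *)

Lemma Permutation_all (T : Type) (P : pred T) l l' : Permutation l l' -> all P l = all P l'.
Proof. by elim=> [|x s t _ /= ->|x y s /=|s t u _ -> _ ->] //; rewrite andbCA. Qed.

(** * Cuts of chord diagrams, submodularity, and a weight lowered by moves *)

Section Chords.
Implicit Types (D Y Z : seq (nat * nat)) (S X : pred nat) (e : nat * nat).

Definition ends D := [seq e.1 | e <- D] ++ [seq e.2 | e <- D].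
Definition cut S D := count (fun e => S e.1 != S e.2) D.
Definition inside S D := count (fun e => S e.1 && S e.2) D.
(** Chords joining a point of S outside X to a point of X outside S: half the defect in the
    submodularity of [cut]. *)
Definition crossing S X D :=
  count (fun e => [&& S e.1, ~~ X e.1, X e.2 & ~~ S e.2]
               || [&& S e.2, ~~ X e.2, X e.1 & ~~ S e.1]) D.

Lemma count_ends S D : count S (ends D) = cut S D + 2 * inside S D.
Proof.
rewrite /ends /cut /inside count_cat !count_map.
elim: D => //= e D IH; case: (S e.1); case: (S e.2) => /=; lia.
Qed.

Lemma cut_submod S X D :
  cut S D + cut X D = cut (predU S X) D + cut (predI S X) D + 2 * crossing S X D.
Proof.
rewrite /cut /crossing; elim: D => //= e D IH.
case: (S e.1); case: (S e.2); case: (X e.1); case: (X e.2) => /=; lia.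
Qed.

Lemma cut_ext S X D : (forall v, v \in ends D -> S v = X v) -> cut S D = cut X D.
Proof.
move=> SX; apply: eq_in_count => e eD.
have mem1: e.1 \in ends D by rewrite mem_cat map_f.
have mem2: e.2 \in ends D by rewrite mem_cat (map_f snd) // orbT.
by rewrite (SX _ mem1) (SX _ mem2).
Qed.

Lemma cutC S D : cut (predC S) D = cut S D.
Proof. by apply: eq_count => e /=; case: (S _); case: (S _). Qed.

Lemma perm_cut S D D' : perm_eq D D' -> cut S D = cut S D'.
Proof. by move/permP; exact. Qed.

Lemma perm_ends D D' : perm_eq D D' -> perm_eq (ends D) (ends D').
Proof. by move=> DD'; rewrite /ends perm_cat // perm_map. Qed.

Lemma ends_cons e D : perm_eq (ends (e :: D)) (e.1 :: e.2 :: ends D).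
Proof.
apply/permP => S; rewrite /ends /= !count_cat /=; lia.
Qed.

Definition oriented D := all (fun e => e.2 < e.1) D.

Definition cmove D D' := exists m n r s rest,
  [/\ s < r < n, n < m, perm_eq D ((m, r) :: (n, s) :: rest) &
   perm_eq D' ((m, s) :: (n, r) :: rest) \/ perm_eq D' ((m, n) :: (r, s) :: rest)].

Inductive cmoves : seq (nat * nat) -> seq (nat * nat) -> Prop :=
| cmoves0 D D' : perm_eq D D' -> cmoves D D'
| cmovesS D D' D'' : cmove D D' -> cmoves D' D'' -> cmoves D D''.

Lemma cmoves_cons e D D' : cmoves D D' -> cmoves (e :: D) (e :: D').
Proof.
elim=> [{}D {}D' DD' | {}D {}D' D'' [m [n [r [s [rest [h1 h2 h3 h4]]]]]] _ IH].
  by apply: cmoves0; rewrite perm_cons.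
apply: cmovesS IH; exists m, n, r, s, (e :: rest); split=> //.
  by apply/permP => a; move/permP/(_ a): h3 => /=; lia.
by case: h4 => /permP h4; [left | right]; apply/permP => a; move: (h4 a) => /=; lia.
Qed.

Lemma cmoves_perm D1 D1' D2 D2' :
  perm_eq D1 D1' -> perm_eq D2' D2 -> cmoves D1' D2' -> cmoves D1 D2.
Proof.
move=> h1 h2 h; elim: h D1 D2 h1 h2 => [E E' EE' D1 D2 h1 h2 | E E' E'' mv _ IH D1 D2 h1 h2].
  by apply: cmoves0; rewrite (permPl h1) (permPl EE').
apply: cmovesS (IH _ _ (perm_refl _) h2).
case: mv => [m [n [r [s [rest [q1 q2 q3 q4]]]]]].
by exists m, n, r, s, rest; split=> //; rewrite (permPl h1).
Qed.

Definition itv i j : pred nat := fun v => i <= v < j.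

(** The function l (2K - l) of a chord length l is increasing and strictly concave for l <= K.
    Concavity pays for the nested outcome of a move, which keeps the sum of the two lengths;
    monotonicity pays for the disjoint outcome, which shortens both chords. *)
Definition chord_weight K D := sumn [seq (e.1 - e.2) * (2 * K - (e.1 - e.2)) | e <- D].

Lemma perm_chord_weight K D D' : perm_eq D D' -> chord_weight K D = chord_weight K D'.
Proof. by move=> DD'; apply: perm_sumn; apply: perm_map. Qed.

Lemma cmove_weight K D D' :
  (forall v, v \in ends D -> v < K) -> cmove D D' -> chord_weight K D' < chord_weight K D.
Proof.
move=> ltK [m [n [r [s [rest [/andP[sr rn] nm pD pD']]]]]].
have mK: m < K.
  by apply: ltK; rewrite (perm_mem (perm_ends pD)) (perm_mem (ends_cons _ _)) inE eqxx.
(* The gaps a, b, c between s < r < n < m remove the truncated subtractions. The weight drops by 2ac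
   for the nested outcome and by 2bL for the disjoint one. *)
have [a [b [c [L [a0 b0 c0 eqs]]]]] : exists a b c L,
    [/\ 0 < a, 0 < b, 0 < c & [/\ r = s + a, n = s + a + b, m = s + a + b + c,
         0 < L & 2 * K = L + a + b + c]].
  exists (r - s), (n - r), (m - n), (2 * K - (m - s)).
  by split; [lia | lia | lia |]; split; lia.
case: eqs => er en em L0 eK.
have ac0 : 0 < a * c by rewrite muln_gt0 a0.
have bL0 : 0 < b * L by rewrite muln_gt0 b0.
have e1 : m - r = b + c by lia.
have e2 : n - s = a + b by lia.
have e3 : m - s = a + b + c by lia.
have e4 : n - r = b by lia.
have e5 : m - n = c by lia.
have e6 : r - s = a by lia.
have f1 : 2 * K - (b + c) = L + a by lia.
have f2 : 2 * K - (a + b) = L + c by lia.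
have f3 : 2 * K - (a + b + c) = L by lia.
have f4 : 2 * K - b = L + a + c by lia.
have f5 : 2 * K - c = L + a + b by lia.
have f6 : 2 * K - a = L + b + c by lia.
rewrite (perm_chord_weight K pD).
case: pD' => pD'; rewrite (perm_chord_weight K pD') /chord_weight /=.
  by rewrite e1 e2 e3 e4 f1 f2 f3 f4 !addnA ltn_add2r; clear -ac0; lia.
by rewrite e1 e2 e5 e6 f1 f2 f5 f6 !addnA ltn_add2r; clear -bL0; lia.
Qed.

End Chords.

(** * Links and cyclic positions *)

Section Chords2.
Implicit Types (D Y Z : seq (nat * nat)) (S X : pred nat) (e : nat * nat).

Definition linked D u v := ((u, v) \in D) || ((v, u) \in D).

Lemma linkedC D u v : linked D u v = linked D v u.
Proof. by rewrite /linked orbC. Qed.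

Lemma linked_ends D u v : linked D u v -> u \in ends D.
Proof.
rewrite /ends mem_cat; case/orP => h; apply/orP; [left | right]; apply/mapP.
  by exists (u, v).
by exists (v, u).
Qed.

Lemma ends_linked D u : u \in ends D -> exists v, linked D u v.
Proof.
rewrite mem_cat => /orP[] /mapP[[a b] h ->]; [exists b | exists a]; rewrite /linked /= h //.
by rewrite orbT.
Qed.

Lemma linked_oriented D u v : oriented D -> linked D u v ->
  (v < u /\ (u, v) \in D) \/ (u < v /\ (v, u) \in D).
Proof.
by move=> /allP oD /orP[] h; [left | right]; split=> //; have := oD _ h.
Qed.

Lemma crossing0 S X D :
  (forall u v, linked D u v -> S u -> ~~ X u -> X v -> S v) -> crossing S X D = 0.
Proof.
move=> h; apply/eqP; rewrite -leqn0 leqNgt -has_count; apply/hasPn => -[u v] uv /=.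
have l1 : linked D u v by rewrite /linked uv.
have l2 : linked D v u by rewrite linkedC.
apply/norP; split; apply/negP => /and4P[s1 s2 s3 /negP[]]; exact: (h _ _ _ s1 s2 s3).
Qed.

Lemma crossing_gt0 S X D u v :
  linked D u v -> S u -> ~~ X u -> X v -> ~~ S v -> 0 < crossing S X D.
Proof.
move=> uv s1 s2 s3 s4; rewrite -has_count; apply/hasP.
case/orP: uv => h; [exists (u, v) | exists (v, u)] => //=; rewrite s1 s2 s3 s4 //=.
by rewrite orbT.
Qed.

Lemma inside0 S D : (forall u v, linked D u v -> S u -> ~~ S v) -> inside S D = 0.
Proof.
move=> h; apply/eqP; rewrite -leqn0 leqNgt -has_count; apply/hasPn => -[u v] uv /=.
apply/negP => /andP[s1]; apply/negP/(h u) => //.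
by rewrite /linked uv.
Qed.

Lemma inside_gt0 S D u v : linked D u v -> S u -> S v -> 0 < inside S D.
Proof.
move=> uv s1 s2; rewrite -has_count; apply/hasP.
by case/orP: uv => h; [exists (u, v) | exists (v, u)] => //=; rewrite s1 s2.
Qed.

Lemma inside_ex S D : 0 < inside S D -> exists e, [/\ e \in D, S e.1 & S e.2].
Proof. by rewrite -has_count => /hasP[e eD /andP[]]; exists e. Qed.

(** The points below K are placed on a circle and counted from p, which gets position 0. *)
Definition rot_pos p K v := if p <= v then v - p else v + K - p.
Definition rot_itv p K b t : pred nat := fun v => b <= rot_pos p K v < t.

(** A cyclic interval that wraps around is the complement of an ordinary one, and by [cutC] both
    have the same cut. *)
Lemma rot_itv_itv p K b t : p < K -> b <= t -> t <= K ->
  exists i j, i <= j /\ ((forall v, v < K -> rot_itv p K b t v = itv i j v) \/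
                         (forall v, v < K -> rot_itv p K b t v = predC (itv i j) v)).
Proof.
move=> pK bt tK; rewrite /rot_itv /itv /rot_pos /=.
have [h1|h1] := leqP t (K - p).
  exists (b + p), (t + p); split; first lia.
  left=> v vK; case: (leqP p v); lia.
have [h2|h2] := leqP (K - p) b.
  exists (b + p - K), (t + p - K); split; first lia.
  left=> v vK; case: (leqP p v); lia.
exists (t + p - K), (b + p); split; first lia.
right=> v vK; case: (leqP p v); lia.
Qed.

(** Passing to the complement if necessary, an interval may be assumed to avoid the origin p, whence
    the bound 0 < b. *)
Lemma itv_rot_itv p K i j : p < K -> i <= j ->
  exists b t, [/\ 0 < b, b <= t, t <= K &
     (forall v, v < K -> itv i j v = rot_itv p K b t v) \/
     (forall v, v < K -> itv i j v = predC (rot_itv p K b t) v)].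
Proof.
move=> pK ij; rewrite /rot_itv /itv /rot_pos /=.
have [h1|h1] := leqP j p.
  exists (i + K - p), (j + K - p); split; try lia.
  left=> v vK; case: (leqP p v); lia.
have [h2|h2] := ltnP p i; last first.
  exists (minn j K - p), (i + K - p); split; try lia.
  right=> v vK; case: (leqP p v); lia.
have [h3|h3] := leqP i K.
  exists (i - p), (minn j K - p); split; try lia.
  left=> v vK; case: (leqP p v); lia.
(* Beyond K the interval contains no point, so an empty cyclic interval serves. *)
exists 1, 1; split; try lia.
left=> v vK; case: (leqP p v); lia.
Qed.

Lemma rot_pos_inj p K u v : p < K -> u < K -> v < K ->
  rot_pos p K u = rot_pos p K v -> u = v.
Proof.
by move=> pK uK vK; rewrite /rot_pos; case: (leqP p u); case: (leqP p v); lia.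
Qed.

Lemma rot_pos_lt p K v : p < K -> v < K -> rot_pos p K v < K.
Proof. by move=> pK vK; rewrite /rot_pos; case: (leqP p v); lia. Qed.

Lemma rot_pos_between p K q v : p < q -> q < K -> v < K ->
  0 < rot_pos p K v < q - p -> p < v < q.
Proof. by move=> pq qK vK; rewrite /rot_pos; case: (leqP p v); lia. Qed.

Lemma rot_pos_gt p K q v : p < q -> q < K -> v < K -> ~~ (p <= v <= q) ->
  q - p < rot_pos p K v.
Proof. by move=> pq qK vK; rewrite /rot_pos; case: (leqP p v); lia. Qed.

(* The crossing chords {p,x} and {n,s} become {p,n} and {x,s}; the four cyclic
   rotations of p, n, x, s are the two kinds of moves, two each. *)
Lemma cmove_of_rot K p n x s D : oriented D -> p < K -> n < K -> x < K -> s < K ->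
  0 < rot_pos p K n -> rot_pos p K n < rot_pos p K x -> rot_pos p K x < rot_pos p K s ->
  linked D p x -> linked D n s ->
  exists D' rest a b c d,
   [/\ cmove D D',
       perm_eq D (a :: b :: rest), perm_eq D' (c :: d :: rest) &
     forall S, [/\ (S a.1 != S a.2) = (S p != S x), (S b.1 != S b.2) = (S n != S s),
         (S c.1 != S c.2) = (S p != S n) & (S d.1 != S d.2) = (S x != S s)]].
Proof.
move=> oD pK nK xK sK.
set nrm := fun u v => (maxn u v, minn u v).
have nrmP (S : pred nat) u v : (S (nrm u v).1 != S (nrm u v).2) = (S u != S v).
  by rewrite /nrm /=; case: (leqP u v) => //= _; rewrite eq_sym.
have link u v : linked D u v -> nrm u v \in D.
  move=> /(linked_oriented oD)[] [lt uvD]; rewrite /nrm.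
    by rewrite (maxn_idPl (ltnW lt)) (minn_idPr (ltnW lt)).
  by rewrite (maxn_idPr (ltnW lt)) (minn_idPl (ltnW lt)).
move=> h1 h2 h3 /link px /link ns.
have ne : nrm n s != nrm p x.
  have np : n <> p by move=> E; move: h1; rewrite E /rot_pos leqnn subnn.
  have nx : n <> x by move=> E; move: h2; rewrite E ltnn.
  by apply/eqP; rewrite /nrm => -[]; clear -np nx; lia.
pose rest := rem (nrm n s) (rem (nrm p x) D).
have pD : perm_eq D (nrm p x :: nrm n s :: rest).
  rewrite (permPl (perm_to_rem px)) perm_cons; apply: perm_to_rem.
  have := perm_mem (perm_to_rem px) (nrm n s); rewrite ns inE (negbTE ne) /=.
  by move=> <-.
exists (nrm p n :: nrm x s :: rest), rest, (nrm p x), (nrm n s), (nrm p n), (nrm x s).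
split=> //.
have pD' : perm_eq D (nrm n s :: nrm p x :: rest).
  by rewrite (permPl pD); apply/permP => S /=; lia.
have sw u v w : perm_eq [:: u, v & w] [:: v, u & w :> seq (nat * nat)].
  by apply/permP => S /=; lia.
(* The linear orders compatible with the cyclic order p, n, x, s, one for each choice of the least
   point. *)
have cases : [\/ p < n /\ n < x /\ x < s, n < x /\ x < s /\ s < p,
  x < s /\ s < p /\ p < n | s < p /\ p < n /\ n < x].
  move: h1 h2 h3; rewrite /rot_pos.
  case: (leqP p n) => c1; case: (leqP p x) => c2; case: (leqP p s) => c3 h1 h2 h3;
  first [by exfalso; lia | by constructor 1; lia | by constructor 2; lia
       | by constructor 3; lia | by constructor 4; lia].
have mx u v : u <= v -> nrm u v = (v, u).
  by move=> uv; rewrite /nrm (maxn_idPr uv) (minn_idPl uv).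
have mn u v : v <= u -> nrm u v = (u, v).
  by move=> uv; rewrite /nrm (maxn_idPl uv) (minn_idPr uv).
case: cases => [] [u1 [u2 u3]].
- exists s, x, n, p, rest; split; try lia.
    by move: pD'; rewrite (mx n s) ?(mx p x) //; lia.
  by right; rewrite (mx p n) ?(mx x s) ?sw //; lia.
- exists p, s, x, n, rest; split; try lia.
    by move: pD; rewrite (mx n s) ?(mn p x) //; lia.
  by left; rewrite (mn p n) ?(mx x s) //; lia.
- exists n, p, s, x, rest; split; try lia.
    by move: pD'; rewrite (mn n s) ?(mn p x) //; lia.
  by right; rewrite (mx p n) ?(mx x s) //; lia.
- exists x, n, p, s, rest; split; try lia.
    by move: pD; rewrite (mn n s) ?(mx p x) //; lia.
  by left; rewrite (mx p n) ?(mn x s) ?sw //; lia.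
Qed.

End Chords2.

(** * Uncrossing one chord diagram into another *)

Section Chords3.
Implicit Types (D Y Z : seq (nat * nat)) (S X : pred nat) (e : nat * nat).

Lemma cmove_ends D D' : cmove D D' -> perm_eq (ends D) (ends D').
Proof.
move=> [m [n [r [s [rest [_ _ pD pD']]]]]].
rewrite (permPl (perm_ends pD)) perm_sym.
by case: pD' => /perm_ends pD'; rewrite (permPl pD'); apply/permP => S;
   rewrite /ends /= ?count_cat /= ?count_cat /=; lia.
Qed.

Lemma cmove_oriented D D' : cmove D D' -> oriented D -> oriented D'.
Proof.
move=> [m [n [r [s [rest [h1 h2 pD pD']]]]]].
rewrite /oriented (perm_all _ pD) /= => /and3P[_ _ oR].
by case: pD' => pD'; rewrite (perm_all _ pD') /= oR andbT; lia.
Qed.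

Lemma exists_min (T : eqType) (f : T -> nat) (s : seq T) (P : pred T) :
  has P s -> exists x, [/\ x \in s, P x & forall y, y \in s -> P y -> f x <= f y].
Proof.
move=> hs; have x0 : T by case: s hs.
pose i0 := Ordinal (ltac:(by rewrite -has_find) : find P s < size s).
case: (@arg_minnP _ i0 (fun i => P (nth x0 s i)) (fun i => f (nth x0 s i))) => [|i Pi imin].
  exact: nth_find.
exists (nth x0 s i); split=> [|//|y ys Py]; first exact: mem_nth.
by have := imin (Ordinal (ltac:(by rewrite index_mem) : index y s < size s)); rewrite /= nth_index //; apply.
Qed.

(** Resolving a crossing lowers some cuts by 2, so it must be chosen where [Z] has slack. The open
    interval between the ends p, q of a shortest [Y]-chord is cut equally by [Y] and [Z].
    Submodularity is applied to pairs of sets meeting in that interval: {p, q} is a defect for [Y],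
    and the extremal choices of x and s leave no defect for [Z]. *)
Lemma uncross_step Y Z K : Y != [::] -> oriented Y -> oriented Z ->
  (forall v, v \in ends Z -> v < K) -> perm_eq (ends Y) (ends Z) ->
  (forall e, e \in Y -> e \notin Z) ->
  (forall i j, i <= j -> cut (itv i j) Y <= cut (itv i j) Z) ->
  exists Z', cmove Z Z' /\ (forall i j, i <= j -> cut (itv i j) Y <= cut (itv i j) Z').
Proof.
move=> Y0 oY oZ ltZ pYZ nYZ leYZ.
have ltY v : v \in ends Y -> v < K by rewrite (perm_mem pYZ); exact: ltZ.
have endsE S : cut S Y + 2 * inside S Y = cut S Z + 2 * inside S Z.
  by rewrite -!count_ends; move/permP: pYZ; exact.
have [|[q p] [qpY _ qp_min]] := @exists_min _ (fun e => e.1 - e.2) Y predT.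
  by rewrite has_predT; case: (Y) Y0.
have lpq : p < q by move/allP: oY => /(_ _ qpY).
have lYpq : linked Y p q by rewrite linkedC /linked qpY.
have qK : q < K by apply: ltY; apply: linked_ends; rewrite linkedC; exact: lYpq.
have pK : p < K by lia.
(* [q, p] is a shortest chord of [Y], so [Z] has no chord inside [p, q]. *)
have noZ u v : linked Z u v -> p <= v -> u <= q -> u <= v.
  move=> uv pv uq; case: leqP => // vu.
  have uvZ : (u, v) \in Z.
    by case: (linked_oriented oZ uv) => [[]//|[h _]]; clear -h vu; lia.
  (* With equal endpoint counts, a smaller cut means at least as many inner chords. So a [Z]-chord
     in [v, u] forces a [Y]-chord there, which by minimality is [p, q] itself. *)
  have [e [eY]] : exists e, [/\ e \in Y, itv v u.+1 e.1 & itv v u.+1 e.2].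
    apply: inside_ex.
    have iZ : 0 < inside (itv v u.+1) Z.
      by apply: (inside_gt0 uv); rewrite /itv; clear -vu; lia.
    by have := leYZ v u.+1 (leqW (ltnW vu)); have := endsE (itv v u.+1); clear -iZ; lia.
  rewrite /itv => h1 h2.
  have := qp_min e eY isT; rewrite /= => h3.
  have o1 : e.2 < e.1 by move/allP: oY => /(_ _ eY).
  have [e1 e2] : u = q /\ v = p by clear -pv uq vu h1 h2 h3 o1; lia.
  by move: (nYZ _ qpY); rewrite -e1 -e2 uvZ.
have noY u v : linked Y u v -> p <= v -> u < q -> u <= v.
  move=> uv pv uq; case: leqP => // vu.
  have uvY : (u, v) \in Y.
    by case: (linked_oriented oY uv) => [[]//|[h _]]; clear -h vu; lia.
  by have := qp_min _ uvY isT; rewrite /=; clear -pv uq vu; lia.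
pose rho := rot_pos p K; pose I := rot_itv p K.
have rho0 : rho p = 0 by rewrite /rho /rot_pos leqnn subnn.
have rhoq : rho q = q - p by rewrite /rho /rot_pos ltnW.
have rhoK v : v < K -> rho v < K by exact: rot_pos_lt.
have rho_inj u v : u < K -> v < K -> rho u = rho v -> u = v.
  exact: rot_pos_inj.
have leI b t : b <= t -> t <= K -> cut (I b t) Y <= cut (I b t) Z.
  move=> bt tK; have [i [j [ij [E|E]]]] := rot_itv_itv pK bt tK.
    rewrite (@cut_ext _ (itv i j) Y) ?(@cut_ext _ (itv i j) Z) ?leYZ // => v h.
      exact: E (ltZ _ h).
    exact: E (ltY _ h).
  rewrite (@cut_ext _ (predC (itv i j)) Y) ?(@cut_ext _ (predC (itv i j)) Z) ?cutC ?leYZ // => v h.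
    exact: E (ltZ _ h).
  exact: E (ltY _ h).
have [y0 py0] : exists y, linked Z p y.
  by apply: ends_linked; rewrite -(perm_mem pYZ); apply: linked_ends lYpq.
have nbrZ v : linked Z p v -> v < K /\ rho q < rho v.
  move=> pv; have vK : v < K by apply: ltZ; apply: linked_ends; rewrite linkedC; exact: pv.
  split=> //; rewrite rhoq; apply: rot_pos_gt => //.
  have := noZ v p; rewrite linkedC => /(_ pv) h.
  by case: (linked_oriented oZ pv) => -[] + _; clear -h; lia.
have [|x [_ px x_min]] := @exists_min _ rho (ends Z) (linked Z p).
  by apply/hasP; exists y0 => //; apply: linked_ends; rewrite linkedC; exact: py0.
have {}x_min v : linked Z p v -> rho x <= rho v.
  by move=> pv; apply: x_min => //; apply: linked_ends; rewrite linkedC; exact: pv.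
have [xK qx] := nbrZ x px.
(* Neither diagram has a chord strictly between p and q, so each endpoint in this interval belongs
   to a cut chord. *)
have cutA : cut (I 1 (rho q)) Y = cut (I 1 (rho q)) Z.
  have inside_I D : oriented D -> (forall v, v \in ends D -> v < K) ->
      (forall u v, linked D u v -> p <= v -> u < q -> u <= v) -> inside (I 1 (rho q)) D = 0.
    move=> oD ltD noD; apply: inside0 => u v uv; rewrite /I /rot_itv -/rho rhoq => hu; apply/negP => hv.
    have uK := ltD _ (linked_ends uv); have := uv; rewrite linkedC => vu.
    have vK := ltD _ (linked_ends vu).
    have hu' : p < u < q by apply: (rot_pos_between lpq qK).
    have hv' : p < v < q by apply: (rot_pos_between lpq qK).
    by have := noD _ _ uv; have := noD _ _ vu; case: (linked_oriented oD uv) => -[+ _]; clear -hu' hv'; lia.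
  have iY := inside_I Y oY ltY noY.
  have iZ := inside_I Z oZ ltZ (fun u v uv pv uq => noZ u v uv pv (ltnW uq)).
  by have := endsE (I 1 (rho q)); rewrite iY iZ; clear; lia.
(* Oriented [Z]-chords that start in [q, x) and cross {p, x}. [Zs] lists both orientations;
   minimising K - rho makes the far end s as far from p as possible. *)
pose cr (e : nat * nat) := [&& rho q <= rho e.1, rho e.1 < rho x & rho x < rho e.2].
pose Zs := Z ++ [seq (e.2, e.1) | e <- Z].
have ZsP u v : ((u, v) \in Zs) = linked Z u v.
  rewrite mem_cat /linked; congr orb; apply/mapP/idP => [[[a b] h [-> ->]] // | h].
  by exists (v, u).
have [|[n s] [nsZ crns s_max]] := @exists_min _ (fun e => K - rho e.2) Zs cr.
  (* Without such a chord, (p, x) and the complement of [q, x] have no defect for [Z] but the defect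
     {p, q} for [Y]. Their intersection is (p, q) and their union misses only x, whose degree is the
     same in both diagrams: this contradicts the cut inequalities. *)
  apply: contraT => /hasPn nocr.
  have cr0 : crossing (I 1 (rho x)) (predC (I (rho q) (rho x).+1)) Z = 0.
    apply: crossing0 => u v uv; rewrite /= /I /rot_itv -/rho negbK => h1 h2 h3.
    have uK := ltZ _ (linked_ends uv).
    have vK : v < K by apply: ltZ; move: uv; rewrite linkedC; apply: linked_ends.
    apply: contraT => h4; have := nocr (u, v); rewrite ZsP /cr /= => /(_ uv) h5.
    have v0 : rho v = 0 by clear -h1 h2 h3 h4 h5; lia.
    have vp : v = p by apply: rho_inj; rewrite // v0 rho0.
    by have := x_min u; rewrite linkedC -vp uv => /(_ isT); clear -h1; lia.
  have crY : 0 < crossing (I 1 (rho x)) (predC (I (rho q) (rho x).+1)) Y.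
    by apply: (@crossing_gt0 _ _ _ q p); rewrite ?[linked _ q p]linkedC //= /I /rot_itv -/rho ?rho0; clear -qx rhoq lpq; lia.
  have sY := cut_submod (I 1 (rho x)) (predC (I (rho q) (rho x).+1)) Y.
  have sZ := cut_submod (I 1 (rho x)) (predC (I (rho q) (rho x).+1)) Z.
  have eU D : cut (predU (I 1 (rho x)) (predC (I (rho q) (rho x).+1))) D
      = cut (I (rho x) (rho x).+1) D.
    rewrite -cutC; apply: cut_ext => v _; rewrite /= /I /rot_itv -/rho.
    by clear -qx rhoq lpq; apply/idP/idP; lia.
  have eI D : cut (predI (I 1 (rho x)) (predC (I (rho q) (rho x).+1))) D
      = cut (I 1 (rho q)) D.
    apply: cut_ext => v _; rewrite /= /I /rot_itv -/rho.
    by clear -qx rhoq lpq; apply/idP/idP; lia.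
  have xY : inside (I (rho x) (rho x).+1) Y = 0.
    apply: inside0 => u v uv; rewrite /I /rot_itv -/rho => hu; apply/negP => hv.
    have uK := ltY _ (linked_ends uv).
    have vK : v < K by apply: ltY; move: uv; rewrite linkedC; apply: linked_ends.
    have E : u = v by apply: rho_inj => //; clear -hu hv; lia.
    by case: (linked_oriented oY uv) => -[+ _]; clear -E; lia.
  have xZ : inside (I (rho x) (rho x).+1) Z = 0.
    apply: inside0 => u v uv; rewrite /I /rot_itv -/rho => hu; apply/negP => hv.
    have uK := ltZ _ (linked_ends uv).
    have vK : v < K by apply: ltZ; move: uv; rewrite linkedC; apply: linked_ends.
    have E : u = v by apply: rho_inj => //; clear -hu hv; lia.
    by case: (linked_oriented oZ uv) => -[+ _]; clear -E; lia.
  have eX := endsE (I (rho x) (rho x).+1).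
  have rxK := rhoK x xK.
  have l1 : cut (I 1 (rho x)) Y <= cut (I 1 (rho x)) Z by apply: leI; clear -qx rxK; lia.
  have l2 : cut (I (rho q) (rho x).+1) Y <= cut (I (rho q) (rho x).+1) Z by apply: leI; clear -qx rxK; lia.
  by move: sY sZ; rewrite !eU !eI !cutC cr0; clear -cutA xY xZ eX l1 l2 crY; lia.
move: crns nsZ s_max; rewrite ZsP /cr /= => /and3P[qn nx xs] ns s_max.
have nK : n < K by apply: ltZ; apply: linked_ends ns.
have sK : s < K by apply: ltZ; move: ns; rewrite linkedC; apply: linked_ends.
have {}s_max u v : linked Z u v -> rho q <= rho u -> rho u < rho x -> rho v <= rho s.
  move=> uv h1 h2.
  have vK : v < K by apply: ltZ; move: uv; rewrite linkedC; apply: linked_ends.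
  case: (leqP (rho v) (rho x)) => h3; first exact: leq_trans h3 (ltnW xs).
  have := s_max (u, v); rewrite ZsP /cr /= => /(_ uv).
  by have := rhoK _ vK; have := rhoK _ sK; rewrite h1 h2 h3; clear; lia.
have [|||Z' [rest [a [b [c [d [mv pZ pZ' sep]]]]]]] :=
  @cmove_of_rot K p n x s Z oZ pK nK xK sK _ _ _ px ns.
- by rewrite -/rho; clear -qn rhoq lpq; lia.
- by rewrite -/rho.
- by rewrite -/rho.
exists Z'; split=> // i j ij.
(* Among the cyclic intervals avoiding p, only those containing x and s but not n lose cut, by 2.
   Such an interval [be, t) is the complement of the union of (p, be) with the complement of [q, t),
   and these two sets meet in (p, q). *)
have key be t : rho n < be -> be <= rho x -> rho s < t -> t <= K ->
    cut (I be t) Y + 2 <= cut (I be t) Z.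
  move=> h1 h2 h3 h4.
  have cr0 : crossing (predC (I (rho q) t)) (I 1 be) Z = 0.
    apply: crossing0 => u v uv; rewrite /= /I /rot_itv -/rho => k1 k2 k3.
    apply/negP => k4.
    have uK := ltZ _ (linked_ends uv).
    have vu := uv; rewrite linkedC in vu.
    have k5 := s_max _ _ vu.
    have u0 : rho u = 0 by clear -k1 k2 k3 k4 k5 h2 h3; lia.
    have up : u = p by apply: rho_inj; rewrite // u0 rho0.
    by have := x_min v; rewrite -up uv => /(_ isT); clear -k3 h2; lia.
  have crY : 0 < crossing (predC (I (rho q) t)) (I 1 be) Y.
    by apply: (@crossing_gt0 _ _ _ p q); rewrite //= /I /rot_itv -/rho ?rho0; clear -rhoq lpq qn h1 h2 h3 xs; lia.
  have sY := cut_submod (predC (I (rho q) t)) (I 1 be) Y.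
  have sZ := cut_submod (predC (I (rho q) t)) (I 1 be) Z.
  have eU D : cut (predU (predC (I (rho q) t)) (I 1 be)) D = cut (I be t) D.
    rewrite -cutC; apply: cut_ext => v _; rewrite /= /I /rot_itv -/rho.
    by clear -qn h1 h2 h3 xs rhoq lpq; apply/idP/idP; lia.
  have eI D : cut (predI (predC (I (rho q) t)) (I 1 be)) D = cut (I 1 (rho q)) D.
    apply: cut_ext => v _; rewrite /= /I /rot_itv -/rho.
    by clear -qn h1 h2 h3 xs rhoq lpq; apply/idP/idP; lia.
  have l1 : cut (I 1 be) Y <= cut (I 1 be) Z by apply: leI; clear -h1 h2 h3 h4 xs; lia.
  have l2 : cut (I (rho q) t) Y <= cut (I (rho q) t) Z by apply: leI; clear -qn h1 h2 h3 h4 xs; lia.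
  by move: sY sZ; rewrite !eU !eI !cutC cr0; clear -cutA crY l1 l2; lia.
have cutZ S : cut S Z = (S p != S x) + ((S n != S s) + cut S rest).
  by rewrite (perm_cut _ pZ) /cut /=; case: (sep S) => -> -> _ _.
have cutZ' S : cut S Z' = (S p != S n) + ((S x != S s) + cut S rest).
  by rewrite (perm_cut _ pZ') /cut /=; case: (sep S) => _ _ -> ->.
have := leYZ _ _ ij.
have [be [t [be0 bt tK E]]] := itv_rot_itv pK ij.
have cutE D : (forall v, v \in ends D -> v < K) -> cut (itv i j) D = cut (I be t) D.
  move=> ltD; case: E => E; first by apply: cut_ext => v /ltD /E.
  by rewrite -[RHS]cutC; apply: cut_ext => v /ltD /E.
have ltZ' v : v \in ends Z' -> v < K.
  by rewrite -(perm_mem (cmove_ends mv)); exact: ltZ.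
rewrite (cutE Y) // (cutE Z) // (cutE Z') //.
have := key be t; rewrite cutZ cutZ'.
have -> : I be t p = false by rewrite /I /rot_itv -/rho rho0; clear -be0; lia.
have En : I be t n = (be <= rho n < t) by [].
have Ex : I be t x = (be <= rho x < t) by [].
have Es : I be t s = (be <= rho s < t) by [].
move: (I be t n) (I be t x) (I be t s) En Ex Es => [] [] []; clear -nx xs tK; rewrite /=; lia.
Qed.

(** Cancelling a common chord lowers the size and a move lowers the weight at constant size, hence
    the induction on their sum. The bound K on the endpoints is fixed once, as both steps preserve
    it. *)
Theorem uncross Y Z : oriented Y -> oriented Z -> perm_eq (ends Y) (ends Z) ->
  (forall i j, i <= j -> cut (itv i j) Y <= cut (itv i j) Z) -> cmoves Z Y.
Proof.
pose K := (\max_(v <- ends Z) v).+1.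
have ltZ v : v \in ends Z -> v < K by move=> h; rewrite ltnS; apply: leq_bigmax_seq.
move: K ltZ => K ltZ oY oZ pYZ leYZ.
have [N] := ubnP (size Z + chord_weight K Z).
elim: N => // N IH in Y Z ltZ oY oZ pYZ leYZ *; rewrite ltnS => leN.
have [/hasP[e eY eZ]|/hasPn nc] := boolP (has (mem Z) Y).
  have pY := perm_to_rem eY; have pZ := perm_to_rem eZ.
  apply: (cmoves_perm pZ (D2' := e :: rem e Y)); first by rewrite perm_sym.
  have cutY S : cut S Y = (S e.1 != S e.2) + cut S (rem e Y) by rewrite (perm_cut _ pY).
  have cutZ S : cut S Z = (S e.1 != S e.2) + cut S (rem e Z) by rewrite (perm_cut _ pZ).
  apply: cmoves_cons; apply: IH.
  - move=> v h; apply: ltZ; rewrite (perm_mem (perm_ends pZ)) (perm_mem (ends_cons _ _)).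
    by rewrite !inE h !orbT.
  - by move: oY; rewrite /oriented (perm_all _ pY) => /andP[].
  - by move: oZ; rewrite /oriented (perm_all _ pZ) => /andP[].
  - move: pYZ; rewrite (permPl (perm_ends pY)) (permPr (perm_ends pZ)).
    by rewrite (permPl (ends_cons _ _)) (permPr (ends_cons _ _)) !perm_cons.
  - by move=> i j ij; have := leYZ i j ij; rewrite cutY cutZ leq_add2l.
  apply: leq_trans leN; rewrite (perm_size pZ) (perm_chord_weight K pZ) addSn ltnS.
  by rewrite leq_add2l /chord_weight /= leq_addl.
have [Y0|Y0] := eqVneq Y [::].
  subst Y; apply: cmoves0.
  by case: Z pYZ {ltZ oZ leYZ leN nc} => // e Z /perm_size.
have [Z' [mv leYZ']] := uncross_step Y0 oY oZ ltZ pYZ nc leYZ.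
apply: cmovesS (mv) _; apply: IH => //.
- by move=> v; rewrite -(perm_mem (cmove_ends mv)); exact: ltZ.
- exact: cmove_oriented mv oZ.
- by rewrite -(permPr (cmove_ends mv)).
have h1 := cmove_weight ltZ mv.
have h2 : size Z' = size Z.
  by have := perm_size (cmove_ends mv); rewrite !size_cat !size_map; lia.
by lia.
Qed.

End Chords3.

(** * From arc diagrams with poles to chord diagrams *)

Section Items.
Implicit Types (D : seq item) (x : item) (E : seq (nat * nat)).

Definition is_pole x := if x is Pole _ then true else false.

(* A pole at r is read as an arc from r to a vertex M beyond all others. *)
Definition item_chord M x := match x with Arc m r => (m, r) | Pole r => (M, r) end.
Definition chord_item M (e : nat * nat) :=
  if e.1 == M then Pole e.2 else Arc e.1 e.2.
Definition item_lt M x := match x with Arc m r => (r < m < M) | Pole r => r < M end.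

(* Contributions of an item to the dimension of the intersection of the submodule
   with [power_im v.-1] and with [bip_image m r]. *)
Definition item_ge v x : nat :=
  match x with Arc n s => (v <= n) + (v <= s) | Pole n => v <= n end.
Definition item_phi m r x : nat :=
  match x with Arc n s => (r <= n) + ((m <= n) && (r <= s)) | Pole n => r <= n end.

Lemma perm_eq_Permutation (T : eqType) (s t : seq T) : perm_eq s t -> Permutation s t.
Proof.
elim: s t => [|x s IH] t; first by rewrite perm_sym => /perm_nilP->.
move=> pst; have xt : x \in t by rewrite -(perm_mem pst) mem_head.
have pt : perm_eq s (rem x t).
  by have := perm_to_rem xt; rewrite -(permPl pst) perm_cons.
apply: perm_trans (perm_skip x (IH _ pt)) _.
elim: t xt {pst pt} => //= y t IHt; rewrite inE eq_sym.
case: eqP => [-> //|_ /= xt].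
exact: perm_trans (perm_swap _ _ _) (perm_skip y (IHt xt)).
Qed.

Lemma item_chordK M x : item_lt M x -> chord_item M (item_chord M x) = x.
Proof.
case: x => [m r|r] /=; rewrite /chord_item /= ?eqxx //.
by case: eqP => // ->; rewrite ltnn andbF.
Qed.

(** Only the largest endpoint m of a move can be the far vertex M. If m = M the move is (B) or (D),
    otherwise it is (A) or (C). *)
Lemma cmove_arc_move M E E' : (forall v, v \in ends E -> v <= M) -> cmove E E' ->
  arc_move (map (chord_item M) E) (map (chord_item M) E').
Proof.
move=> leM [m [n [r [s [rest [/andP[sr rn] nm pE pE']]]]]].
have mM : m <= M.
  by apply: leM; rewrite (perm_mem (perm_ends pE)) (perm_mem (ends_cons _ _)) inE eqxx.
have ci p q : p < M -> chord_item M (p, q) = Arc p q.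
  by rewrite /chord_item /= => /ltn_eqF ->.
have nM : chord_item M (n, s) = Arc n s by apply: ci; lia.
have nM' : chord_item M (n, r) = Arc n r by apply: ci; lia.
have rM : chord_item M (r, s) = Arc r s by apply: ci; lia.
have {}pE := Permutation_map (chord_item M) (perm_eq_Permutation pE).
move: mM; rewrite leq_eqVlt => /orP[/eqP mM|mM].
  have mE q : chord_item M (m, q) = Pole q by rewrite /chord_item mM /= eqxx.
  exists (Arc n s), (Pole r).
  case: pE' => /perm_eq_Permutation/(Permutation_map (chord_item M)) pE'.
    exists (Arc n r), (Pole s), (map (chord_item M) rest).
    split; first by apply: perm_trans pE _; rewrite /= mE nM; exact: perm_swap.
    split; first by apply: perm_trans pE' _; rewrite /= mE nM'; exact: perm_swap.
    by right; exists n, r, s; do ![split => //; try lia]; left.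
  exists (Pole n), (Arc r s), (map (chord_item M) rest).
  split; first by apply: perm_trans pE _; rewrite /= mE nM; exact: perm_swap.
  split; first by move: pE'; rewrite /= mE rM.
  by right; exists n, r, s; do ![split => //; try lia]; right.
have mE q : chord_item M (m, q) = Arc m q by apply: ci.
exists (Arc m r), (Arc n s).
case: pE' => /perm_eq_Permutation/(Permutation_map (chord_item M)) pE'.
  exists (Arc m s), (Arc n r), (map (chord_item M) rest).
  split; first by move: pE; rewrite /= mE nM.
  split; first by move: pE'; rewrite /= mE nM'.
  by left; exists m, n, r, s; do ![split => //; try lia]; left.
exists (Arc m n), (Arc r s), (map (chord_item M) rest).
split; first by move: pE; rewrite /= mE nM.
split; first by move: pE'; rewrite /= mE rM.
by left; exists m, n, r, s; do ![split => //; try lia]; right.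
Qed.

Lemma cmoves_arc_moves M E E' : (forall v, v \in ends E -> v <= M) -> cmoves E E' ->
  exists D', arc_moves (map (chord_item M) E) D' /\
             Permutation D' (map (chord_item M) E').
Proof.
move=> + h; elim: h => [{}E {}E' pE leM | {}E E1 {}E' mv _ IH leM].
  exists (map (chord_item M) E); split; first exact: am_refl.
  exact/Permutation_map/perm_eq_Permutation.
have [|D' [h1 h2]] := IH.
  by move=> v; rewrite -(perm_mem (cmove_ends mv)); exact: leM.
exists D'; split=> //; exact: am_step (cmove_arc_move leM mv) h1.
Qed.

Definition item_ends D := flatten
  [seq (match x with Arc m r => [:: m; r] | Pole r => [:: r] end) | x <- D].

Lemma ends_item_chord M D :
  perm_eq (ends (map (item_chord M) D)) (nseq (count is_pole D) M ++ item_ends D).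
Proof.
elim: D => //= x D IH; rewrite (permPl (ends_cons _ _)).
apply/permP => S; move/permP/(_ S): IH; rewrite /item_ends.
by case: x => [m r|r] /=; rewrite !count_cat ?add0n ?add1n /=; lia.
Qed.

Lemma count_item_ge v D : count (leq v) (item_ends D) = sumn (map (item_ge v) D).
Proof. by rewrite /item_ends; elim: D => //= -[m r|r] D /= ->; lia. Qed.

Lemma cut_item_phi M m r D : r <= m -> m <= M -> all (item_lt M) D ->
  2 * sumn (map (item_phi m r) D) =
  cut (itv r m) (map (item_chord M) D) + sumn (map (item_ge r) D) + sumn (map (item_ge m) D).
Proof.
move=> rm mM; rewrite /cut /itv; elim: D => //= x D IH /andP[xM /IH].
by case: x xM => [n s|s] /= h; lia.
Qed.

(** The inequalities are given for 0 < r < m - 1 only. An interval with at most one point contains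
    no chord, so its cut is fixed by the endpoints; an interval reaching past M is replaced by its
    complement. *)
Theorem arc_moves_of_phi D D' : all item_ok D -> all item_ok D' ->
  (forall v, 0 < v -> sumn (map (item_ge v) D) = sumn (map (item_ge v) D')) ->
  count is_pole D = count is_pole D' ->
  (forall m r, 0 < r -> r.+1 < m ->
     sumn (map (item_phi m r) D) <= sumn (map (item_phi m r) D')) ->
  exists D'', arc_moves D' D'' /\ Permutation D'' D.
Proof.
move=> okD okD' eqge eqpole lephi.
pose M := (\max_(v <- item_ends D ++ item_ends D') v).+1.
have ltM v : v \in item_ends D ++ item_ends D' -> v < M.
  by move=> h; rewrite ltnS; apply: leq_bigmax_seq.
have okends F : all item_ok F -> all (leq 1) (item_ends F).
  elim: F => //= x F IH /andP[okx /IH]; case: x okx => [m r|r] /= h -> //; lia.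
have okM F : all item_ok F -> (forall v, v \in item_ends F -> v < M) -> all (item_lt M) F.
  elim: F => //= x F IH /andP[okx okF] lt.
  rewrite IH ?andbT // => [|v h]; last by apply: lt; rewrite mem_cat h orbT.
  move: lt okx {IH okF}; rewrite /item_ends /=; case: x => [m r|r] lt /=.
    by have := lt m; rewrite inE eqxx => /(_ isT); lia.
  by have := lt r; rewrite inE eqxx => /(_ isT).
have ltD : all (item_lt M) D by apply: okM => // v h; apply: ltM; rewrite mem_cat h.
have ltD' : all (item_lt M) D' by apply: okM => // v h; apply: ltM; rewrite mem_cat h orbT.
have or F : all (item_lt M) F -> oriented (map (item_chord M) F).
  by rewrite /oriented all_map; apply: sub_all => -[m r|r] //= /andP[].
(* Consecutive [item_ge] sums differ by the multiplicity of an endpoint v > 0, and [item_ok]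
   excludes v = 0. *)
have pends : perm_eq (item_ends D) (item_ends D').
  have cmE F v : count_mem v (item_ends F) + count (leq v.+1) (item_ends F) = count (leq v) (item_ends F).
    by elim: (item_ends F) => //= u s <-; case: (ltngtP v u) => /=; lia.
  apply/allP => v _; apply/eqP.
  have [v0|v0] := posnP v.
    have z F : all item_ok F -> count_mem v (item_ends F) = 0.
      move/okends => /allP okF; apply/eqP; rewrite -leqn0 leqNgt -has_count.
      by apply/hasPn => u /okF; rewrite v0 /=; case: u.
    by rewrite !z.
  have := cmE D v; have := cmE D' v; rewrite !count_item_ge (eqge v v0) (eqge v.+1 isT); clear; lia.
pose Y := map (item_chord M) D; pose Z := map (item_chord M) D'.
have pYZ : perm_eq (ends Y) (ends Z).
  by rewrite (permPl (ends_item_chord _ _)) (permPr (ends_item_chord _ _)) eqpole perm_cat2l.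
have bY v : v \in ends Y -> 0 < v <= M.
  rewrite (perm_mem (ends_item_chord _ _)) mem_cat => /orP[|h].
    by rewrite mem_nseq => /andP[_ /eqP->]; rewrite /M ltnS leq0n leqnn.
  have /allP/(_ _ h) /= -> /= := okends _ okD.
  by apply/ltnW/ltM; rewrite mem_cat h.
have bZ v : v \in ends Z -> 0 < v <= M by rewrite -(perm_mem pYZ); exact: bY.
have endsE S : cut S Y + 2 * inside S Y = cut S Z + 2 * inside S Z.
  by rewrite -!count_ends; move/permP: pYZ; exact.
have le1 i j : 0 < i -> i <= j -> j <= M -> cut (itv i j) Y <= cut (itv i j) Z.
  move=> i0 ij jM; have [h|h] := ltnP i.+1 j.
    have h1 := cut_item_phi ij jM ltD; have h2 := cut_item_phi ij jM ltD'.
    have := lephi j i i0 h; rewrite -/Y -/Z in h1 h2.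
    have := eqge i i0; have := eqge j (leq_trans i0 ij).
    clear -h1 h2; lia.
  have in0 F : all (item_lt M) F -> inside (itv i j) (map (item_chord M) F) = 0.
    move=> /or/allP oF; apply/eqP; rewrite -leqn0 leqNgt -has_count; apply/hasPn => e /oF.
    by rewrite /itv; clear -h; lia.
  by have := endsE (itv i j); rewrite !in0 //; clear; lia.
have le0 i j : i <= j -> j <= M -> cut (itv i j) Y <= cut (itv i j) Z.
  move=> ij jM; have [j0|j0] := posnP j.
    rewrite (@cut_ext _ (itv 1 1) Y) ?(@cut_ext _ (itv 1 1) Z).
    - by apply: le1 => //; rewrite /M.
    - by move=> v _; rewrite /itv j0; lia.
    - by move=> v _; rewrite /itv j0; lia.
  rewrite (@cut_ext _ (itv (maxn 1 i) j) Y) ?(@cut_ext _ (itv (maxn 1 i) j) Z).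
  - by apply: le1 => //; lia.
  - by move=> v /bZ; rewrite /itv; lia.
  - by move=> v /bY; rewrite /itv; lia.
have le i j : i <= j -> cut (itv i j) Y <= cut (itv i j) Z.
  move=> ij; have [jM|jM] := leqP j M; first exact: le0.
  have {}ij := leq_trans (geq_minl i M.+1) ij.
  rewrite (@cut_ext _ (predC (itv 0 i)) Y) ?(@cut_ext _ (predC (itv 0 i)) Z) ?cutC.
  - have [iM|iM] := leqP i M; first exact: le0.
    rewrite (@cut_ext _ (predC (itv 0 0)) Y) ?(@cut_ext _ (predC (itv 0 0)) Z) ?cutC ?le0 //.
      by move=> v /bZ; rewrite /itv /=; lia.
    by move=> v /bY; rewrite /itv /=; lia.
  - by move=> v /bZ; rewrite /itv /=; lia.
  - by move=> v /bY; rewrite /itv /=; lia.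
have cm : cmoves Z Y by apply: uncross => //; exact: or.
have leZ v : v \in ends Z -> v <= M by move/bZ/andP=> [].
have [D'' []] := cmoves_arc_moves leZ cm.
have K F : all (item_lt M) F -> map (chord_item M) (map (item_chord M) F) = F.
  by elim: F => //= x F IH /andP[/item_chordK-> /IH->].
by rewrite /Y /Z !K //; exists D''.
Qed.

End Items.

Local Open Scope ring_scope.

(** * Direct sums of Jordan matrices through injections and projections *)

Section Biproduct.
Variable k : fieldType.

Definition inl_mx b1 b2 : 'M[k]_(sumn b1, sumn (b1 ++ b2)) :=
  castmx (erefl, esym (sumn_cat b1 b2)) (row_mx 1%:M 0).
Definition inr_mx b1 b2 : 'M[k]_(sumn b2, sumn (b1 ++ b2)) :=
  castmx (erefl, esym (sumn_cat b1 b2)) (row_mx 0 1%:M).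
Definition prl_mx b1 b2 : 'M[k]_(sumn (b1 ++ b2), sumn b1) :=
  castmx (esym (sumn_cat b1 b2), erefl) (col_mx 1%:M 0).
Definition prr_mx b1 b2 : 'M[k]_(sumn (b1 ++ b2), sumn b2) :=
  castmx (esym (sumn_cat b1 b2), erefl) (col_mx 0 1%:M).

Lemma inl_prl b1 b2 : inl_mx b1 b2 *m prl_mx b1 b2 = 1%:M.
Proof.
rewrite /inl_mx /prl_mx; case: _ / (esym _).
by rewrite !castmx_id mul_row_col mulmx1 mulmx0 addr0.
Qed.
Lemma inl_prr b1 b2 : inl_mx b1 b2 *m prr_mx b1 b2 = 0.
Proof.
rewrite /inl_mx /prr_mx; case: _ / (esym _).
by rewrite !castmx_id mul_row_col mulmx0 mul0mx addr0.
Qed.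
Lemma inr_prl b1 b2 : inr_mx b1 b2 *m prl_mx b1 b2 = 0.
Proof.
rewrite /inr_mx /prl_mx; case: _ / (esym _).
by rewrite !castmx_id mul_row_col mulmx0 mul0mx addr0.
Qed.
Lemma inr_prr b1 b2 : inr_mx b1 b2 *m prr_mx b1 b2 = 1%:M.
Proof.
rewrite /inr_mx /prr_mx; case: _ / (esym _).
by rewrite !castmx_id mul_row_col mulmx1 mulmx0 add0r.
Qed.

Lemma inl_mx_free b1 b2 : row_free (inl_mx b1 b2).
Proof. by apply/row_freeP; exists (prl_mx b1 b2); apply: inl_prl. Qed.
Lemma inr_mx_free b1 b2 : row_free (inr_mx b1 b2).
Proof. by apply/row_freeP; exists (prr_mx b1 b2); apply: inr_prr. Qed.

(** Turns a block matrix cast along [sumn_cat] into composites with injections and projections, for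
    which the biproduct identities suffice. *)
Lemma castmx_block n1 n2 m1 m2 N M (e : (n1 + n2)%N = N) (e' : (m1 + m2)%N = M)
    (A : 'M[k]_(n1, m1)) (B : 'M[k]_(n2, m2)) (C : 'M_(n2, m1)) :
  castmx (e, e') (block_mx A 0 C B) =
  castmx (e, erefl) (col_mx 1%:M 0) *m A *m castmx (erefl, e') (row_mx 1%:M 0)
  + castmx (e, erefl) (col_mx 0 1%:M) *m B *m castmx (erefl, e') (row_mx 0 1%:M)
  + castmx (e, erefl) (col_mx 0 1%:M) *m C *m castmx (erefl, e') (row_mx 1%:M 0).
Proof.
case: _ / e; case: _ / e'; rewrite !castmx_id.
rewrite !mul_col_mx !mul1mx !mul0mx !mul_mx_row !mulmx1 !mulmx0.
by rewrite !add_col_mx !addr0 add0r add_row_mx add0r addr0.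
Qed.

Lemma prl_inl_prr_inr b1 b2 :
  prl_mx b1 b2 *m inl_mx b1 b2 + prr_mx b1 b2 *m inr_mx b1 b2 = 1%:M.
Proof.
have := castmx_block (esym (sumn_cat b1 b2)) (esym (sumn_cat b1 b2)) 1%:M 1%:M 0.
rewrite !mulmx1 mulmx0 mul0mx addr0 => <-.
by rewrite -scalar_mx_block; case: _ / (esym _); rewrite castmx_id.
Qed.

Lemma psumsP a j : reflect (exists2 i, (i <= size a)%N & j = sumn (take i a)) (j \in psums a).
Proof.
apply: (iffP mapP) => -[i]; first by rewrite mem_iota /= ltnS => h ->; exists i.
by move=> h ->; exists i => //; rewrite mem_iota /= ltnS.
Qed.

Lemma sumn_take_le i (a : seq nat) : (sumn (take i a) <= sumn a)%N.
Proof. by rewrite -{2}(cat_take_drop i a) sumn_cat leq_addr. Qed.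

Lemma psums_catl b1 b2 j : (j < sumn b1)%N -> (j \in psums (b1 ++ b2)) = (j \in psums b1).
Proof.
move=> jb; apply/psumsP/psumsP => -[i ib ej].
  have [ib1|ib1] := leqP i (size b1).
    by exists i => //; rewrite ej takel_cat.
  by move: jb; rewrite ej take_cat (leq_gtF (ltnW ib1)) sumn_cat; lia.
by exists i; rewrite ?size_cat ?takel_cat //; lia.
Qed.

Lemma psums_catr b1 b2 j : ((sumn b1 + j)%N \in psums (b1 ++ b2)) = (j \in psums b2).
Proof.
apply/psumsP/psumsP => -[i ib ej].
  move: ej; rewrite take_cat; case: ltnP => h.
    have := sumn_take_le i b1 => h1 h2.
    by exists 0%N => //; rewrite take0 /=; lia.
  rewrite sumn_cat => ej; exists (i - size b1)%N; last by lia.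
  by move: ib; rewrite size_cat; lia.
exists (size b1 + i)%N; first by rewrite size_cat leq_add2l.
by rewrite take_cat (leq_gtF (leq_addr _ _)) addKn sumn_cat ej.
Qed.

Lemma jm_cat b1 b2 : jm k (b1 ++ b2) =
  prl_mx b1 b2 *m jm k b1 *m inl_mx b1 b2 + prr_mx b1 b2 *m jm k b2 *m inr_mx b1 b2.
Proof.
have := castmx_block (esym (sumn_cat b1 b2)) (esym (sumn_cat b1 b2)) (jm k b1) (jm k b2) 0.
rewrite mulmx0 mul0mx addr0 => <-.
apply/matrixP => i j; rewrite castmxE !mxE /= !esymK.
case: splitP => i' /= ei; rewrite !mxE; case: splitP => j' /= ej; rewrite !mxE ei ej //.
- by rewrite psums_catl // ltn_ord.
(* The superdiagonal entry between the two blocks is absent because [sumn b1] is a partial sum. *)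
- case: eqP => //= e; have -> : (sumn b1 + j')%N = sumn b1 by have := ltn_ord i'; lia.
  have := psums_catr b1 b2 0%N; rewrite addn0 => ->.
  by rewrite (_ : _ \in _ = true) //; apply/psumsP; exists 0%N; rewrite ?take0.
- by case: eqP => //= e; have := ltn_ord j'; lia.
by rewrite psums_catr; congr (nat_of_bool (_ && _))%:R; lia.
Qed.

Lemma smap_dsum (X Y : sobj k) : smap (dsum X Y) =
  prl_mx (sa X) (sa Y) *m smap X *m inl_mx (sb X) (sb Y)
  + prr_mx (sa X) (sa Y) *m smap Y *m inr_mx (sb X) (sb Y).
Proof. by rewrite /dsum /= castmx_block mulmx0 mul0mx addr0. Qed.

Lemma inl_jm b1 b2 : inl_mx b1 b2 *m jm k (b1 ++ b2) = jm k b1 *m inl_mx b1 b2.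
Proof.
by rewrite jm_cat mulmxDr !mulmxA inl_prl inl_prr mul1mx !mul0mx addr0.
Qed.
Lemma inr_jm b1 b2 : inr_mx b1 b2 *m jm k (b1 ++ b2) = jm k b2 *m inr_mx b1 b2.
Proof.
by rewrite jm_cat mulmxDr !mulmxA inr_prl inr_prr mul1mx !mul0mx add0r.
Qed.
Lemma jm_prl b1 b2 : jm k (b1 ++ b2) *m prl_mx b1 b2 = prl_mx b1 b2 *m jm k b1.
Proof.
by rewrite jm_cat mulmxDl -!mulmxA inl_prl inr_prl mulmx1 !mulmx0 addr0.
Qed.
Lemma jm_prr b1 b2 : jm k (b1 ++ b2) *m prr_mx b1 b2 = prr_mx b1 b2 *m jm k b2.
Proof.
by rewrite jm_cat mulmxDl -!mulmxA inl_prr inr_prr mulmx1 !mulmx0 add0r.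
Qed.

End Biproduct.

(** * Isomorphisms from coverings of pairs *)

Section Cov.
Variable k : fieldType.
Implicit Types X Y Z U V : sobj k.

(** [valid] without sortedness of the types, which the concatenation in [dsum] destroys. *)
Definition is_obj X := is_obj_map (smap X).

Lemma is_objP X : reflect (row_free (smap X) /\ jm k (sa X) *m smap X = smap X *m jm k (sb X))
  (is_obj X).
Proof. by apply: (iffP andP) => -[h1 h2]; split=> //; apply/eqP. Qed.

Lemma iso_refl X : iso X X.
Proof.
exists 1%:M, 1%:M, 1%:M, 1%:M.
by rewrite /is_mor !mul1mx !mulmx1 !eqxx.
Qed.

Lemma iso_sym X Y : iso X Y -> iso Y X.
Proof. by move=> [p1 [p2 [q1 [q2 [h1 h2 [h3 h4] [h5 h6]]]]]]; exists q1, q2, p1, p2. Qed.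

Lemma is_mor_comp X Y Z p1 p2 q1 q2 :
  @is_mor k X Y p1 p2 -> @is_mor k Y Z q1 q2 -> @is_mor k X Z (p1 *m q1) (p2 *m q2).
Proof.
move=> /and3P[/eqP h1 /eqP h2 /eqP h3] /and3P[/eqP g1 /eqP g2 /eqP g3].
by apply/and3P; split; apply/eqP; rewrite !mulmxA ?h1 ?h2 -?h3 -!mulmxA ?g1 ?g2 ?g3 ?mulmxA ?h3.
Qed.

Lemma iso_trans X Y Z : iso X Y -> iso Y Z -> iso X Z.
Proof.
move=> [p1 [p2 [q1 [q2 [h1 h2 [h3 h4] [h5 h6]]]]]].
move=> [p1' [p2' [q1' [q2' [g1 g2 [g3 g4] [g5 g6]]]]]].
exists (p1 *m p1'), (p2 *m p2'), (q1' *m q1), (q2' *m q2); split.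
- exact: is_mor_comp h1 g1.
- exact: is_mor_comp g2 h2.
- by rewrite !mulmxA -(mulmxA p1) g3 mulmx1 h3 -(mulmxA q1') h4 mulmx1 g4.
- by rewrite !mulmxA -(mulmxA p2) g5 mulmx1 h5 -(mulmxA q2') h6 mulmx1 g6.
Qed.

(* Some k[T]-map from the ambient module of X has image W and maps the submodule of
   X onto A.  If X has the dimension of W this identifies X with the pair (W, A),
   without choosing a basis of W. *)
Definition cov X n (T : 'M[k]_n) p (W : 'M[k]_(p, n)) q (A : 'M[k]_(q, n)) : Prop :=
  exists P : 'M[k]_(sumn (sb X), n),
    [/\ jm k (sb X) *m P = P *m T, (P :=: W)%MS & (smap X *m P :=: A)%MS].

Lemma cov_eqmx X n (T : 'M_n) p (W : 'M_(p, n)) q (A : 'M_(q, n))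
    p' (W' : 'M_(p', n)) q' (A' : 'M_(q', n)) :
  (W :=: W')%MS -> (A :=: A')%MS -> cov X T W A -> cov X T W' A'.
Proof.
move=> eW eA [P [h1 h2 h3]]; exists P; split=> //.
  exact: eqmx_trans h2 eW.
exact: eqmx_trans h3 eA.
Qed.

Definition covers X M := cov X (jm k (sb M)) (1%:M : 'M_(sumn (sb M))) (smap M).

Definition glue b1 b2 n (P1 : 'M[k]_(sumn b1, n)) (P2 : 'M[k]_(sumn b2, n)) :
  'M[k]_(sumn (b1 ++ b2), n) := prl_mx k b1 b2 *m P1 + prr_mx k b1 b2 *m P2.

Lemma inl_glue b1 b2 n (P1 : 'M_(_, n)) P2 : inl_mx k b1 b2 *m glue P1 P2 = P1.
Proof. by rewrite mulmxDr !mulmxA inl_prl inl_prr mul1mx mul0mx addr0. Qed.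

Lemma inr_glue b1 b2 n (P1 : 'M_(_, n)) P2 : inr_mx k b1 b2 *m glue P1 P2 = P2.
Proof. by rewrite mulmxDr !mulmxA inr_prl inr_prr mul1mx mul0mx add0r. Qed.

Lemma glueE b1 b2 n (P : 'M_(_, n)) :
  glue (inl_mx k b1 b2 *m P) (inr_mx k b1 b2 *m P) = P.
Proof. by rewrite /glue !mulmxA -mulmxDl prl_inl_prr_inr mul1mx. Qed.

Lemma glue_eqmx b1 b2 n (P1 : 'M_(sumn b1, n)) (P2 : 'M_(sumn b2, n)) :
  (glue P1 P2 :=: P1 + P2)%MS.
Proof.
apply/eqmxP/andP; split; first by apply: addmx_sub_adds; apply: submxMl.
rewrite addsmx_sub; apply/andP; split.
  by rewrite -[X in (X <= _)%MS](inl_glue P1 P2) submxMl.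
by rewrite -[X in (X <= _)%MS](inr_glue P1 P2) submxMl.
Qed.

Lemma smap_dsumE X Y : smap (dsum X Y) = glue (smap X *m inl_mx k _ _) (smap Y *m inr_mx k _ _).
Proof. by rewrite smap_dsum /glue !mulmxA. Qed.

Lemma smap_dsum_glue X Y n (P1 : 'M_(_, n)) P2 :
  smap (dsum X Y) *m glue P1 P2 = glue (smap X *m P1) (smap Y *m P2).
Proof. by rewrite smap_dsum mulmxDl -!mulmxA inl_glue inr_glue. Qed.

Lemma jm_glue b1 b2 n (P1 : 'M_(_, n)) P2 :
  jm k (b1 ++ b2) *m glue P1 P2 = glue (jm k b1 *m P1) (jm k b2 *m P2).
Proof. by rewrite jm_cat mulmxDl -!mulmxA inl_glue inr_glue. Qed.

Lemma glueM b1 b2 n m (P1 : 'M_(sumn b1, n)) (P2 : 'M_(sumn b2, n)) (M : 'M_(n, m)) :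
  glue P1 P2 *m M = glue (P1 *m M) (P2 *m M).
Proof. by rewrite /glue mulmxDl !mulmxA. Qed.

Lemma cov_dsum X Y n (T : 'M_n) p1 (W1 : 'M_(p1, n)) q1 (A1 : 'M_(q1, n))
    p2 (W2 : 'M_(p2, n)) q2 (A2 : 'M_(q2, n)) :
  cov X T W1 A1 -> cov Y T W2 A2 -> cov (dsum X Y) T (W1 + W2)%MS (A1 + A2)%MS.
Proof.
move=> [P1 [h1 h2 h3]] [P2 [g1 g2 g3]]; exists (glue P1 P2); split.
- by rewrite jm_glue glueM h1 g1.
- exact: eqmx_trans (glue_eqmx _ _) (adds_eqmx h2 g2).
by rewrite smap_dsum_glue; apply: eqmx_trans (glue_eqmx _ _) (adds_eqmx h3 g3).
Qed.

(** Square representatives keep all pairs at one matrix type, whatever the sizes of the summands, so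
    that inductions over lists of summands go through. *)
Lemma cov_dsum_inv X Y n (T : 'M_n) p (W : 'M_(p, n)) q (A : 'M_(q, n)) :
  cov (dsum X Y) T W A -> exists (W1 A1 W2 A2 : 'M_n),
    [/\ cov X T W1 A1, cov Y T W2 A2, (W1 + W2 :=: W)%MS & (A1 + A2 :=: A)%MS].
Proof.
move=> [P]; rewrite -(glueE P); move: (inl_mx _ _ _ *m P) (inr_mx _ _ _ *m P) => P1 P2 [h1 h2 h3].
exists <<P1>>%MS, <<smap X *m P1>>%MS, <<P2>>%MS, <<smap Y *m P2>>%MS.
rewrite /= jm_glue glueM in h1.
split.
- exists P1; split; rewrite ?genmxE //; try exact: eqmx_sym (genmxE _).
  by rewrite -(inl_glue (_ *m P1) (jm k (sb Y) *m P2)) h1 inl_glue.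
- exists P2; split; try exact: eqmx_sym (genmxE _).
  by rewrite -(inr_glue (jm k (sb X) *m P1) (_ *m P2)) h1 inr_glue.
- apply: eqmx_trans h2; apply: eqmx_trans (eqmx_sym (glue_eqmx _ _)).
  by apply: adds_eqmx; apply: genmxE.
apply: eqmx_trans h3; rewrite smap_dsum_glue; apply: eqmx_trans (eqmx_sym (glue_eqmx _ _)).
by apply: adds_eqmx; apply: genmxE.
Qed.

Lemma cov_push X n (T : 'M_n) p (W : 'M_(p, n)) q (A : 'M_(q, n)) n' (T' : 'M_n') (J : 'M_(n, n')) :
  T *m J = J *m T' -> cov X T W A -> cov X T' (W *m J) (A *m J).
Proof.
move=> TJ [P [h1 h2 h3]]; exists (P *m J); split.
- by rewrite mulmxA h1 -!mulmxA TJ.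
- exact: eqmxMr.
by rewrite mulmxA; apply: eqmxMr.
Qed.

(** A surjection between ambient modules of equal dimension is invertible. It carries one submodule
    onto the other, so injectivity of both embeddings lets it and its inverse restrict. *)
Lemma iso_of_cov X Y : is_obj X -> is_obj Y -> sumn (sb X) = sumn (sb Y) ->
  covers X Y -> iso X Y.
Proof.
move=> /is_objP[fX cX] /is_objP[fY cY] eXY [P [h1 h2 h3]].
have fullP : row_full P by rewrite /row_full h2 mxrank1.
have freeP : row_free P by rewrite /row_free h2 mxrank1 eXY.
have [Q PQ QP] : exists2 Q, P *m Q = 1%:M & Q *m P = 1%:M.
  by exists (pinvmx P); rewrite ?mulmxVp ?mulVpmx.
have hQ : jm k (sb Y) *m Q = Q *m jm k (sb X).
  by rewrite -[LHS]mul1mx -QP -!mulmxA (mulmxA P) -h1 -(mulmxA _ P) PQ mulmx1.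
have [p1 hp1] : exists p1, p1 *m smap Y = smap X *m P.
  by exists (smap X *m P *m pinvmx (smap Y)); rewrite mulmxKpV // h3.
have [q1 hq1] : exists q1, q1 *m smap X = smap Y *m Q.
  exists (smap Y *m Q *m pinvmx (smap X)).
  by rewrite mulmxKpV // -[X in (_ <= X)%MS]mulmx1 -PQ mulmxA submxMr // h3.
exists p1, P, q1, Q; split.
- apply/and3P; split; apply/eqP => //.
  by apply: (row_free_inj fY); rewrite -!mulmxA hp1 cY !mulmxA hp1 cX -!mulmxA h1.
- apply/and3P; split; apply/eqP => //.
  by apply: (row_free_inj fX); rewrite -!mulmxA hq1 cX !mulmxA hq1 cY -!mulmxA hQ.
- split.
    by apply: (row_free_inj fX); rewrite mul1mx -mulmxA hq1 mulmxA hp1 -mulmxA PQ mulmx1.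
  by apply: (row_free_inj fY); rewrite mul1mx -mulmxA hp1 mulmxA hq1 -mulmxA QP mulmx1.
by split.
Qed.

Lemma mutual_inv_dim m n (P : 'M[k]_(m, n)) Q : P *m Q = 1%:M -> Q *m P = 1%:M -> m = n.
Proof.
by move=> /mulmx1_min h1 /mulmx1_min h2; apply/eqP; rewrite eqn_leq h1 h2.
Qed.

Lemma iso_dim X Y : iso X Y -> sumn (sb X) = sumn (sb Y).
Proof. by move=> [p1 [p2 [q1 [q2 [_ _ _ [h1 h2]]]]]]; apply: mutual_inv_dim h1 h2. Qed.

Lemma cov_of_iso X Y : iso X Y -> covers X Y.
Proof.
move=> [p1 [p2 [q1 [q2 [/and3P[/eqP g1 /eqP g2 /eqP g3] _ [h1 h2] [h3 h4]]]]]].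
have full m n (P : 'M[k]_(m, n)) Q : Q *m P = 1%:M -> (P :=: (1%:M : 'M_n))%MS.
  by move=> QP; apply/eqmxP/andP; split; rewrite ?submx1 // -QP submxMl.
exists p2; split=> //; first exact: full h4.
rewrite -g3; apply: eqmxMfull; rewrite /row_full (full _ _ _ _ h2) mxrank1 //.
Qed.

Lemma iso_obj X Y : iso X Y -> is_obj X -> is_obj Y.
Proof.
move=> [p1 [p2 [q1 [q2 [/and3P[/eqP g1 /eqP g2 /eqP g3] /and3P[/eqP k1 /eqP k2 /eqP k3] [h1 h2] [h3 h4]]]]]].
move=> /is_objP[fX cX]; have eY : smap Y = q1 *m smap X *m p2.
  by rewrite -mulmxA -g3 mulmxA h2 mul1mx.
apply/is_objP; split; last by rewrite eY !mulmxA k1 -!mulmxA -g2 !mulmxA -(mulmxA q1 _ (smap X)) cX !mulmxA.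
case/row_freeP: fX => F XF; apply/row_freeP; exists (q2 *m F *m p1).
by rewrite eY -!mulmxA (mulmxA p2) h3 mul1mx (mulmxA _ F) XF mul1mx h2.
Qed.

Lemma is_obj_dsum X Y : is_obj X -> is_obj Y -> is_obj (dsum X Y).
Proof.
move=> /is_objP[fX cX] /is_objP[fY cY]; apply/is_objP; split.
  case/row_freeP: fX => F XF; case/row_freeP: fY => G YG.
  apply/row_freeP; exists (glue (F *m inl_mx k _ _) (G *m inr_mx k _ _)).
  by rewrite smap_dsum_glue !mulmxA XF YG !mul1mx /glue prl_inl_prr_inr.
have e := smap_dsumE X Y.
rewrite {1}e jm_glue !mulmxA cX cY smap_dsum mulmxDl -!mulmxA inl_jm inr_jm.
by rewrite /glue !mulmxA.
Qed.

Lemma is_obj_zero : is_obj (zero_obj k).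
Proof. by apply/is_objP; split; [rewrite /row_free mxrank0 | rewrite mulmx0 mul0mx]. Qed.

Lemma cov_dsum_map X Y X' Y' n (T : 'M_n) :
  (forall W A : 'M_n, cov X T W A -> cov X' T W A) -> (forall W A : 'M_n, cov Y T W A -> cov Y' T W A) ->
  forall p (W : 'M_(p, n)) q (A : 'M_(q, n)), cov (dsum X Y) T W A -> cov (dsum X' Y') T W A.
Proof.
move=> hX hY p W q A /cov_dsum_inv[W1 [A1 [W2 [A2 [/hX c1 /hY c2 eW eA]]]]].
exact: cov_eqmx eW eA (cov_dsum c1 c2).
Qed.

Lemma cov_dsumC X Y n (T : 'M_n) p (W : 'M_(p, n)) q (A : 'M_(q, n)) :
  cov (dsum X Y) T W A -> cov (dsum Y X) T W A.
Proof.
move=> /cov_dsum_inv[W1 [A1 [W2 [A2 [c1 c2 eW eA]]]]].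
by apply: cov_eqmx (cov_dsum c2 c1); rewrite addsmxC.
Qed.

Lemma cov_dsumA X Y Z n (T : 'M_n) p (W : 'M_(p, n)) q (A : 'M_(q, n)) :
  cov (dsum (dsum X Y) Z) T W A <-> cov (dsum X (dsum Y Z)) T W A.
Proof.
split=> /cov_dsum_inv[W1 [A1 [W2 [A2 [c1 c2 eW eA]]]]].
  have [W3 [A3 [W4 [A4 [c3 c4 eW' eA']]]]] := cov_dsum_inv c1.
  apply: cov_eqmx (cov_dsum c3 (cov_dsum c4 c2)); rewrite addsmxA.
    exact: eqmx_trans (adds_eqmx eW' (eqmx_refl _)) eW.
  exact: eqmx_trans (adds_eqmx eA' (eqmx_refl _)) eA.
have [W3 [A3 [W4 [A4 [c3 c4 eW' eA']]]]] := cov_dsum_inv c2.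
apply: cov_eqmx (cov_dsum (cov_dsum c1 c3) c4); rewrite -addsmxA.
  exact: eqmx_trans (adds_eqmx (eqmx_refl _) eW') eW.
exact: eqmx_trans (adds_eqmx (eqmx_refl _) eA') eA.
Qed.

Lemma cov_dsum0 Z X n (T : 'M_n) p (W : 'M_(p, n)) q (A : 'M_(q, n)) : sumn (sb Z) = 0%N ->
  cov (dsum Z X) T W A <-> cov X T W A.
Proof.
move=> Z0; have z (P : 'M[k]_(sumn (sb Z), n)) : P = 0.
  by apply/matrixP => -[i lti]; exfalso; move: (lti); rewrite {1}Z0.
split=> [/cov_dsum_inv[W1 [A1 [W2 [A2 [[P [_]]]]]]]|c].
  rewrite (z P) mulmx0 => h1 h2 c2 eW eA; apply: cov_eqmx c2.
    exact: eqmx_trans (eqmx_sym (adds0mx _ _)) (eqmx_trans (adds_eqmx h1 (eqmx_refl _)) eW).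
  exact: eqmx_trans (eqmx_sym (adds0mx _ _)) (eqmx_trans (adds_eqmx h2 (eqmx_refl _)) eA).
have c0 : cov Z T (0 : 'M_n) (0 : 'M_n).
  by exists 0; split; rewrite ?mulmx0 ?mul0mx //; apply/eqmxP; rewrite !sub0mx.
by apply: cov_eqmx (cov_dsum c0 c); apply: adds0mx.
Qed.

Lemma cov_perm xs ys n (T : 'M_n) : Permutation xs ys ->
  forall p (W : 'M_(p, n)) q (A : 'M_(q, n)), cov (dsum_list xs) T W A -> cov (dsum_list ys) T W A.
Proof.
elim=> [|x l l' _ IH|x y l|l l' l'' _ IH1 _ IH2] p W q A //=.
- by apply: cov_dsum_map => // W' A'; apply: IH.
- by move/cov_dsumA => c; apply/cov_dsumA; apply: cov_dsum_map c => // W' A'; apply: cov_dsumC.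
by move=> /IH1/IH2.
Qed.

Lemma cov_list_cat xs ys n (T : 'M_n) p (W : 'M_(p, n)) q (A : 'M_(q, n)) :
  cov (dsum_list (xs ++ ys)) T W A <-> cov (dsum (dsum_list xs) (dsum_list ys)) T W A.
Proof.
elim: xs p W q A => [|x xs IH] p W q A /=; first by split=> /cov_dsum0; apply.
by split=> [|/cov_dsumA] c; [apply/cov_dsumA|]; apply: cov_dsum_map c => // W' A' /IH.
Qed.

End Cov.

(** * Cyclic submodules and pickets *)

Section Krylov.
Variable k : fieldType.

Section Kry.
Variables (n : nat) (T : 'M[k]_n).
Implicit Types (v w : 'rV[k]_n).

(** If v T^c = 0, this is the matrix of the map from N_(c) sending the generator to v. The choice c
    = n in [kry] reaches every nonzero power when T^n = 0. *)
Definition chain v c : 'M[k]_(c, n) := \matrix_(i < c) (v *m T ^+ i).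
Definition kry v : 'M[k]_n := chain v n.

Lemma mulmx_expS v i : v *m T ^+ i.+1 = v *m T ^+ i *m T.
Proof. by rewrite exprSr mulmxA. Qed.

Lemma mulmx_expD v i j : v *m T ^+ (i + j) = v *m T ^+ i *m T ^+ j.
Proof. by rewrite exprD mulmxA. Qed.

Lemma mulmx_exp_ge0 v i j : (i <= j)%N -> v *m T ^+ i = 0 -> v *m T ^+ j = 0.
Proof. by move=> ij v0; rewrite -(subnKC ij) mulmx_expD v0 mul0mx. Qed.

Lemma chain_sub v c m (S : 'M_(m, n)) : (S *m T <= S)%MS -> (v <= S)%MS -> (chain v c <= S)%MS.
Proof.
move=> TS vS; apply/row_subP => i; rewrite rowK.
elim: (i : nat) => [|j IH]; first by rewrite expr0 mulmx1.
by rewrite mulmx_expS (submx_trans _ TS) // submxMr.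
Qed.

Hypothesis nilT : T ^+ n = 0.

Lemma mem_kry v i : (v *m T ^+ i <= kry v)%MS.
Proof.
have [ni|ni] := ltnP i n.
  by have := row_sub (Ordinal ni) (kry v); rewrite rowK.
by rewrite -(subnKC ni) exprD nilT mul0r mulmx0 sub0mx.
Qed.

Lemma chain_kry v c : v *m T ^+ c = 0 -> (chain v c :=: kry v)%MS.
Proof.
move=> v0; apply/eqmxP/andP; split; apply/row_subP => i; rewrite rowK ?mem_kry //.
have [ci|ci] := ltnP i c; last by rewrite (mulmx_exp_ge0 ci v0) sub0mx.
by have := row_sub (Ordinal ci) (chain v c); rewrite rowK.
Qed.

Lemma kry_stable v : (kry v *m T <= kry v)%MS.
Proof.
by apply/row_subP => i; rewrite row_mul rowK -mulmx_expS mem_kry.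
Qed.

Lemma self_kry v : (v <= kry v)%MS.
Proof. by have := mem_kry v 0; rewrite expr0 mulmx1. Qed.

Lemma kry_sub v m (S : 'M_(m, n)) : (S *m T <= S)%MS -> (kry v <= S)%MS = (v <= S)%MS.
Proof.
move=> TS; apply/idP/idP; first exact/submx_trans/self_kry.
exact: chain_sub.
Qed.

Lemma adds_stable m1 m2 (S1 : 'M_(m1, n)) (S2 : 'M_(m2, n)) :
  (S1 *m T <= S1)%MS -> (S2 *m T <= S2)%MS -> ((S1 + S2)%MS *m T <= (S1 + S2)%MS)%MS.
Proof. by move=> h1 h2; rewrite addsmxMr addsmxS. Qed.

End Kry.

Lemma kry0 n (T : 'M[k]_n) : kry T 0 = 0.
Proof. by apply/row_matrixP => i; rewrite rowK mul0mx row0. Qed.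

Lemma jm_exp b i (r c : 'I_(sumn b)) :
  (c != r + i :> nat)%N -> (jm k b ^+ i) r c = 0.
Proof.
elim: i r c => [|i IH] r c.
  by rewrite addn0 expr0 !mxE eq_sym => /negbTE; rewrite -val_eqE /= => ->.
move=> ne; rewrite exprSr mxE big1 // => l _.
have [e|ne'] := eqVneq (l : nat) (r + i)%N; last by rewrite IH ?mul0r.
rewrite !mxE; case: eqP => [e'|]; last by rewrite mulr0.
by case/eqP: ne; rewrite e' e addnS.
Qed.

Lemma jm_nilp b : jm k b ^+ sumn b = 0.
Proof.
apply/matrixP => r c; rewrite jm_exp ?mxE //.
by rewrite neq_ltn (leq_trans (ltn_ord c)) ?leq_addl.
Qed.

(** Rows of Jordan matrices and of embeddings select one basis vector or none; the flag [b] and the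
    test c < N record whether the end of a chain has been passed. *)
Lemma row_select N n (M : 'rV[k]_N) (P : 'M[k]_(N, n)) (w : nat -> 'rV[k]_n) c (b : bool) :
  (forall l, M 0 l = ((l == c :> nat) && b)%:R) -> (forall l, row l P = w l) ->
  M *m P = if b && (c < N)%N then w c else 0.
Proof.
move=> hM hP; rewrite mulmx_sum_row.
case: b hM => /= hM; last by rewrite big1 // => l _; rewrite hM andbF scale0r.
case: ltnP => cN.
  rewrite (bigD1 (Ordinal cN)) //= big1 ?addr0 => [|l ne].
    by rewrite hM /= eqxx scale1r hP.
  by rewrite hM andbT -val_eqE /= in ne *; rewrite (negbTE ne) scale0r.
rewrite big1 // => l _; rewrite hM (_ : (l == c :> nat) = false) ?scale0r //.
by apply/negbTE; rewrite neq_ltn (leq_trans (ltn_ord l)).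
Qed.

Lemma mem_psums1 m j : (j \in psums [:: m]) = (j == 0)%N || (j == m + 0)%N.
Proof.
rewrite /psums /= !inE. by [].
Qed.

(* Row r of a k[T]-map out of N_(m) is the image of T^r e. *)
Lemma jm1_chain n (T : 'M[k]_n) v m : v *m T ^+ m = 0 ->
  jm k [:: m] *m chain T v (sumn [:: m]) = chain T v (sumn [:: m]) *m T.
Proof.
move=> v0; apply/row_matrixP => i; rewrite row_mul [RHS]row_mul rowK -mulmx_expS.
rewrite (@row_select _ _ _ _ (fun j => v *m T ^+ j) i.+1 (i.+1 != m + 0)%N).
- rewrite /=; case: ifP => //; move=> h; rewrite (_ : i.+1 = m) ?v0 //.
  by have := ltn_ord i; move: h => /=; lia.
- move=> l; rewrite !mxE mem_psums1; case: eqP => //= ->.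
  by rewrite negb_or /=.
by move=> l; rewrite rowK.
Qed.

Lemma jm1_chain_inv n (T : 'M[k]_n) m (P : 'M[k]_(sumn [:: m], n)) : (0 < m)%N ->
  jm k [:: m] *m P = P *m T -> exists2 v, v *m T ^+ m = 0 & P = chain T v (sumn [:: m]).
Proof.
move=> m0 hP; have N0 : (0 < sumn [:: m])%N by rewrite /= addn0.
pose w j := odflt 0 (omap (fun i => row i P) (insub j)) : 'rV[k]_n.
have wP l : row l P = w l by rewrite /w valK.
have step i (iN : (i < sumn [:: m])%N) : w i *m T = if (i.+1 < m)%N then w i.+1 else 0.
  have -> : w i = row (Ordinal iN) P by rewrite wP.
  rewrite -row_mul -hP row_mul.
  rewrite (@row_select _ _ _ _ w i.+1 (i.+1 != m + 0)%N) //.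
    by rewrite /=; congr (if _ then _ else _); lia.
  move=> l; rewrite !mxE mem_psums1; case: eqP => //= ->.
  by rewrite negb_or /=.
exists (w 0%N).
  have h i : (i < m)%N -> w 0%N *m T ^+ i = w i.
    elim: i => [|i IH] im; first by rewrite expr0 mulmx1.
    rewrite mulmx_expS IH; last exact: ltnW.
    by rewrite step ?im //= addn0 ltnW.
  rewrite -(prednK m0) mulmx_expS h ?prednK // step /= ?addn0 ?prednK //.
  by rewrite ltnn.
apply/row_matrixP => i; rewrite rowK wP.
have : (i < m)%N by have := ltn_ord i; rewrite /=; lia.
elim: (i : nat) => [|j IH] jm'; first by rewrite expr0 mulmx1.
by rewrite mulmx_expS -IH ?(ltnW jm') // step /= ?addn0 ?(ltnW jm') // jm'.
Qed.

Lemma smap_picket_chain n (T : 'M[k]_n) v l m : (l <= m)%N ->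
  smap (picket k l m) *m chain T v (sumn [:: m]) = chain T (v *m T ^+ (m - l)) (sumn [:: l]).
Proof.
move=> lm; apply/row_matrixP => i; rewrite row_mul rowK -mulmx_expD addnC.
rewrite (@row_select _ _ _ _ (fun j => v *m T ^+ j) (i + (m - l))%N true).
- by rewrite /= ifT //; have := ltn_ord i; rewrite /=; lia.
- by move=> j; rewrite !mxE andbT.
by move=> j; rewrite rowK.
Qed.

Lemma cov_picket n (T : 'M[k]_n) v l m : T ^+ n = 0 -> (l <= m)%N -> v *m T ^+ m = 0 ->
  cov (picket k l m) T (kry T v) (kry T (v *m T ^+ (m - l))).
Proof.
move=> nilT lm v0; exists (chain T v (sumn [:: m])); split.
- exact: jm1_chain.
- by apply: chain_kry; rewrite //= addn0.
rewrite smap_picket_chain //; apply: chain_kry; rewrite //= addn0 -mulmx_expD subnK //.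
Qed.

End Krylov.

(** * Generators of bipickets *)

Section Bipicket.
Variable k : fieldType.

Lemma arc_gen_eq0 n (T : 'M[k]_n) (v w : 'rV[k]_n) m r : (0 < r)%N -> (r < m)%N ->
  v *m T ^+ m = 0 -> w *m T ^+ r = 0 -> (v *m T ^+ (m - 2) + w *m T ^+ r.-1) *m T ^+ 2 = 0.
Proof.
move=> r0 rm v0 w0; rewrite mulmxDl -!mulmx_expD.
rewrite (@mulmx_exp_ge0 _ _ _ _ _ (m - 2 + 2) _ v0); last by lia.
rewrite (@mulmx_exp_ge0 _ _ _ _ _ (r.-1 + 2) _ w0) ?addr0 //; lia.
Qed.

Lemma mul_prlE p b1 b2 (A : 'M[k]_(p, sumn (b1 ++ b2))) i (j : 'I_(sumn b1)) (j' : 'I_(sumn (b1 ++ b2))) :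
  j' = j :> nat -> (A *m prl_mx k b1 b2) i j = A i j'.
Proof.
rewrite /prl_mx; case: _ / (esym _) A j' => A j' ej.
rewrite castmx_id -{1}(hsubmxK A) mul_row_col mulmx1 mulmx0 addr0 mxE.
by congr (A _ _); apply: val_inj.
Qed.

Lemma mul_prrE p b1 b2 (A : 'M[k]_(p, sumn (b1 ++ b2))) i (j : 'I_(sumn b2)) (j' : 'I_(sumn (b1 ++ b2))) :
  j' = (sumn b1 + j)%N :> nat -> (A *m prr_mx k b1 b2) i j = A i j'.
Proof.
rewrite /prr_mx; case: _ / (esym _) A j' => A j' ej.
rewrite castmx_id -{1}(hsubmxK A) mul_row_col mulmx1 mulmx0 add0r mxE.
by congr (A _ _); apply: val_inj.
Qed.

Lemma smap_bipicket_glue n (T : 'M[k]_n) v w m r : (0 < r)%N -> (1 < m)%N ->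
  v *m T ^+ m = 0 -> w *m T ^+ r = 0 ->
  smap (bipicket k m r) *m @glue k [:: m] [:: r] n (chain T v (sumn [:: m])) (chain T w (sumn [:: r]))
   = chain T (v *m T ^+ (m - 2) + w *m T ^+ r.-1) (sumn [:: 2%N]).
Proof.
move=> r0 m1 v0 w0; rewrite /glue mulmxDr !mulmxA.
apply/row_matrixP => i; rewrite [RHS]rowK linearD /= !row_mul.
have i2 : ((i : 'I_(sumn [:: 2%N])) < 2)%N by have := ltn_ord i; rewrite /=; lia.
have hv l : (row i (smap (bipicket k m r)) *m prl_mx k [:: m] [:: r]) 0 l =
    ((l == i + (m - 2) :> nat)%N && true)%:R.
  have ll : (l < sumn ([:: m] ++ [:: r]))%N by have := ltn_ord l; rewrite /=; lia.
  rewrite (@mul_prlE _ [:: m] [:: r] _ _ _ (Ordinal ll)) // !mxE /= andbT.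
  by congr (nat_of_bool _)%:R; have := ltn_ord l; move: i2; rewrite /=; lia.
have hw l : (row i (smap (bipicket k m r)) *m prr_mx k [:: m] [:: r]) 0 l =
    ((l == r.-1 + i :> nat)%N && true)%:R.
  have ll : (m + l < sumn ([:: m] ++ [:: r]))%N by have := ltn_ord l; rewrite /=; lia.
  rewrite (@mul_prrE _ [:: m] [:: r] _ _ _ (Ordinal ll)); last by rewrite /= (addn0 m).
  rewrite !mxE /= andbT.
  by congr (nat_of_bool _)%:R; have := ltn_ord l; move: i2; rewrite /=; lia.
rewrite (row_select (w := fun j => v *m T ^+ j) hv) => [|l]; last by rewrite rowK.
rewrite (row_select (w := fun j => w *m T ^+ j) hw) => [|l]; last by rewrite rowK.
rewrite mulmxDl -!mulmx_expD addnC /=.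
case: ifP => h1; last by move: h1 i2 => /=; clear -m1; lia.
(* Row 1 of the embedding has no entry in the block of r: its column would be m + r. This matches w
   T^r = 0. *)
congr (_ + _); case: ifP => // h2; rewrite (_ : r.-1 + i = r)%N ?w0 //.
by move: h2 i2 => /=; clear -r0; lia.
Qed.

Lemma cov_bipicket n (T : 'M[k]_n) v w m r : T ^+ n = 0 -> (0 < r)%N -> (r < m)%N ->
  v *m T ^+ m = 0 -> w *m T ^+ r = 0 ->
  cov (bipicket k m r) T (kry T v + kry T w)%MS (kry T (v *m T ^+ (m - 2) + w *m T ^+ r.-1)).
Proof.
move=> nilT r0 rm v0 w0; exists (@glue k [:: m] [:: r] n (chain T v (sumn [:: m])) (chain T w (sumn [:: r]))).
split.
- by rewrite (@jm_glue k [:: m] [:: r]) (@glueM k [:: m] [:: r]) !jm1_chain.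
- apply: eqmx_trans (@glue_eqmx k [:: m] [:: r] _ _ _) _; apply: adds_eqmx; apply: chain_kry; rewrite //= addn0 //.
rewrite smap_bipicket_glue //; last by lia.
by apply: chain_kry => //=; apply: arc_gen_eq0.
Qed.

Lemma cov_bipicket_inv n (T : 'M[k]_n) m r p (W : 'M_(p, n)) q (A : 'M_(q, n)) :
  T ^+ n = 0 -> (0 < r)%N -> (r < m)%N -> cov (bipicket k m r) T W A ->
  exists v w, [/\ v *m T ^+ m = 0, w *m T ^+ r = 0, (kry T v + kry T w :=: W)%MS &
     (kry T (v *m T ^+ (m - 2) + w *m T ^+ r.-1) :=: A)%MS].
Proof.
move=> nilT r0 rm [P]; rewrite -(@glueE k [:: m] [:: r] n P).
move: (inl_mx k [:: m] [:: r] *m P) (inr_mx k [:: m] [:: r] *m P) => P1 P2 [h1 h2 h3].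
rewrite (@jm_glue k [:: m] [:: r]) (@glueM k [:: m] [:: r]) in h1.
have m0 : (0 < m)%N by lia.
have /(jm1_chain_inv m0)[v v0 e1] : jm k [:: m] *m P1 = P1 *m T.
  by rewrite -(inl_glue (_ *m P1) (jm k [:: r] *m P2)) h1 inl_glue.
have /(jm1_chain_inv r0)[w w0 e2] : jm k [:: r] *m P2 = P2 *m T.
  by rewrite -(inr_glue (jm k [:: m] *m P1) (_ *m P2)) h1 inr_glue.
exists v, w; split=> //.
  apply: eqmx_trans h2; apply: eqmx_trans (eqmx_sym (@glue_eqmx k [:: m] [:: r] _ _ _)).
  by apply: adds_eqmx; apply/eqmx_sym; rewrite ?e1 ?e2; apply: chain_kry; rewrite //= addn0.
apply: eqmx_trans h3; rewrite e1 e2 smap_bipicket_glue //; last by lia.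
by apply/eqmx_sym/chain_kry => //=; apply: arc_gen_eq0.
Qed.

(* [picket 2 n + picket 0 (n-1)] is the degenerate bipicket (n, n-1). *)
Lemma cov_bipicket_succ n (T : 'M[k]_n) r p (W : 'M_(p, n)) q (A : 'M_(q, n)) : T ^+ n = 0 -> (0 < r)%N ->
  cov (bipicket k r.+1 r) T W A -> cov (dsum (picket k 2 r.+1) (picket k 0 r)) T W A.
Proof.
move=> nilT r0 /cov_bipicket_inv[] // v [w [v0 w0 eW eA]].
(* For m = r + 1 the exponents m - 2 and r - 1 agree, so v + w alone generates the P_2^{r+1}. *)
have vw0 : (v + w) *m T ^+ r.+1 = 0.
  by rewrite mulmxDl v0 (mulmx_exp_ge0 _ w0) ?addr0.
apply: cov_eqmx (cov_dsum (cov_picket (l := 2) nilT _ vw0) (cov_picket (l := 0) nilT _ w0)) => //; last first.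
- apply: eqmx_trans eA; rewrite subn0 w0 kry0 subSS -subn1 mulmxDl.
  exact: addsmx0.
apply: eqmx_trans eW; apply/eqmxP/andP; split; rewrite addsmx_sub; apply/andP; split.
- rewrite kry_sub //; last by rewrite adds_stable ?kry_stable.
  by apply: addmx_sub_adds; apply: self_kry.
- exact: addsmxSr.
- rewrite kry_sub //; last by rewrite adds_stable ?kry_stable.
  rewrite -[X in (X <= _)%MS](addrK w v); apply: addmx_sub_adds; first exact: self_kry.
  by rewrite eqmx_opp self_kry.
exact: addsmxSr.
Qed.

Lemma row_free_select a n (M : 'M[k]_(a, n)) d : (a + d <= n)%N ->
  (forall i j, M i j = (j == i + d :> nat)%N%:R) -> row_free M.
Proof.
move=> adn hM; apply/row_freeP; exists M^T; apply/matrixP => i j; rewrite !mxE.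
have idn : (i + d < n)%N by have := ltn_ord i; lia.
rewrite (bigD1 (Ordinal idn)) //= big1 ?addr0 => [|l ne].
  by rewrite !mxE !hM /= eqxx mul1r eqn_add2r.
by rewrite hM; case: eqP => e; rewrite ?mul0r //; case/eqP: ne; apply: val_inj.
Qed.

Lemma picket_jm l m : (l <= m)%N ->
  jm k [:: l] *m smap (picket k l m) = smap (picket k l m) *m jm k [:: m].
Proof.
case: m => [|m] lm.
  move: lm; rewrite leqn0 => /eqP->; by apply/matrixP => -[].
have := mulmx1 (jm k [:: m.+1]).
rewrite -{2}(mul1mx (jm k [:: m.+1])) => /(jm1_chain_inv (ltn0Sn m))[v v0 e].
rewrite -[smap _]mulmx1 e smap_picket_chain // jm1_chain //.
by rewrite -mulmx_expD subnK.
Qed.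

Lemma is_obj_picket l m : (l <= m)%N -> is_obj (picket k l m).
Proof.
move=> lm; apply/is_objP; split; last exact: picket_jm.
by apply: (@row_free_select _ _ _ (m - l)%N) => [|i j]; rewrite ?mxE //=; lia.
Qed.

(** The identity of N_(m) commutes with T, hence is itself a chain; its first row is the wanted
    generator. The injections play this part for bipickets. *)
Lemma picket_gens l m : (0 < m)%N -> (l <= m)%N ->
  exists v : 'rV[k]_(sumn [:: m]), let T := jm k [:: m] in
  [/\ v *m T ^+ m = 0, (kry T v :=: (1%:M : 'M_(sumn [:: m])))%MS &
      picket k l m = @SObj k [:: l] [:: m] (chain T (v *m T ^+ (m - l)) (sumn [:: l]))].
Proof.
move=> m0 lm; have := mulmx1 (jm k [:: m]).
rewrite -{2}(mul1mx (jm k [:: m])) => /(jm1_chain_inv m0)[v v0 e].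
exists v; split=> //.
  rewrite {1}e; apply: eqmx_sym; apply: (@chain_kry _ _ _ (jm_nilp k [:: m])).
  by apply: mulmx_exp_ge0 v0; rewrite /= leq_addr.
by rewrite -smap_picket_chain // -e mulmx1.
Qed.

Lemma bipicket_gens m r : (0 < r)%N -> (r < m)%N ->
  exists v w : 'rV[k]_(sumn [:: m; r]), let T := jm k [:: m; r] in
  [/\ v *m T ^+ m = 0, w *m T ^+ r = 0,
      (kry T v + kry T w :=: (1%:M : 'M_(sumn [:: m; r])))%MS &
      bipicket k m r = @SObj k [:: 2%N] [:: m; r]
        (chain T (v *m T ^+ (m - 2) + w *m T ^+ r.-1) (sumn [:: 2%N]))].
Proof.
move=> r0 rm; have m0 : (0 < m)%N by lia.
have nilT := jm_nilp k [:: m; r].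
have [v v0 e1] : exists2 v, v *m jm k [:: m; r] ^+ m = 0 &
    inl_mx k [:: m] [:: r] = chain (jm k [:: m; r]) v (sumn [:: m]).
  by apply: jm1_chain_inv => //; rewrite (inl_jm k [:: m] [:: r]).
have [w w0 e2] : exists2 w, w *m jm k [:: m; r] ^+ r = 0 &
    inr_mx k [:: m] [:: r] = chain (jm k [:: m; r]) w (sumn [:: r]).
  by apply: jm1_chain_inv => //; rewrite (inr_jm k [:: m] [:: r]).
exists v, w; split=> //.
  have := @glue_eqmx k [:: m] [:: r] _ (inl_mx k _ _) (inr_mx k _ _).
  rewrite {1}/glue prl_inl_prr_inr => h; apply: eqmx_trans (eqmx_sym h).
  by apply: eqmx_sym; apply: adds_eqmx; rewrite ?e1 ?e2; apply: chain_kry => //;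
    [apply: mulmx_exp_ge0 v0 | apply: mulmx_exp_ge0 w0]; rewrite /= leq_addr.
rewrite -smap_bipicket_glue //; last by lia.
by rewrite -e1 -e2 /glue prl_inl_prr_inr mulmx1.
Qed.

Lemma is_obj_bipicket m r : (0 < r)%N -> (r < m)%N -> is_obj (bipicket k m r).
Proof.
move=> r0 rm; apply/is_objP; split.
  have : row_free (smap (bipicket k m r) *m prl_mx k [:: m] [:: r]).
    apply: (@row_free_select _ _ _ (m - 2)%N) => [|i j]; first by rewrite /=; lia.
    have jj : (j < sumn ([:: m] ++ [:: r]))%N by have := ltn_ord j; rewrite /=; lia.
    rewrite (@mul_prlE _ [:: m] [:: r] _ _ _ (Ordinal jj)) // !mxE /=.
    by congr (nat_of_bool _)%:R; have := ltn_ord j; rewrite /=; lia.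
  by case/row_freeP => F; rewrite -mulmxA => F1; apply/row_freeP; eexists; exact: F1.
have [v [w [v0 w0 _ ->]]] := bipicket_gens r0 rm.
by apply: jm1_chain; apply: arc_gen_eq0.
Qed.

Lemma is_obj_item x : item_ok x -> is_obj (item_obj k x).
Proof.
case: x => [m r|m] /= h; last exact: is_obj_picket.
case: eqP => e; [apply: is_obj_picket | apply: is_obj_bipicket]; lia.
Qed.

End Bipicket.

(** * Functionals that split off chains *)

Section Classification.
Variable k : fieldType.

Lemma functional_out p n (S : 'M[k]_(p, n)) (u : 'rV_n) : ~~ (u <= S)%MS ->
  exists2 f : 'cV_n, S *m f = 0 & u *m f = 1%:M.
Proof.
move=> /negP uS; have [j ne] : exists j, (u *m cokermx S) 0 j != 0.
  apply/existsP; rewrite -negb_forall; apply/negP => /forallP h; apply: uS.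
  by rewrite submxE; apply/eqP/rowP => j; rewrite (eqP (h j)) mxE.
have cE i : (u *m col j (cokermx S)) 0 i = (u *m cokermx S) 0 j.
  by rewrite colE (mulmxA u) -colE mxE.
exists (((u *m cokermx S) 0 j)^-1 *: col j (cokermx S)).
  by rewrite -scalemxAr colE (mulmxA S) mulmx_coker mul0mx scaler0.
apply/matrixP => i i'; rewrite !ord1 -scalemxAr mxE cE mulVf //.
by rewrite mxE eqxx.
Qed.

Lemma functional_ext p n (A : 'M[k]_(p, n)) (N : 'cV_p) :
  (forall x : 'rV_p, x *m A = 0 -> x *m N = 0) -> exists f : 'cV_n, A *m f = N.
Proof.
move=> h; exists (pinvmx A *m N); apply/eqP; rewrite mulmxA -subr_eq0 -{2}(mul1mx N) -mulmxBl.
apply/eqP/row_matrixP => i; rewrite row_mul row0; apply: h.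
by rewrite -row_mul mulmxBl mul1mx mulmxKpV // subrr row0.
Qed.

Section Ann.
Variables (n : nat) (T : 'M[k]_n).
Hypothesis nilT : T ^+ n = 0.
Implicit Types (u v w : 'rV[k]_n) (f : 'cV[k]_n).

(** The largest [T]-stable subspace killed by f; exponents below n suffice by nilpotence. *)
Definition ann f : 'M[k]_n := kermx (\matrix_(i < n, j < n) (T ^+ j *m f) i 0).

Lemma annP u f : reflect (forall j, u *m T ^+ j *m f = 0) (u <= ann f)%MS.
Proof.
have E (j : 'I_n) : (u *m \matrix_(i < n, j < n) (T ^+ j *m f) i 0) 0 j = (u *m T ^+ j *m f) 0 0.
  by rewrite -mulmxA !mxE; apply: eq_bigr => i _; rewrite mxE.
apply: (iffP sub_kermxP) => h.
  move=> j; have [nj|nj] := ltnP j n.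
    apply/matrixP => a b; rewrite !ord1 [RHS]mxE.
    by rewrite -(E (Ordinal nj)) h mxE.
  by rewrite -(subnKC nj) exprD nilT mul0r mulmx0 mul0mx.
by apply/rowP => j; rewrite E h !mxE.
Qed.

Lemma ann_stable f : (ann f *m T <= ann f)%MS.
Proof.
apply/row_subP => i; apply/annP => j; rewrite row_mul -(mulmxA _ T).
have -> : T *m T ^+ j = T ^+ j.+1 by rewrite exprS.
by have /annP := row_sub i (ann f).
Qed.

Lemma stable_socle m (S : 'M[k]_m) (T' : 'M[k]_m) : T' ^+ m = 0 ->
  (S *m T' <= S)%MS -> S != 0 -> exists x : 'rV_m, [/\ x != 0, (x <= S)%MS & x *m T' = 0].
Proof.
move=> nil' TS S0.
have ex : exists j, S *m T' ^+ j == 0 by exists m; rewrite nil' mulmx0.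
case: (ex_minnP ex) => -[|j]; first by rewrite expr0 mulmx1 (negbTE S0).
move=> /eqP j1 jmin.
have /rowV0Pn[x xS x0] : S *m T' ^+ j != 0 by apply/negP => /jmin; rewrite ltnn.
exists x; split=> //.
  apply: submx_trans xS _; elim: j {j1 jmin} => [|j IH]; first by rewrite expr0 mulmx1.
  by rewrite exprSr mulmxA (submx_trans _ TS) // submxMr.
case/submxP: xS => y ->; by rewrite -!mulmxA -[T' ^+ j *m T']/(T' ^+ j * T') -exprSr j1 mulmx0.
Qed.

(** The vectors that [P] maps into [S] form a stable subspace, which is zero because it contains no
    nonzero socle vector. So [P] is injective and its image is independent of [S]. *)
Lemma split_rank (X : sobj k) (P : 'M[k]_(sumn (sb X), n)) m (S : 'M[k]_(m, n)) :
  jm k (sb X) *m P = P *m T -> (S *m T <= S)%MS ->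
  (forall x : 'rV_(sumn (sb X)), x *m jm k (sb X) = 0 -> (x *m P <= S)%MS -> x = 0) ->
  \rank (P + S)%MS = (sumn (sb X) + \rank S)%N.
Proof.
move=> hP TS inj.
have ker0 : kermx (P *m cokermx S) = 0.
  apply/eqP; apply: contraT => /(stable_socle (jm_nilp k (sb X))) [|x [x0 xK xj]].
    apply/sub_kermxP; apply/eqP; rewrite -(mulmxA (kermx _)) (mulmxA (jm k _)) hP.
    have K0 : (kermx (P *m cokermx S) *m P <= S)%MS by rewrite submxE -mulmxA mulmx_ker.
    move: (kermx _) K0 => K K0.
    have : (K *m P *m T <= S)%MS by rewrite (submx_trans _ TS) // submxMr.
    by rewrite submxE (mulmxA K) (mulmxA K).
  case/eqP: x0; apply: inj => //.
  by rewrite submxE -mulmxA; apply/eqP/sub_kermxP.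
have fP : row_free P.
  rewrite -kermx_eq0 -submx0 -ker0; apply/sub_kermxP.
  by rewrite mulmxA mulmx_ker mul0mx.
have cap0 : (P :&: S)%MS = 0.
  apply/eqP; rewrite -submx0; apply/rV_subP => y; rewrite sub_capmx => /andP[/submxP[x ->] xS].
  have : (x <= kermx (P *m cokermx S))%MS.
    by apply/sub_kermxP/eqP; move: xS; rewrite submxE mulmxA.
  by rewrite ker0 submx0 => /eqP->; rewrite mul0mx sub0mx.
have := mxrank_sum_cap P S; rewrite cap0 mxrank0 addn0 => ->.
by rewrite (eqP fP).
Qed.

Lemma stable_exp p (W : 'M[k]_(p, n)) q (U : 'M[k]_(q, n)) i : (W *m T <= W)%MS ->
  (U <= W)%MS -> (U *m T ^+ i <= W)%MS.
Proof.
move=> TW UW; elim: i => [|i IH]; first by rewrite expr0 mulmx1.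
by rewrite exprSr mulmxA (submx_trans _ TW) // submxMr.
Qed.

(* The coefficients of u along the chains of v and w are read off by f and g,
   from the socle downwards; r = 0 is the case of a single chain. *)
Lemma chains_complement (W : 'M[k]_n) v w f g m r :
  (W *m T <= W)%MS -> (v <= W)%MS -> (w <= W)%MS -> (0 < m)%N -> (r < m)%N ->
  v *m T ^+ m = 0 -> w *m T ^+ r = 0 ->
  W *m T ^+ m *m f = 0 -> W *m T ^+ r *m g = 0 ->
  v *m T ^+ m.-1 *m f = 1%:M -> v *m T ^+ m.-1 *m g = 0 ->
  ((0 < r)%N -> w *m T ^+ r.-1 *m g = 1%:M) ->
  (W <= (kry T v + kry T w) + (W :&: (ann f :&: ann g)))%MS.
Proof.
move=> TW vW wW m0 rm v0 w0 Wf Wg vf vg wg.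
set S := (_ + _)%MS.
have Wf' u i : (u <= W)%MS -> (m <= i)%N -> u *m T ^+ i *m f = 0.
  move=> uW mi; rewrite -(subnKC mi) addnC mulmx_expD.
  by have /submxP[y ->] := stable_exp (i - m) TW uW; rewrite -!mulmxA (mulmxA W) Wf mulmx0.
have Wg' u i : (u <= W)%MS -> (r <= i)%N -> u *m T ^+ i *m g = 0.
  move=> uW mi; rewrite -(subnKC mi) addnC mulmx_expD.
  by have /submxP[y ->] := stable_exp (i - r) TW uW; rewrite -!mulmxA (mulmxA W) Wg mulmx0.
have expandG (c d : 'M_1) (y a b : 'rV_n) i (h : 'cV_n) :
    (y - (c *m a + d *m b)) *m T ^+ i *m h =
    y *m T ^+ i *m h - (c *m (a *m T ^+ i *m h) + d *m (b *m T ^+ i) *m h).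
  by rewrite !mulmxBl !mulmxDl !mulmxA.
have key j u : (j <= m)%N -> (u <= W)%MS -> (forall i, (j <= i)%N -> u *m T ^+ i *m f = 0) ->
    (forall i, (j <= i)%N -> u *m T ^+ i *m g = 0) -> (u <= S)%MS.
  elim: j u => [|j IH] u jm uW uf ug.
    apply: submx_trans (addsmxSr _ _); rewrite !sub_capmx uW /=.
    by apply/andP; split; apply/annP => i; [apply: uf | apply: ug].
  (* [d] is the coefficient along the chain of w, which has only r terms. As f need not vanish on
     that chain, [c] is corrected by a multiple of d; g kills v T^{m-1}, so subtracting along v
     leaves the values of g alone. *)
  pose d := if (j < r)%N then u *m T ^+ j *m g else 0.
  pose c := u *m T ^+ j *m f - d *m (w *m T ^+ r.-1 *m f).
  pose vj := v *m T ^+ (m.-1 - j); pose wj := w *m T ^+ (r.-1 - j).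
  have vjE i : vj *m T ^+ i = v *m T ^+ (m.-1 - j + i) by rewrite /vj -mulmx_expD.
  have wjE i : wj *m T ^+ i = w *m T ^+ (r.-1 - j + i) by rewrite /wj -mulmx_expD.
  have vj0 i : (j < i)%N -> vj *m T ^+ i = 0.
    by move=> ji; rewrite vjE; apply: mulmx_exp_ge0 v0; lia.
  have dwj0 i : (j < i)%N -> d *m (wj *m T ^+ i) = 0.
    rewrite /d; case: ifP => jr ji; last by rewrite mul0mx.
    by rewrite wjE (mulmx_exp_ge0 _ w0) ?mulmx0 //; lia.
  have vjj : vj *m T ^+ j = v *m T ^+ m.-1 by rewrite vjE subnK //; lia.
  have dwjj : d *m (wj *m T ^+ j) = d *m (w *m T ^+ r.-1).
    rewrite /d; case: ifP => jr; last by rewrite !mul0mx.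
    by rewrite wjE subnK //; lia.
  have vjW : (vj <= W)%MS by apply: stable_exp.
  have wjW : (wj <= W)%MS by apply: stable_exp.
  pose u' := u - (c *m vj + d *m wj).
  have expand i (h : 'cV_n) : u' *m T ^+ i *m h =
      u *m T ^+ i *m h - (c *m (vj *m T ^+ i *m h) + d *m (wj *m T ^+ i) *m h).
    exact: expandG.
  have u'S : (u' <= S)%MS.
    apply: IH; first exact: ltnW.
    - by rewrite addmx_sub // eqmx_opp addmx_sub // (submx_trans (submxMl _ _)).
    - move=> i; rewrite leq_eqVlt => /orP[/eqP<-|ji]; rewrite expand.
        by rewrite vjj dwjj vf mulmx1 /c -!mulmxA subrK subrr.
      by rewrite vj0 // dwj0 // uf // !mul0mx !mulmx0 addr0 subr0.
    move=> i; rewrite leq_eqVlt => /orP[/eqP<-|ji]; rewrite expand.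
      rewrite vjj dwjj vg mulmx0 add0r -(mulmxA d) /d; case: ifP => jr.
        by rewrite wg ?mulmx1 ?subrr //; lia.
      by rewrite mul0mx subr0 Wg' //; lia.
    by rewrite vj0 // dwj0 // ug // !mul0mx !mulmx0 addr0 subr0.
  rewrite -[u](subrK (c *m vj + d *m wj)) addmx_sub //.
  apply: submx_trans (addsmxSl _ _); apply: addmx_sub_adds; apply: submx_trans (submxMl _ _) _.
    exact: mem_kry.
  exact: mem_kry.
apply/row_subP => i; apply: (key m) => // [|j mj|j mj]; first exact: row_sub.
  by apply: Wf' => //; apply: row_sub.
by apply: Wg' => //; [apply: row_sub | lia].
Qed.

Lemma jm1_ker m (x : 'rV[k]_(sumn [:: m])) : (0 < m)%N -> x *m jm k [:: m] = 0 ->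
  exists c : 'M[k]_1, (c = 0 -> x = 0) /\
    forall v, x *m chain T v (sumn [:: m]) = c *m (v *m T ^+ m.-1).
Proof.
move=> m0 xj; have mm : (m.-1 < sumn [:: m])%N by rewrite /=; lia.
have x0 i : i != Ordinal mm -> x 0 i = 0.
  move=> ne; have im : (i.+1 < sumn [:: m])%N.
    by have := ltn_ord i; move: ne; rewrite -val_eqE /=; lia.
  have := congr1 (fun y : 'rV_(sumn [:: m]) => y 0 (Ordinal im)) xj; rewrite !mxE => <-.
  rewrite (bigD1 i) //= big1 ?addr0 => [|l ne'].
    by rewrite !mxE eqxx mem_psums1 /= (_ : i.+1 != m + 0)%N ?mulr1 //; move: im => /=; lia.
  rewrite !mxE /= (_ : i.+1 == l.+1 = false) ?mulr0 //.
  by rewrite eqSS eq_sym; apply/negbTE.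
exists (x 0 (Ordinal mm))%:M; split.
  move=> /(congr1 (fun y : 'M_1 => y 0 0)); rewrite !mxE eqxx mulr1n => xm.
  by apply/rowP => i; rewrite mxE; have [->|/x0] := eqVneq i (Ordinal mm).
move=> v; rewrite mul_scalar_mx mulmx_sum_row (bigD1 (Ordinal mm)) //= big1 ?addr0 ?rowK //.
by move=> i /x0->; rewrite scale0r.
Qed.

Definition objs D zs : seq (sobj k) := map (@item_obj k) D ++ map (picket k 0) zs.

(** The rank equality makes the covering injective, so that the sum of the items is direct. *)
Definition decomposes (W A : 'M[k]_n) : Prop := exists D zs, [/\ all item_ok D,
  cov (dsum_list (objs D zs)) T W A & \rank W = sumn (sb (dsum_list (objs D zs)))].

Lemma sumn_sb_list (xs : seq (sobj k)) :
  sumn (sb (dsum_list xs)) = sumn [seq sumn (sb x) | x <- xs].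
Proof. by elim: xs => //= x xs IH; rewrite sumn_cat IH. Qed.

(* The chains P split off the pair (W, A), leaving (S, A :&: S). *)
Definition peels (X : sobj k) (P : 'M_(sumn (sb X), n)) (W S A : 'M[k]_n) :=
  [/\ jm k (sb X) *m P = P *m T, [/\ (P <= W)%MS, (S <= W)%MS & (W <= P + S)%MS], (S *m T <= S)%MS,
      (smap X *m P <= A)%MS /\ (A <= smap X *m P + (A :&: S))%MS &
      forall x : 'rV_(sumn (sb X)), x *m jm k (sb X) = 0 -> (x *m P <= S)%MS -> x = 0].

Lemma peel (X Y : sobj k) P W S A : peels (X := X) P W S A ->
  cov Y T S (A :&: S)%MS -> \rank S = sumn (sb Y) ->
  cov (dsum X Y) T W A /\ \rank W = sumn (sb (dsum X Y)).
Proof.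
move=> [hP [PW SW WPS] TS [PA APS] inj] cY rS.
have eW : (P + S :=: W)%MS.
  by apply/eqmxP; rewrite WPS addsmx_sub PW SW.
split; last by rewrite -eW (split_rank hP TS inj) rS /= sumn_cat.
have cX : cov X T P (smap X *m P) by exists P; split.
apply: cov_eqmx (cov_dsum cX cY) => //.
by apply/eqmxP; rewrite APS addsmx_sub PA capmxSl.
Qed.

Lemma peel_item x P W S A : item_ok x -> peels (X := item_obj k x) P W S A ->
  decomposes S (A :&: S)%MS -> decomposes W A.
Proof.
move=> okx pl [D [zs [okD cS rS]]]; have [cW rW] := peel pl cS rS.
by exists (x :: D), zs; rewrite /= okx.
Qed.

Lemma peel_zero m P W S A : peels (X := picket k 0 m) P W S A ->
  decomposes S (A :&: S)%MS -> decomposes W A.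
Proof.
move=> pl [D [zs [okD cS rS]]]; have [cW rW] := peel pl cS rS.
exists D, (m :: zs); split=> //.
  apply: (@cov_perm k (picket k 0 m :: objs D zs)) cW; rewrite /objs /=.
  exact: (@Permutation_middle _ _ (map (picket k 0) zs)).
rewrite rW -[dsum _ _]/(dsum_list (picket k 0 m :: objs D zs)) !sumn_sb_list /objs map_cons !map_cat /=.
by rewrite !sumn_cat /= addnCA.
Qed.

Lemma chain_inj v f m (S : 'M_n) : (0 < m)%N -> v *m T ^+ m.-1 *m f = 1%:M -> (S <= ann f)%MS ->
  forall x : 'rV_(sumn [:: m]), x *m jm k [:: m] = 0 ->
  (x *m chain T v (sumn [:: m]) <= S)%MS -> x = 0.
Proof.
move=> m0 vf Sf x /(jm1_ker m0)[c [c0 ->]] xS; apply: c0.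
have /annP/(_ 0%N) := submx_trans xS Sf.
by rewrite expr0 mulmx1 -mulmxA vf mulmx1.
Qed.

Lemma chains_inj v w f g m r (S : 'M_n) : (0 < m)%N -> (0 < r)%N ->
  v *m T ^+ m.-1 *m f = 1%:M -> v *m T ^+ m.-1 *m g = 0 -> w *m T ^+ r.-1 *m g = 1%:M ->
  (S <= ann f)%MS -> (S <= ann g)%MS ->
  forall x : 'rV_(sumn ([:: m] ++ [:: r])), x *m jm k ([:: m] ++ [:: r]) = 0 ->
  (x *m @glue k [:: m] [:: r] n (chain T v (sumn [:: m])) (chain T w (sumn [:: r])) <= S)%MS -> x = 0.
Proof.
move=> m0 r0 vf vg wg Sf Sg x xj; rewrite /glue mulmxDr !mulmxA => xS.
have /(jm1_ker m0)[c [c0 ec]] : x *m prl_mx k [:: m] [:: r] *m jm k [:: m] = 0.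
  by rewrite -mulmxA -jm_prl mulmxA xj mul0mx.
have /(jm1_ker r0)[d [d0 ed]] : x *m prr_mx k [:: m] [:: r] *m jm k [:: r] = 0.
  by rewrite -mulmxA -jm_prr mulmxA xj mul0mx.
rewrite ec ed in xS.
have d00 : d = 0.
  have /annP/(_ 0%N) := submx_trans xS Sg.
  by rewrite expr0 mulmx1 mulmxDl -!(mulmxA c) -!(mulmxA d) vg wg mulmx0 mulmx1 add0r.
have c00 : c = 0.
  have /annP/(_ 0%N) := submx_trans xS Sf.
  by rewrite d00 mul0mx addr0 expr0 mulmx1 -mulmxA vf mulmx1.
by rewrite -[x]mulmx1 -(prl_inl_prr_inr k [:: m] [:: r]) mulmxDr !mulmxA c0 // d0 // !mul0mx addr0.
Qed.

(** The value of f after T fixes the coefficient of a, then the value of f fixes that of a T; T^2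
    vanishes on A. *)
Lemma sub_split_arc (A : 'M[k]_n) a f : (A *m T <= A)%MS -> A *m T *m T = 0 -> (a <= A)%MS ->
  a *m T *m f = 1%:M -> (A <= kry T a + (A :&: ann f))%MS.
Proof.
move=> TA TTA aA af; apply/row_subP => i; set u := row i A.
have uA : (u <= A)%MS by apply: row_sub.
have TT (y : 'rV_n) : (y <= A)%MS -> y *m T *m T = 0.
  by move=> /submxP[z ->]; rewrite -!mulmxA (mulmxA A) TTA mulmx0.
have [c ec] : exists c, u *m T *m f = c by eexists.
have [d ed] : exists d, (u - c *m a) *m f = d by eexists.
have aTA : (a *m T <= A)%MS by apply: submx_trans TA; apply: submxMr.
rewrite -[u](subrK (c *m a + d *m (a *m T))) addrC; apply: addmx_sub_adds.
  apply: addmx_sub; apply: submx_trans (submxMl _ _) _; first exact: self_kry.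
  by have := mem_kry nilT a 1; rewrite expr1.
have sA : (u - (c *m a + d *m (a *m T)) <= A)%MS.
  by rewrite addmx_sub // eqmx_opp addmx_sub // (submx_trans (submxMl _ _)).
rewrite sub_capmx sA /=; apply/annP => -[|[|j]].
- rewrite expr0 mulmx1 opprD addrA mulmxBl ed -mulmxA af mulmx1 subrr //.
- rewrite expr1 !mulmxBl ec mulmxDl mulmxDl -!(mulmxA c) af mulmx1.
  by rewrite -(mulmxA d) TT // mulmx0 mul0mx addr0 subrr.
by rewrite -addn2 addnC mulmx_expD expr2 -[T * T]/(T *m T) (mulmxA _ T T) TT // !mul0mx.
Qed.

Lemma sub_split_pole (A : 'M[k]_n) a f : A *m T = 0 -> (a <= A)%MS ->
  a *m f = 1%:M -> (A <= kry T a + (A :&: ann f))%MS.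
Proof.
move=> TA aA af; apply/row_subP => i; set u := row i A.
have uA : (u <= A)%MS by apply: row_sub.
have [c ec] : exists c, u *m f = c by eexists.
rewrite -[u](subrK (c *m a)) addrC; apply: addmx_sub_adds.
  exact: submx_trans (submxMl _ _) (self_kry nilT a).
have sA : (u - c *m a <= A)%MS by rewrite addmx_sub // eqmx_opp (submx_trans (submxMl _ _)).
rewrite sub_capmx sA /=; apply/annP => -[|j].
  by rewrite expr0 mulmx1 mulmxBl ec -mulmxA af mulmx1 subrr.
case/submxP: sA => z ->; rewrite exprS -[T * _]/(T *m _) -(mulmxA z) (mulmxA A) TA.
by rewrite mul0mx mulmx0 mul0mx.
Qed.

(** On A the functional g is f after T, so it imposes no further condition on the complement of a in
    the submodule. *)
Lemma cap_ann_sub (A : 'M[k]_n) f g : (A *m T <= A)%MS -> A *m T *m T = 0 ->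
  A *m g = A *m T *m f -> (A :&: ann f <= ann g)%MS.
Proof.
move=> TA TTA Ag; apply/rV_subP => u; rewrite sub_capmx => /andP[/submxP[y ->] /annP h].
apply/annP => -[|[|j]].
- by have := h 1%N; rewrite expr1 expr0 mulmx1 -!mulmxA Ag !mulmxA.
- have ATg : A *m T *m g = 0.
    by case/submxP: TA => z ez; rewrite ez -(mulmxA z) Ag !mulmxA -ez TTA mul0mx.
  by rewrite expr1 -(mulmxA y) -(mulmxA y) ATg mulmx0.
rewrite -addn2 addnC mulmx_expD expr2 -[T * T]/(T *m T) -(mulmxA y) (mulmxA A T T) TTA.
by rewrite mulmx0 !mul0mx.
Qed.

End Ann.
End Classification.

(** * Decomposition into pickets and bipickets *)

Section Classification2.
Variable k : fieldType.
Variables (n : nat) (T : 'M[k]_n).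
Hypothesis nilT : T ^+ n = 0.
Implicit Types (u v w : 'rV[k]_n) (f : 'cV[k]_n).

Lemma stable_cap (S1 S2 : 'M[k]_n) : (S1 *m T <= S1)%MS -> (S2 *m T <= S2)%MS ->
  ((S1 :&: S2)%MS *m T <= (S1 :&: S2)%MS)%MS.
Proof.
move=> h1 h2; rewrite sub_capmx.
by rewrite (submx_trans (submxMr _ (capmxSl _ _)) h1) (submx_trans (submxMr _ (capmxSr _ _)) h2).
Qed.

Lemma exp_anti (W : 'M[k]_n) i j : (W *m T <= W)%MS -> (i <= j)%N ->
  (W *m T ^+ j <= W *m T ^+ i)%MS.
Proof.
move=> TW ij; rewrite -(subnK ij) exprD mulmxA submxMr //.
by apply: (stable_exp _ TW).
Qed.

Lemma single_complement (W : 'M[k]_n) v f m :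
  (W *m T <= W)%MS -> (v <= W)%MS -> (0 < m)%N -> v *m T ^+ m = 0 ->
  W *m T ^+ m *m f = 0 -> v *m T ^+ m.-1 *m f = 1%:M ->
  (W <= kry T v + (W :&: ann T f))%MS.
Proof.
move=> TW vW m0 v0 Wf vf.
have := @chains_complement _ _ T nilT W v 0 f 0 m 0 TW vW (sub0mx _ _) m0 m0 v0 _ Wf _ vf _ _.
rewrite mul0mx !mulmx0 => /(_ erefl erefl erefl) h.
apply: submx_trans (h _) _ => //.
rewrite kry0 addsmx_sub; apply/andP; split.
  apply: submx_trans (addsmxSl _ _); by rewrite addsmx_sub submx_refl sub0mx.
apply: submx_trans (addsmxSr _ _); rewrite sub_capmx capmxSl /=.
exact: submx_trans (capmxSr _ _) (capmxSl _ _).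
Qed.

Lemma peels_chain (W A : 'M[k]_n) u f l m (S := (W :&: ann T f)%MS) :
  (W *m T <= W)%MS -> (A <= W)%MS -> (A *m T <= A)%MS -> (u <= W)%MS ->
  (l <= m)%N -> (0 < m)%N -> u *m T ^+ m = 0 -> W *m T ^+ m *m f = 0 -> u *m T ^+ m.-1 *m f = 1%:M ->
  (u *m T ^+ (m - l) <= A)%MS -> (A <= kry T (u *m T ^+ (m - l)) + (A :&: ann T f))%MS ->
  peels T (X := picket k l m) (chain T u (sumn [:: m])) W S A.
Proof.
move=> TW AW TA uW lm m0 u0 Wf uf uA Au.
have chE : (chain T u (sumn [:: m]) :=: kry T u)%MS.
  by apply: chain_kry; rewrite //= addn0.
have smE : (smap (picket k l m) *m chain T u (sumn [:: m]) :=: kry T (u *m T ^+ (m - l)))%MS.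
  rewrite smap_picket_chain //; apply: chain_kry => //.
  by rewrite -mulmx_expD /= addn0 subnK.
split.
- exact: jm1_chain.
- split; [exact: chain_sub | exact: capmxSl |].
  rewrite (adds_eqmx chE (eqmx_refl S)); exact: (@single_complement W u f m).
- by apply: stable_cap => //; apply: ann_stable.
- split; first by rewrite smE kry_sub.
  apply: submx_trans Au _; rewrite (adds_eqmx smE (eqmx_refl _)) addsmxS // sub_capmx capmxSl /=.
  by rewrite sub_capmx capmxSr (submx_trans (capmxSl _ _) AW).
exact: (chain_inj nilT m0 uf (capmxSr _ _)).
Qed.

(** Takes the last power of T whose image meets S outside X, modulo X. [X] is the part to be
    disregarded: zero when a single chain is split off, and for arcs the T-multiples of submodule
    elements of larger height. *)
Lemma height_max (S W X : 'M[k]_n) : (W *m T <= W)%MS -> ~~ (S <= X)%MS -> (S <= W)%MS ->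
  exists m (b : 'rV[k]_n), [/\ (0 < m)%N, (b <= S)%MS, (b <= W *m T ^+ m.-1 + X)%MS &
                 ~~ (b <= W *m T ^+ m + X)%MS].
Proof.
move=> TW SX SW; pose Q m := ~~ ((S :&: (W *m T ^+ m + X))%MS <= X)%MS.
have Q0 : Q 0%N.
  rewrite /Q expr0 mulmx1; apply: contra SX; apply: submx_trans.
  by rewrite sub_capmx submx_refl (submx_trans SW (addsmxSl _ _)).
have Qn : ~~ Q n.
  rewrite /Q negbK nilT mulmx0; apply: submx_trans (capmxSr _ _) _.
  by rewrite addsmx_sub sub0mx submx_refl.
have [m [Qm Qm1]] : exists m, Q m /\ ~~ Q m.+1.
  have ex : exists m, ~~ Q m by exists n.
  case: (ex_minnP ex) => -[|m] nQ qmin; first by rewrite Q0 in nQ.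
  by exists m; split=> //; apply: contraT => /qmin; rewrite ltnn.
have [i bi] := row_subPn Qm; move: (row_sub i (S :&: (W *m T ^+ m + X))%MS).
move: (row i _) bi => b bi.
rewrite sub_capmx => /andP[bS bW]; exists m.+1, b; split=> //.
apply/negP => bW'; move: Qm1; rewrite /Q negbK => h; case/negP: bi.
by apply: submx_trans h; rewrite sub_capmx bS.
Qed.

Lemma socle_height_witness (W : 'M[k]_n) (S : 'M[k]_n) : (W *m T <= W)%MS ->
  (S <= W)%MS -> S != 0 -> S *m T = 0 -> exists m v f,
  [/\ (0 < m)%N, (v <= W)%MS, (v *m T ^+ m.-1 <= S)%MS,
      v *m T ^+ m = 0 & W *m T ^+ m *m f = 0 /\ v *m T ^+ m.-1 *m f = 1%:M].
Proof.
move=> TW SW S0 TS.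
have [|m [b [m0 bS bW nb]]] := @height_max S W 0 TW _ SW; first by rewrite submx0.
move: bW nb; rewrite !addsmx0 => /submxP[y eb] nb.
have [f Wf bf] := functional_out nb.
exists m, (y *m W), f; rewrite -mulmxA -eb; split=> //; first exact: submxMl.
rewrite -(prednK m0) exprS -[T * _]/(T *m _) -/(T ^+ _).
have -> : T *m T ^+ m.-1 = T ^+ m.-1 *m T by rewrite -[LHS]/(T * T ^+ m.-1) -exprS exprSr.
rewrite -!mulmxA (mulmxA W) (mulmxA y) -eb.
by case/submxP: bS => z ->; rewrite -mulmxA TS mulmx0.
Qed.

(** The exponent r - 1 is the last for which all of A T comes from elements of A in W T^{r-1}. Among
    these images one of maximal height m - 1, modulo those coming from A in W T^r, is chosen;
    correcting its preimage by such an element gives a T = v T^{m-1}. Then a - v T^{m-2} is killed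
    by T and lies in W T^{r-1}, which yields w. *)
Lemma arc_witness (W A : 'M[k]_n) : (W *m T <= W)%MS -> (A <= W)%MS ->
  A *m T *m T = 0 -> A *m T != 0 -> exists r m (a v w : 'rV[k]_n) (f : 'cV[k]_n),
  [/\ [/\ (0 < r)%N, (r < m)%N, (a <= A)%MS, (v <= W)%MS & (w <= W)%MS],
      v *m T ^+ m = 0, w *m T ^+ r = 0, a = v *m T ^+ (m - 2) + w *m T ^+ r.-1 &
      [/\ W *m T ^+ m *m f = 0, (A :&: W *m T ^+ r)%MS *m T *m f = 0 & a *m T *m f = 1%:M]].
Proof.
move=> TW AW TTA TA0; pose X r := (A :&: W *m T ^+ r)%MS *m T.
have [r0 hr] : exists r0, ~~ (X r0 <= X r0.+1)%MS.
  have ex : exists r, ~~ (A *m T <= X r)%MS.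
    exists n; rewrite /X nilT mulmx0 capmx0 mul0mx submx0 //.
  case: (ex_minnP ex) => -[|r] nr rmin.
    by case/negP: nr; rewrite /X submxMr // sub_capmx submx_refl expr0 mulmx1.
  exists r; apply: contra nr; apply: submx_trans.
  by apply: contraT => /rmin; rewrite ltnn.
have XW r : (X r <= W *m T ^+ r.+1)%MS.
  by rewrite exprSr mulmxA submxMr // capmxSr.
have XW0 : (X r0 <= W)%MS.
  exact: submx_trans (XW _) (stable_exp _ TW (submx_refl _)).
have [m [b [m0 bX bW nb]]] := height_max TW hr XW0.
case/submxP: bX => y eb; move: bW => /sub_addsmxP[[y1 y2] /= eb'].
pose a := y *m (A :&: W *m T ^+ r0)%MS - y2 *m (A :&: W *m T ^+ r0.+1)%MS.
pose v := y1 *m W.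
have aT : a *m T = v *m T ^+ m.-1.
  by rewrite /a mulmxBl -!mulmxA -eb eb' /X addrK /v !mulmxA.
have nb' : ~~ (a *m T <= W *m T ^+ m + X r0.+1)%MS.
  apply: contra nb => h; have -> : b = a *m T + y2 *m X r0.+1.
    by rewrite /a mulmxBl -!mulmxA -eb /X subrK.
  by apply: addmx_sub => //; apply: submx_trans (addsmxSr _ _); apply: submxMl.
have aA : (a <= A)%MS.
  by apply: addmx_sub; rewrite ?eqmx_opp; apply: submx_trans (submxMl _ _) (capmxSl _ _).
have aW : (a <= W *m T ^+ r0)%MS.
  apply: addmx_sub; rewrite ?eqmx_opp; apply: submx_trans (submxMl _ _) _; first exact: capmxSr.
  by apply: submx_trans (capmxSr _ _) _; apply: exp_anti.
have rm : (r0.+1 < m)%N.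
  rewrite ltnNge; apply: contra nb' => mr; apply: submx_trans (addsmxSl _ _).
  apply: submx_trans (exp_anti TW mr); rewrite exprSr mulmxA; exact: submxMr.
have [f' WXf af] := functional_out nb'.
have [Wf Xf] : W *m T ^+ m *m f' = 0 /\ X r0.+1 *m f' = 0.
  split; apply/eqP; rewrite -submx0.
    by apply: submx_trans (submxMr f' (addsmxSl _ (X r0.+1))) _; rewrite WXf sub0mx.
  by apply: submx_trans (submxMr f' (addsmxSr (W *m T ^+ m) _)) _; rewrite WXf sub0mx.
have vW : (v <= W)%MS by apply: submxMl.
have : (a - v *m T ^+ (m - 2) <= W *m T ^+ r0)%MS.
  rewrite addmx_sub // eqmx_opp; apply: submx_trans (submxMr _ vW) _.
  by apply: exp_anti => //; clear -rm; lia.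
case/submxP=> z ez; pose w := z *m W.
have ew : a = v *m T ^+ (m - 2) + w *m T ^+ r0.
  by rewrite /w -mulmxA -ez addrC subrK.
have TTa : a *m T *m T = 0.
  by case/submxP: aA => x ->; rewrite -!mulmxA (mulmxA A) TTA mulmx0.
exists r0.+1, m, a, v, w, f'; split=> //.
- by split=> //; apply: submxMl.
- by rewrite -(prednK m0) mulmx_expS -aT.
rewrite mulmx_expS; have -> : w *m T ^+ r0 = a - v *m T ^+ (m - 2) by rewrite ew addrAC subrr add0r.
rewrite mulmxBl aT -mulmx_expS (_ : (m - 2).+1 = m.-1) ?subrr //; clear -rm; lia.
Qed.

Theorem classify (W A : 'M[k]_n) : (W *m T <= W)%MS -> (A <= W)%MS ->
  (A *m T <= A)%MS -> A *m T *m T = 0 -> decomposes T W A.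
Proof.
have [d] := ubnP (\rank W).
elim: d => // d IH in W A *; rewrite ltnS => rW TW AW TA TTA.
have peelable S : (S *m T <= S)%MS -> (S <= W)%MS -> (\rank S < \rank W)%N ->
    decomposes T S (A :&: S)%MS.
  move=> TS SW rS; apply: IH => //; first exact: leq_trans rS rW.
  - exact: capmxSr.
  - exact: stable_cap.
  - apply/eqP; rewrite -submx0 -TTA -!mulmxA; apply: submxMr; exact: capmxSl.
have ranklt S x f : (S <= W)%MS -> (x <= W)%MS -> x *m f = 1%:M -> S *m f = 0 ->
    (\rank S < \rank W)%N.
  move=> SW xW xf Sf; rewrite ltn_neqAle mxrankS // andbT; apply/negP => /eqP e.
  have /submxP[z ez] : (x <= S)%MS by apply: submx_trans xW _; rewrite -(geq_leqif (mxrank_leqif_sup SW)) e.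
  have := xf; rewrite ez -mulmxA Sf mulmx0 => /matrixP/(_ 0 0); rewrite !mxE.
  by move=> /eqP; rewrite eq_sym oner_eq0.
have annf (f : 'cV_n) : ann T f *m f = 0.
  apply/row_matrixP => i; rewrite row_mul row0.
  by have /(annP nilT)/(_ 0%N) := row_sub i (ann T f); rewrite expr0 mulmx1.
have capannf S (f : 'cV_n) : (S <= ann T f)%MS -> S *m f = 0.
  by case/submxP=> z ->; rewrite -mulmxA annf mulmx0.
have peel_rest f x : (x <= W)%MS -> x *m f = 1%:M -> decomposes T (W :&: ann T f)%MS (A :&: (W :&: ann T f))%MS.
  move=> xW xf; apply: peelable; first by apply: stable_cap => //; apply: ann_stable.
    exact: capmxSl.
  by apply: (ranklt _ _ x f) => //; [apply: capmxSl | apply: capannf; apply: capmxSr].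
have [W0|W0] := eqVneq W 0.
  exists [::], [::]; split=> //; last by rewrite W0 mxrank0.
  exists 0; split; rewrite ?mulmx0 ?mul0mx ?W0 //; apply/eqmxP; rewrite !sub0mx //.
  by move: AW; rewrite W0 submx0 => /eqP->; rewrite sub0mx.
have [TA0|TA0] := eqVneq (A *m T) 0; last first.
  have [r [m [a [v [w [f [[r0 rm aA vW wW] v0 w0 ea [Wf Xf af]]]]]]]] := arc_witness TW AW TTA TA0.
  have aTE : a *m T = v *m T ^+ m.-1.
    rewrite ea mulmxDl -!mulmx_expS (prednK r0) w0 addr0.
    by rewrite (_ : (m - 2).+1 = m.-1) //; clear -r0 rm; lia.
  have m0 : (0 < m)%N by clear -rm; lia.
  have a2 : a *m T ^+ 2 = 0.
    by case/submxP: aA => x ->; rewrite expr2 -[T * T]/(T *m T) -mulmxA (mulmxA A) TTA mulmx0.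
  (* If r = m - 1, both exponents in the formula for a coincide and u = v + w is a single generator:
     the summand is P_2^m. *)
  have [mr|mr] := eqVneq r m.-1.
    pose u := v + w.
    have u0 : u *m T ^+ m = 0 by rewrite mulmxDl v0 (mulmx_exp_ge0 (ltnW rm) w0) addr0.
    have uW : (u <= W)%MS by apply: addmx_sub.
    have uE : u *m T ^+ (m - 2) = a.
      by rewrite ea mulmxDl (_ : (m - 2)%N = r.-1) //; clear -r0 rm mr; lia.
    have uf : u *m T ^+ m.-1 *m f = 1%:M.
      by rewrite mulmxDl -mr w0 addr0 mr -aTE.
    have eX : item_obj k (Arc m r) = picket k 2 m by rewrite /= mr eqxx.
    have := @peel_item _ _ T (Arc m r); rewrite eX.
    move=> /(_ (chain T u (sumn [:: m])) W (W :&: ann T f)%MS A); apply.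
    - by rewrite /= r0; clear -rm; lia.
    - apply: peels_chain; rewrite ?uE //; first by clear -r0 rm; lia.
      exact: (sub_split_arc nilT TA TTA aA af).
    apply: (peel_rest _ (a *m T)) => //.
    exact: submx_trans (submx_trans (submxMr _ aA) TA) AW.
  (* [g] is to be f after T on A and zero on W T^r. The two demands are compatible because f kills
     the T-multiples of the intersection of A with W T^r. *)
  have [g eg] : exists g : 'cV_n, col_mx A (W *m T ^+ r) *m g = col_mx (A *m T *m f) 0.
    apply: functional_ext => x; rewrite -[x]hsubmxK !mul_row_col mulmx0 addr0.
    move/eqP; rewrite addr_eq0 => /eqP e; rewrite !mulmxA.
    have : (lsubmx x *m A <= A :&: W *m T ^+ r)%MS.
      by rewrite sub_capmx submxMl e eqmx_opp submxMl.
    by case/submxP=> z ->; rewrite -!mulmxA (mulmxA _ T) Xf mulmx0.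
  move: eg; rewrite mul_col_mx => /eq_col_mx[Ag Wg].
  have vg : v *m T ^+ m.-1 *m g = 0.
    rewrite -(subnKC (_ : r <= m.-1)%N); last by clear -rm; lia.
    rewrite addnC mulmx_expD; have /submxP[z ->] := stable_exp (m.-1 - r) TW vW.
    by rewrite -!mulmxA (mulmxA W) Wg mulmx0.
  (* Here r < m - 1 enters: v T^{m-2} lies in W T^r and is killed by g, so g(w T^{r-1}) = g(a) = f(a
     T) = 1. *)
  have wg : w *m T ^+ r.-1 *m g = 1%:M.
    have -> : w *m T ^+ r.-1 = a - v *m T ^+ (m - 2) by rewrite ea addrAC subrr add0r.
    rewrite mulmxBl; have -> : v *m T ^+ (m - 2) *m g = 0.
      rewrite -(subnKC (_ : r <= m - 2)%N); last by clear -rm mr; lia.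
      rewrite addnC mulmx_expD; have /submxP[z ->] := stable_exp (m - 2 - r) TW vW.
      by rewrite -!mulmxA (mulmxA W) Wg mulmx0.
    rewrite subr0; case/submxP: (aA) => z ez; rewrite ez -mulmxA Ag.
    by rewrite -af ez !mulmxA.
  pose S := (W :&: (ann T f :&: ann T g))%MS.
  have TS : (S *m T <= S)%MS by apply: stable_cap => //; apply: stable_cap; apply: ann_stable.
  have Sf : (S <= ann T f)%MS by apply: submx_trans (capmxSr _ _) (capmxSl _ _).
  have Sg : (S <= ann T g)%MS by apply: submx_trans (capmxSr _ _) (capmxSr _ _).
  have eX : item_obj k (Arc m r) = bipicket k m r by rewrite /= (negbTE mr).
  pose P := @glue k [:: m] [:: r] n (chain T v (sumn [:: m])) (chain T w (sumn [:: r])).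
  have PE : (P :=: kry T v + kry T w)%MS.
    apply: eqmx_trans (@glue_eqmx k [:: m] [:: r] _ _ _) _.
    by apply: adds_eqmx; apply: chain_kry; rewrite //= addn0.
  have smE : (smap (bipicket k m r) *m P :=: kry T a)%MS.
    rewrite smap_bipicket_glue -?ea //; last by clear -r0 rm; lia.
    exact: chain_kry.
  have := @peel_item _ _ T (Arc m r); rewrite eX.
  move=> /(_ P W S A); apply; first by rewrite /= r0; clear -rm; lia.
    split=> //.
    - by rewrite (@jm_glue k [:: m] [:: r]) (@glueM k [:: m] [:: r]) !jm1_chain.
    - split; [by rewrite PE addsmx_sub !kry_sub // vW wW | exact: capmxSl |].
      rewrite (adds_eqmx PE (eqmx_refl S)).
      by apply: (chains_complement nilT TW vW wW m0 rm) => //; rewrite -aTE.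
    - split; first by rewrite smE kry_sub.
      apply: submx_trans (sub_split_arc nilT TA TTA aA af) _.
      rewrite (adds_eqmx smE (eqmx_refl _)) addsmxS // sub_capmx capmxSl /=.
      rewrite sub_capmx (submx_trans (capmxSl _ _) AW) sub_capmx capmxSr /=.
      exact: cap_ann_sub.
    by apply: (@chains_inj _ _ T nilT v w f g m r S) => //; rewrite -aTE.
  apply: peelable => //; first exact: capmxSl.
  apply: (ranklt _ _ (a *m T) f) => //; first exact: capmxSl.
    exact: submx_trans (submx_trans (submxMr _ aA) TA) AW.
  by apply: capannf.
have [A0|A0] := eqVneq A 0.
  have [j [S0 ST SW]] : exists S : 'M[k]_n, [/\ S != 0, S *m T = 0 & (S <= W)%MS].
    have [x [x0 xW xT]] := stable_socle nilT TW W0.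
    exists <<x>>%MS; split.
    - by rewrite -mxrank_eq0 genmxE mxrank_eq0.
    - by apply/eqP; rewrite -submx0 (eqmxMr _ (genmxE x)) xT sub0mx.
    by rewrite genmxE.
  have [m [v [f [m0 vW vS v0 [Wf vf]]]]] := socle_height_witness TW SW S0 ST.
  apply: (@peel_zero _ _ T m (chain T v (sumn [:: m])) W (W :&: ann T f)%MS A).
    by apply: peels_chain; rewrite // ?subn0 ?v0 A0 sub0mx.
  exact: (peel_rest _ _ (stable_exp _ TW vW) vf).
have [m [v [f [m0 vW vA v0 [Wf vf]]]]] := socle_height_witness TW AW A0 TA0.
apply: (@peel_item _ _ T (Pole m) (chain T v (sumn [:: m])) W (W :&: ann T f)%MS A) => //.
  by apply: peels_chain; rewrite ?subn1 //; exact: (sub_split_pole nilT TA0 vA vf).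
exact: (peel_rest _ _ (stable_exp _ TW vW) vf).
Qed.

End Classification2.

(** * Extensions whose two components split *)

Section ExtObj.
Variable k : fieldType.
Implicit Types X Y Z U V : sobj k.

(** Both underlying modules are direct sums; the class sits in the block [h] of the embedding, from
    the submodule of V to the ambient module of U. *)
Definition ext_obj U V (h : 'M[k]_(sumn (sa V), sumn (sb U))) : sobj k :=
  @SObj k (sa U ++ sa V) (sb U ++ sb V)
    (smap (dsum U V) + prr_mx k (sa U) (sa V) *m h *m inl_mx k (sb U) (sb V)).

Lemma smap_ext_glue U V h n (P1 : 'M_(_, n)) P2 :
  smap (@ext_obj U V h) *m glue P1 P2 = glue (smap U *m P1) (h *m P1 + smap V *m P2).
Proof.
rewrite mulmxDl smap_dsum_glue -!mulmxA inl_glue /glue !mulmxDr.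
by rewrite -addrA (addrC (_ *m (smap V *m P2))).
Qed.

Lemma inl_smap_ext U V h : inl_mx k (sa U) (sa V) *m smap (@ext_obj U V h) = smap U *m inl_mx k _ _.
Proof.
rewrite -[smap (ext_obj h)]mulmx1 -(prl_inl_prr_inr k (sb U) (sb V)) smap_ext_glue.
by rewrite inl_glue.
Qed.

Lemma inr_smap_ext U V h : inr_mx k (sa U) (sa V) *m smap (@ext_obj U V h) =
  h *m inl_mx k _ _ + smap V *m inr_mx k _ _.
Proof.
rewrite -[smap (ext_obj h)]mulmx1 -(prl_inl_prr_inr k (sb U) (sb V)) smap_ext_glue.
by rewrite inr_glue.
Qed.

Lemma smap_extE U V h : smap (@ext_obj U V h) =
  glue (smap U *m inl_mx k _ _) (h *m inl_mx k _ _ + smap V *m inr_mx k _ _).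
Proof. by rewrite -(inl_smap_ext h) -inr_smap_ext glueE. Qed.

Lemma is_obj_ext U V h : is_obj U -> is_obj V ->
  jm k (sa V) *m h = h *m jm k (sb U) -> is_obj (@ext_obj U V h).
Proof.
move=> /is_objP[fU cU] /is_objP[fV cV] ch; apply/is_objP; split; last first.
  rewrite {1}smap_extE jm_glue smap_extE glueM !mulmxDr !mulmxDl !mulmxA cU ch cV.
  by rewrite -!mulmxA inl_jm inr_jm.
case/row_freeP: fU => F UF; case/row_freeP: fV => G VG.
apply/row_freeP; exists (glue (F *m inl_mx k _ _) (G *m inr_mx k _ _ - G *m h *m F *m inl_mx k _ _)).
rewrite smap_ext_glue mulmxBr !mulmxA UF VG !mul1mx addrC subrK.
exact: prl_inl_prr_inr.
Qed.

Lemma ses_ext U V h : jm k (sa V) *m h = h *m jm k (sb U) -> ses U (@ext_obj U V h) V.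
Proof.
move=> ch.
exists (inl_mx k _ _), (inl_mx k _ _), (prr_mx k _ _), (prr_mx k _ _).
have full b1 b2 : row_full (prr_mx k b1 b2) by apply/row_fullP; exists (inr_mx k b1 b2); apply: inr_prr.
have ker b1 b2 : (inl_mx k b1 b2 == kermx (prr_mx k b1 b2))%MS.
  apply/andP; split; first by apply/sub_kermxP; apply: inl_prr.
  rewrite -[X in (X <= _)%MS]mulmx1 -prl_inl_prr_inr mulmxDr !mulmxA mulmx_ker mul0mx addr0.
  exact: submxMl.
split.
- by apply/and3P; split; apply/eqP; rewrite ?inl_jm ?inl_smap_ext.
- apply/and3P; split; apply/eqP; rewrite ?jm_prr //.
  rewrite smap_extE glueM mulmxDl -!mulmxA inl_prr inr_prr !mulmx0 !mulmx1 add0r.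
  by rewrite /glue mulmx0 add0r.
- by apply/and3P; split; [apply: inl_mx_free | apply: full | apply: ker].
by apply/and3P; split; [apply: inl_mx_free | apply: full | apply: ker].
Qed.

Lemma ses_iso U M V U' M' V' : iso U U' -> iso M M' -> iso V V' -> ses U M V -> ses U' M' V'.
Proof.
move=> [pu1 [pu2 [qu1 [qu2 [hpu hqu [u1 u2] [u3 u4]]]]]].
move=> [pm1 [pm2 [qm1 [qm2 [hpm hqm [m1 m2] [m3 m4]]]]]].
move=> [pv1 [pv2 [qv1 [qv2 [hpv hqv [v1 v2] [v3 v4]]]]]].
move=> [i1 [i2 [j1 [j2 [hi hj c1 c2]]]]].
exists (qu1 *m i1 *m pm1), (qu2 *m i2 *m pm2), (qm1 *m j1 *m pv1), (qm2 *m j2 *m pv2).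
have exact a b c a' b' c' (pu : 'M[k]_(a, a')) (qu : 'M_(a', a)) (pm : 'M_(b, b')) qm
    (pv : 'M_(c, c')) qv i j :
    pu *m qu = 1%:M -> qu *m pu = 1%:M -> pm *m qm = 1%:M -> qm *m pm = 1%:M ->
    pv *m qv = 1%:M -> qv *m pv = 1%:M ->
    [&& row_free i, row_full j & (i == kermx j)%MS] ->
    [&& row_free (qu *m i *m pm), row_full (qm *m j *m pv) &
        (qu *m i *m pm == kermx (qm *m j *m pv))%MS].
  move=> e1 e2 e3 e4 e5 e6 /and3P[/row_freeP[i' hi'] /row_fullP[j' hj'] /andP[k1 k2]].
  apply/and3P; split.
  - apply/row_freeP; exists (qm *m i' *m pu).
    by rewrite !mulmxA -(mulmxA _ pm) e3 mulmx1 -(mulmxA qu) hi' mulmx1.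
  - apply/row_fullP; exists (qv *m j' *m pm).
    by rewrite !mulmxA -(mulmxA _ pm) e3 mulmx1 -(mulmxA qv) hj' mulmx1.
  apply/andP; split.
    apply/sub_kermxP; rewrite !mulmxA -(mulmxA _ pm) e3 mulmx1 -(mulmxA qu).
    by rewrite (sub_kermxP k1) mulmx0 mul0mx.
  set K := kermx _; have K0 : K *m qm *m j = 0.
    have : K *m (qm *m j *m pv) = 0 by rewrite mulmx_ker.
    by move/(congr1 (mulmx^~ qv)); rewrite mul0mx !mulmxA -(mulmxA _ pv) e5 mulmx1.
  have /submxP[z ez] : (K *m qm <= i)%MS.
    by apply: submx_trans k2; apply/sub_kermxP.
  have -> : K = z *m pu *m (qu *m i *m pm).
    by rewrite !mulmxA -(mulmxA z) e1 mulmx1 -ez -mulmxA e4 mulmx1.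
  exact: submxMl.
split.
- exact: is_mor_comp (is_mor_comp hqu hi) hpm.
- exact: is_mor_comp (is_mor_comp hqm hj) hpv.
- exact: exact u1 u2 m1 m2 v1 v2 c1.
- exact: exact u3 u4 m3 m4 v3 v4 c2.
Qed.

End ExtObj.

(** * Chains of extensions and orbit closures on fixed modules *)

Section Degeneration.
Variable k : fieldType.
Implicit Types X Y Z U V : sobj k.

Definition jm_iso b b' : Prop := exists (P : 'M[k]_(sumn b, sumn b')) Q,
  [/\ jm k b *m P = P *m jm k b', jm k b' *m Q = Q *m jm k b, P *m Q = 1%:M & Q *m P = 1%:M].

Lemma jm_iso_refl b : jm_iso b b.
Proof. by exists 1%:M, 1%:M; rewrite !mulmx1 !mul1mx. Qed.

Lemma jm_iso_trans b1 b2 b3 : jm_iso b1 b2 -> jm_iso b2 b3 -> jm_iso b1 b3.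
Proof.
move=> [P [Q [h1 h2 h3 h4]]] [P' [Q' [g1 g2 g3 g4]]]; exists (P *m P'), (Q' *m Q); split.
- by rewrite mulmxA h1 -mulmxA g1 mulmxA.
- by rewrite mulmxA g2 -mulmxA h2 mulmxA.
- by rewrite !mulmxA -(mulmxA P) g3 mulmx1.
by rewrite !mulmxA -(mulmxA Q') h4 mulmx1.
Qed.

Lemma jm_iso_sym b b' : jm_iso b b' -> jm_iso b' b.
Proof. by move=> [P [Q [h1 h2 h3 h4]]]; exists Q, P. Qed.

Lemma iso_jm X Y : iso X Y -> jm_iso (sa X) (sa Y) /\ jm_iso (sb X) (sb Y).
Proof.
move=> [p1 [p2 [q1 [q2 [/and3P[/eqP h1 /eqP h2 _] /and3P[/eqP g1 /eqP g2 _] [e1 e2] [e3 e4]]]]]].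
by split; [exists p1, q1 | exists p2, q2].
Qed.

Lemma jm_iso_cat b1 b1' b2 b2' : jm_iso b1 b1' -> jm_iso b2 b2' -> jm_iso (b1 ++ b2) (b1' ++ b2').
Proof.
move=> [P [Q [h1 h2 h3 h4]]] [P' [Q' [g1 g2 g3 g4]]].
exists (glue (P *m inl_mx k _ _) (P' *m inr_mx k _ _)), (glue (Q *m inl_mx k _ _) (Q' *m inr_mx k _ _)).
split.
- by rewrite jm_glue glueM !mulmxA h1 g1 -!mulmxA inl_jm inr_jm.
- by rewrite jm_glue glueM !mulmxA h2 g2 -!mulmxA inl_jm inr_jm.
- by rewrite glueM -!mulmxA inl_glue inr_glue !mulmxA h3 g3 !mul1mx /glue prl_inl_prr_inr.
by rewrite glueM -!mulmxA inl_glue inr_glue !mulmxA h4 g4 !mul1mx /glue prl_inl_prr_inr.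
Qed.

Lemma jm_iso_catC b1 b2 : jm_iso (b1 ++ b2) (b2 ++ b1).
Proof.
exists (glue (inr_mx k _ _) (inl_mx k _ _)), (glue (inr_mx k _ _) (inl_mx k _ _)); split.
- by rewrite jm_glue glueM inl_jm inr_jm.
- by rewrite jm_glue glueM inl_jm inr_jm.
- by rewrite glueM inl_glue inr_glue /glue prl_inl_prr_inr.
by rewrite glueM inl_glue inr_glue /glue prl_inl_prr_inr.
Qed.

Lemma jm_iso_perm b b' : perm_eq b b' -> jm_iso b b'.
Proof.
elim: b b' => [|x b IH] b'; first by rewrite perm_sym => /perm_nilP->; exact: jm_iso_refl.
move=> pb; have xb' : x \in b' by rewrite -(perm_mem pb) mem_head.
case/splitPr: xb' pb => s1 s2; rewrite -cat_rcons -cats1 => pb.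
have /IH h : perm_eq b (s1 ++ s2).
  rewrite -(perm_cons x) (permPl pb) -catA /=.
  by apply/permP => p; rewrite /= !count_cat /=; lia.
apply: jm_iso_trans (jm_iso_cat (jm_iso_refl [:: x]) h) _.
rewrite catA; apply: jm_iso_cat (jm_iso_refl s2).
exact: jm_iso_catC.
Qed.

(** [leq_ext] asks for [valid] terms; sorting the parts restores the partitions that direct sums
    spoil. *)
Lemma iso_valid X : is_obj X -> exists X', valid X' /\ iso X X'.
Proof.
move=> oX.
have sp b : is_part (sort geq b).
  by apply: sort_sorted => x y; apply: leq_total.
have [P [Q [h1 h2 h3 h4]]] : jm_iso (sa X) (sort geq (sa X)).
  by apply: jm_iso_perm; rewrite perm_sym perm_sort.
have [P' [Q' [g1 g2 g3 g4]]] : jm_iso (sb X) (sort geq (sb X)).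
  by apply: jm_iso_perm; rewrite perm_sym perm_sort.
pose X' := SObj (Q *m smap X *m P').
have XX' : iso X X'.
  exists P, P', Q, Q'; split=> //; apply/and3P; split; apply/eqP => //=.
    by rewrite !mulmxA h3 mul1mx.
  by rewrite -!mulmxA g3 mulmx1.
exists X'; split=> //.
by apply/and3P; split; rewrite ?sp //; apply: iso_obj XX' oX.
Qed.

Lemma horner_line n (p : {mpoly k[n]}) (v w : 'rV[k]_n) :
  exists q : {poly k}, forall t, q.[t] = p.@[fun i => (v + t *: w) 0 i].
Proof.
exists (\sum_(m <- msupp p) (p@_m)%:P * \prod_i ((v 0 i)%:P + (w 0 i)%:P * 'X) ^+ m i) => t.
rewrite mevalE horner_sum; apply: eq_bigr => m _; rewrite hornerM hornerC; congr (_ * _).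
rewrite horner_prod; apply: eq_bigr => i _; rewrite horner_exp hornerD hornerM !hornerC hornerX.
by rewrite !mxE mulrC.
Qed.

(** X q vanishes everywhere. Were it nonconstant, X q + 1 would have a root in the closed field,
    which is absurd. *)
Lemma closed_field_puncture (q : {poly k}) : GRing.closed_field_axiom k ->
  (forall t, t != 0 -> q.[t] = 0) -> q.[0] = 0.
Proof.
move=> clk q0; pose p := 'X * q.
have p0 t : p.[t] = 0.
  rewrite hornerM hornerX; have [->|/q0->] := eqVneq t 0; by rewrite ?mul0r ?mulr0.
have [sp|sp] := leqP (size p) 1.
  have : p = 0 by have e := size1_polyC sp; have := p0 0; rewrite e hornerC => ->.
  by move/eqP; rewrite mulf_eq0 polyX_eq0 /= => /eqP->; rewrite horner0.
pose r := p + 1.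
have sr : size r = size p by rewrite size_polyDl // size_poly1.
have lr : lead_coef r != 0 by rewrite lead_coef_eq0 -size_poly_gt0 sr; lia.
have [x] := clk (size r).-1 (fun i => - r`_i / lead_coef r) ltac:(by rewrite sr; lia).
move=> /(congr1 (fun y => lead_coef r * y)) e.
have : r.[x] = 0.
  rewrite horner_coef -(prednK (_ : 0 < size r)%N); last by rewrite sr; lia.
  rewrite big_ord_recr /= -/(lead_coef r) e big_distrr /= -big_split /= big1 // => i _.
  by rewrite mulrA (mulrC (lead_coef r)) divfK // mulNr addrN.
by rewrite hornerD p0 hornerC add0r => /eqP; rewrite oner_eq0.
Qed.

Lemma inl_inr_full b1 b2 : (inl_mx k b1 b2 + inr_mx k b1 b2 :=: (1%:M : 'M_(sumn (b1 ++ b2))))%MS.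
Proof. by apply: eqmx_trans (eqmx_sym (glue_eqmx _ _)) _; rewrite /glue prl_inl_prr_inr. Qed.

Lemma cov_dsum_full X1 X2 U V :
  covers X1 U -> covers X2 V -> covers (dsum X1 X2) (dsum U V).
Proof.
move=> c1 c2.
apply: cov_eqmx (cov_dsum (cov_push (esym (inl_jm k (sb U) (sb V))) c1)
                          (cov_push (esym (inr_jm k (sb U) (sb V))) c2)).
  by rewrite !mul1mx; exact: inl_inr_full.
rewrite -[smap (dsum U V)]mulmx1 -(prl_inl_prr_inr k (sb U) (sb V)) smap_dsum_glue.
exact: eqmx_sym (glue_eqmx _ _).
Qed.

Lemma iso_dsum U U1 V V1 : is_obj U -> is_obj V -> iso U U1 -> iso V V1 ->
  iso (dsum U V) (dsum U1 V1).
Proof.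
move=> oU oV iU iV; apply: iso_of_cov.
- exact: is_obj_dsum.
- by apply: is_obj_dsum; [apply: iso_obj iU oU | apply: iso_obj iV oV].
- by rewrite /= !sumn_cat (iso_dim iU) (iso_dim iV).
by apply: cov_dsum_full; apply: cov_of_iso.
Qed.

Section SameType.
Variables a b : seq nat.
Implicit Types f g h : 'M[k]_(sumn a, sumn b).

Lemma iso_orbit f g : iso (SObj f) (SObj g) <-> Defs.orbit f g.
Proof.
split.
  move=> [p1 [p2 [q1 [q2 [/and3P[/eqP h1 /eqP h2 /eqP h3] _ [e1 e2] [e3 e4]]]]]].
  have [u1 _] := mulmx1_unit e1; have [u2 _] := mulmx1_unit e3.
  exists p1, p2; split; try by apply/andP; split => //; apply/eqP.
  by rewrite -mulmxA -[f *m p2]/(smap (SObj f) *m p2) -h3 mulKmx.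
move=> [u [w [/andP[/eqP h1 u1] /andP[/eqP h2 w1] ->]]].
exists u, w, (invmx u), (invmx w); split.
- by apply/and3P; split; apply/eqP => //=; rewrite !mulmxA mulmxV // mul1mx.
- apply/and3P; split; apply/eqP => /=.
  + by rewrite -[LHS](mulKmx u1) (mulmxA u) -h1 -!mulmxA mulmxV // mulmx1.
  + by rewrite -[LHS](mulKmx w1) (mulmxA w) -h2 -!mulmxA mulmxV // mulmx1.
  by rewrite -!mulmxA mulmxV ?mulmx1.
- by rewrite mulmxV ?mulVmx.
by rewrite mulmxV ?mulVmx.
Qed.

Definition zariski_step f g := forall g', Defs.orbit g g' -> zariski_cl (Defs.orbit f) g'.

(** Bundles both consequences, so that one induction along the moves yields ext over any field and
    deg over a closed one. *)
Definition degenerates f g := leq_ext (SObj f) (SObj g) /\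
  (GRing.closed_field_axiom k -> zariski_step f g).

Hypothesis pa : is_part a.
Hypothesis pb : is_part b.

Lemma valid_SObj f : is_obj (SObj f) -> valid (SObj f).
Proof. by move=> of_; rewrite /valid /= pa pb. Qed.

Lemma degenerates_iso f g : is_obj (SObj f) -> iso (SObj f) (SObj g) -> degenerates f g.
Proof.
move=> of_ fg; split.
  exists 0%N, (fun _ => SObj f), (fun _ => SObj f), (fun _ => SObj f).
  split=> [i _|i|||].
  - exact: valid_SObj.
  - by case: i.
  - exact: iso_refl.
  - by case.
  exact: iso_sym.
move=> _ g' gg' p p0; apply: p0; apply/iso_orbit; apply: iso_trans fg _.
exact/iso_orbit.
Qed.

Lemma transport_iso X g Y : iso X (SObj g) -> sa Y = sa X -> sb Y = sb X ->
  exists f, iso Y (SObj f).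
Proof.
move=> [p1 [p2 [q1 [q2 [/and3P[/eqP h1 /eqP h2 _] /and3P[/eqP g1 /eqP g2 _] [e1 e2] [e3 e4]]]]]].
case: Y => aY bY fY /= ea eb; subst aY bY.
exists (q1 *m fY *m p2), p1, p2, q1, q2; split=> //.
  by apply/and3P; split; apply/eqP => //=; rewrite !mulmxA e1 mul1mx.
by apply/and3P; split; apply/eqP => //=; rewrite -!mulmxA e3 mulmx1.
Qed.

(** The map equal to 1 on U and to t on V carries the class t h to h. *)
Lemma ext_obj_scale U V (h : 'M[k]_(sumn (sa V), sumn (sb U))) t : t != 0 ->
  iso (ext_obj (t *: h)) (ext_obj h).
Proof.
move=> t0; have tV : t * t^-1 = 1 by rewrite mulfV.
have Vt : t^-1 * t = 1 by rewrite mulVf.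
pose D c (b1 b2 : seq nat) := glue (inl_mx k b1 b2) (c *: inr_mx k b1 b2).
have DD c d b1 b2 : D c b1 b2 *m D d b1 b2 = D (c * d) b1 b2.
  by rewrite /D glueM inl_glue -scalemxAl inr_glue scalerA.
have D1 b1 b2 : D 1 b1 b2 = 1%:M by rewrite /D scale1r /glue prl_inl_prr_inr.
have Djm c b1 b2 : jm k (b1 ++ b2) *m D c b1 b2 = D c b1 b2 *m jm k (b1 ++ b2).
  by rewrite /D jm_glue glueM inl_jm -scalemxAl inr_jm -scalemxAr.
have mor c (h1 h2 : 'M[k]_(sumn (sa V), sumn (sb U))) : h1 = c *: h2 ->
    @is_mor k (ext_obj h1) (ext_obj h2) (D c _ _) (D c _ _).
  move=> ->; apply/and3P; split; apply/eqP; rewrite ?Djm //.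
  rewrite {1}/D glueM inl_smap_ext -scalemxAl inr_smap_ext smap_ext_glue.
  by rewrite scalerDr -!scalemxAl -scalemxAr.
exists (D t _ _), (D t _ _), (D t^-1 _ _), (D t^-1 _ _); split.
- exact: mor.
- by apply: mor; rewrite scalerA Vt scale1r.
- by rewrite !DD tV Vt !D1.
by rewrite !DD tV Vt !D1.
Qed.

(** The embeddings with class t h form a line g + t N. For t nonzero they lie in the orbit of f, so
    a polynomial vanishing on that orbit vanishes along the punctured line, hence at g. *)
Lemma zariski_ext U V (h : 'M[k]_(sumn (sa V), sumn (sb U))) f g :
  GRing.closed_field_axiom k ->
  iso (ext_obj h) (SObj f) -> iso (dsum U V) (SObj g) -> zariski_cl (Defs.orbit f) g.
Proof.
move=> clk hf [p1 [p2 [q1 [q2 [/and3P[/eqP h1 /eqP h2 /eqP h3] /and3P[/eqP g1 /eqP g2 /eqP g3] [e1 e2] [e3 e4]]]]]] p p0.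
pose N := q1 *m (prr_mx k (sa U) (sa V) *m h *m inl_mx k (sb U) (sb V)) *m p2.
have gE : g = q1 *m smap (dsum U V) *m p2.
  by rewrite g3 -mulmxA e4 mulmx1.
have orb t : t != 0 -> Defs.orbit f (g + t *: N).
  move=> t0; apply/iso_orbit; apply: iso_trans (iso_sym hf) _.
  apply: iso_trans (iso_sym (ext_obj_scale h t0)) _.
  have -> : g + t *: N = q1 *m smap (ext_obj (t *: h)) *m p2.
    have -> : smap (ext_obj (t *: h)) =
        smap (dsum U V) + t *: (prr_mx k (sa U) (sa V) *m h *m inl_mx k (sb U) (sb V)).
      by rewrite scalemxAl scalemxAr.
    by rewrite gE mulmxDr mulmxDl -scalemxAr -scalemxAl.
  exists p1, p2, q1, q2; split=> //.
    by apply/and3P; split; apply/eqP => //=; rewrite !mulmxA e1 mul1mx.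
  by apply/and3P; split; apply/eqP => //=; rewrite -!mulmxA e3 mulmx1.
have [q qE] := horner_line p (mxvec g) (mxvec N).
have := closed_field_puncture clk (q := q); rewrite qE scale0r addr0; apply=> t t0.
by rewrite qE -linearZ -linearD /=; apply: p0; apply: orb.
Qed.

(** One more sequence is put in front of the chain from g to z. Closures compose because the closure
    of the orbit of f contains every point of the orbit of g. *)
Lemma degenerates_step U V (h : 'M[k]_(sumn (sa V), sumn (sb U))) f g z :
  is_obj U -> is_obj V -> jm k (sa V) *m h = h *m jm k (sb U) ->
  iso (ext_obj h) (SObj f) -> iso (dsum U V) (SObj g) ->
  degenerates g z -> degenerates f z.
Proof.
move=> oU oV ch hf hg [[s [M [U' [V' [vM vUV iM ext iz]]]]] zgz].
have of_ := iso_obj hf (is_obj_ext oU oV ch).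
have [U1 [vU1 iU1]] := iso_valid oU.
have [V1 [vV1 iV1]] := iso_valid oV.
split.
  exists s.+1, (fun i => if i is i'.+2 then M i'.+1 else SObj f),
    (fun i => if i is i'.+2 then U' i'.+1 else U1), (fun i => if i is i'.+2 then V' i'.+1 else V1).
  split.
  - by case=> [|[|i]] // h1; [exact: valid_SObj | apply: vM; lia].
  - by case=> [|[|i]] // h1; apply: vUV; lia.
  - exact: iso_refl.
  - case=> [|[|i]] // h1; last by apply: ext; lia.
    split; first exact: ses_iso iU1 hf iV1 (ses_ext ch).
    apply: iso_trans iM; apply: iso_trans hg; apply: iso_sym.
    exact: iso_dsum.
  exact: iz.
move=> clk z' zz' p p0; apply: (zgz clk z' zz') => g' gg'.
apply: (@zariski_ext U V h f g') => //.
by apply: iso_trans hg _; apply/iso_orbit.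
Qed.

End SameType.
End Degeneration.

(** * Change of generators in the middle term of each move *)

Section Moves.
Variable k : fieldType.

Definition item_dim x := match x with Arc m r => (m + r)%N | Pole r => r end.

Lemma dim_perm (l l' : seq (sobj k)) : Permutation l l' ->
  sumn (sb (dsum_list l)) = sumn (sb (dsum_list l')).
Proof.
rewrite !sumn_sb_list; elim=> //= [y l1 l2 _ -> //|y z l1|l1 l2 l3 _ -> _ //].
by rewrite addnCA.
Qed.

Lemma objs_perm D D' zs : Permutation D D' -> Permutation (objs k D zs) (objs k D' zs).
Proof. by move=> pD; apply: Permutation_app_tail; apply: Permutation_map. Qed.

Lemma objs_cat D D' zs zs' :
  Permutation (objs k D zs ++ objs k D' zs') (objs k (D ++ D') (zs ++ zs')).
Proof.
rewrite /objs !map_cat -!catA; apply: Permutation_app_head; rewrite !catA.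
by apply: Permutation_app_tail; apply: Permutation_app_comm.
Qed.

Section Ambient.
Variables (n : nat) (T : 'M[k]_n).
Hypothesis nilT : T ^+ n = 0.
Implicit Types (u v w : 'rV[k]_n) (W A : 'M[k]_n).

(* The bipicket (m, m-1) contributes an extra empty picket. *)
Definition cov_items xs p (W : 'M[k]_(p, n)) q (A : 'M[k]_(q, n)) := exists zs,
  cov (dsum_list (objs k xs zs)) T W A /\
  sumn (sb (dsum_list (objs k xs zs))) = sumn (map item_dim xs).

Lemma cov_items_cons x xs (W1 A1 W2 A2 : 'M[k]_n) : cov_items [:: x] W1 A1 -> cov_items xs W2 A2 ->
  cov_items (x :: xs) (W1 + W2)%MS (A1 + A2)%MS.
Proof.
move=> [z1 [c1 d1]] [z2 [c2 d2]]; exists (z1 ++ z2).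
have pxs : Permutation _ (objs k (x :: xs) (z1 ++ z2)) := objs_cat [:: x] xs z1 z2.
split; first by apply: (cov_perm pxs); apply/cov_list_cat; apply: cov_dsum.
by rewrite -(dim_perm pxs) sumn_sb_list map_cat sumn_cat -!sumn_sb_list d1 d2 /= addn0.
Qed.

Lemma cov_items_pole v m : (0 < m)%N -> v *m T ^+ m = 0 ->
  cov_items [:: Pole m] (kry T v) (kry T (v *m T ^+ m.-1)).
Proof.
move=> m0 v0; exists [::]; split; last by rewrite /= !addn0.
by apply/cov_dsumC/cov_dsum0 => //; rewrite -subn1; apply: cov_picket.
Qed.

Lemma cov_items_arc v w m r : (0 < r)%N -> (r < m)%N -> v *m T ^+ m = 0 -> w *m T ^+ r = 0 ->
  cov_items [:: Arc m r] (kry T v + kry T w)%MS (kry T (v *m T ^+ (m - 2) + w *m T ^+ r.-1)).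
Proof.
move=> r0 rm v0 w0; have c := cov_bipicket nilT r0 rm v0 w0.
rewrite /cov_items /objs /=; case: eqP => e; last first.
  exists [::]; split; last by rewrite /= !addn0.
  exact/cov_dsumC/cov_dsum0.
have em : m = r.+1 by lia.
exists [:: r]; split; last by rewrite /= !addn0.
subst m; apply: cov_dsum_map (cov_bipicket_succ nilT r0 c) => // W A c0.
exact/cov_dsumC/cov_dsum0.
Qed.

Lemma cov_items_eqmx xs p (W : 'M_(p, n)) q (A : 'M_(q, n)) p' (W' : 'M_(p', n)) q' (A' : 'M_(q', n)) :
  (W :=: W')%MS -> (A :=: A')%MS -> cov_items xs W A -> cov_items xs W' A'.
Proof. by move=> eW eA [zs [c d]]; exists zs; split=> //; apply: cov_eqmx c. Qed.

Variables (em er en es : 'rV[k]_n).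

Let stab4 (a b c d : 'rV[k]_n) :
  (((kry T a + kry T b) + (kry T c + kry T d))%MS *m T <= ((kry T a + kry T b) + (kry T c + kry T d)))%MS.
Proof. by do 3?apply: adds_stable; apply: kry_stable. Qed.

Let mem4 (a b c d : 'rV[k]_n) : let S := ((kry T a + kry T b) + (kry T c + kry T d))%MS in
  [/\ (a <= S)%MS, (b <= S)%MS, (c <= S)%MS & (d <= S)%MS].
Proof.
split.
- exact: submx_trans (self_kry nilT a) (submx_trans (addsmxSl _ _) (addsmxSl _ _)).
- exact: submx_trans (self_kry nilT b) (submx_trans (addsmxSr _ _) (addsmxSl _ _)).
- exact: submx_trans (self_kry nilT c) (submx_trans (addsmxSl _ _) (addsmxSr _ _)).
exact: submx_trans (self_kry nilT d) (submx_trans (addsmxSr _ _) (addsmxSr _ _)).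
Qed.

Let sub4 (a b c d : 'rV[k]_n) (S : 'M[k]_n) : (S *m T <= S)%MS ->
  (a <= S)%MS -> (b <= S)%MS -> (c <= S)%MS -> (d <= S)%MS ->
  ((kry T a + kry T b) + (kry T c + kry T d) <= S)%MS.
Proof. by move=> TS *; rewrite !addsmx_sub !kry_sub //; apply/andP; split; apply/andP. Qed.

(** es + er T^{r-s} is still killed by T^s, and en - em T^{m-p} by T^p. In terms of these the second
    generator of the submodule is that of the arc (m, s), and the first minus the second is that of
    the arc (p, r). *)
Lemma cov_move_A m p r s : (0 < s)%N -> (s < r)%N -> (r < p)%N -> (p < m)%N ->
  em *m T ^+ m = 0 -> en *m T ^+ p = 0 -> er *m T ^+ r = 0 -> es *m T ^+ s = 0 ->
  cov_items [:: Arc m s; Arc p r]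
    ((kry T en + kry T es) + (kry T em + kry T er))%MS
    (kry T (en *m T ^+ (p - 2) + es *m T ^+ s.-1) +
     kry T (es *m T ^+ s.-1 + (em *m T ^+ (m - 2) + er *m T ^+ r.-1)))%MS.
Proof.
move=> s0 sr rp pm m0 n0 r0 s0'.
pose es' := es + er *m T ^+ (r - s); pose en' := en - em *m T ^+ (m - p).
have es'0 : es' *m T ^+ s = 0.
  by rewrite mulmxDl s0' add0r -mulmx_expD subnK ?r0 // ltnW.
have en'0 : en' *m T ^+ p = 0.
  by rewrite mulmxBl n0 sub0r -mulmx_expD subnK ?m0 ?oppr0 // ltnW.
have er0 : - er *m T ^+ r = 0 by rewrite mulNmx r0 oppr0.
have c1 := cov_items_arc s0 (ltn_trans sr (ltn_trans rp pm)) m0 es'0.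
have c2 := cov_items_arc (ltn_trans s0 sr) rp en'0 er0.
have := cov_items_cons c1 c2.
have -> : em *m T ^+ (m - 2) + es' *m T ^+ s.-1 =
    es *m T ^+ s.-1 + (em *m T ^+ (m - 2) + er *m T ^+ r.-1).
  rewrite mulmxDl -mulmx_expD (_ : r - s + s.-1 = r.-1)%N; last by lia.
  by rewrite addrCA.
have -> : en' *m T ^+ (p - 2) + - er *m T ^+ r.-1 =
    (en *m T ^+ (p - 2) + es *m T ^+ s.-1) - (es *m T ^+ s.-1 + (em *m T ^+ (m - 2) + er *m T ^+ r.-1)).
  rewrite mulmxBl -mulmx_expD (_ : m - p + (p - 2) = m - 2)%N; last by lia.
  by rewrite mulNmx opprD [in RHS]addrA addrK opprD addrA.
move: (en *m T ^+ (p - 2) + es *m T ^+ s.-1) (es *m T ^+ s.-1 + _) => a2 a1.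
move/cov_items_eqmx; apply.
- have [h1 h2 h3 h4] := mem4 em es' en' (- er).
  have [g1 g2 g3 g4] := mem4 en es em er.
  have Tg v i := @stable_exp _ _ _ _ _ _ v i (stab4 en es em er).
  have Th v i := @stable_exp _ _ _ _ _ _ v i (stab4 em es' en' (- er)).
  apply/eqmxP/andP; split; apply: sub4 => //; rewrite ?stab4 //.
  + by rewrite addmx_sub ?Tg.
  + by rewrite addmx_sub ?eqmx_opp ?Tg.
  + by rewrite eqmx_opp.
  + have -> : en = en' + em *m T ^+ (m - p) by rewrite subrK.
    by rewrite addmx_sub ?Th.
  + have -> : es = es' + (- er) *m T ^+ (r - s) by rewrite mulNmx addrK.
    by rewrite addmx_sub ?Th.
  + by move: h4; rewrite eqmx_opp.
- apply/eqmxP/andP; split; rewrite addsmx_sub !kry_sub ?adds_stable ?kry_stable //; apply/andP; split.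
  + exact: submx_trans (self_kry nilT _) (addsmxSr _ _).
  + by apply: addmx_sub_adds; rewrite ?eqmx_opp self_kry.
  + by rewrite -[X in (X <= _)%MS](subrK a1 a2) addrC; apply: addmx_sub_adds; rewrite self_kry.
  + exact: submx_trans (self_kry nilT _) (addsmxSl _ _).
Qed.

Let gen2 (a1 a2 : 'rV[k]_n) i :
  (kry T (a1 - a2 *m T ^+ i) + kry T a2 :=: kry T a1 + kry T a2)%MS.
Proof.
have st b1 b2 := adds_stable (kry_stable nilT b1) (kry_stable nilT b2).
apply/eqmxP/andP; split; rewrite addsmx_sub !kry_sub ?st //; apply/andP; split.
- by apply: addmx_sub_adds; rewrite ?eqmx_opp ?self_kry ?mem_kry.
- exact: submx_trans (self_kry nilT _) (addsmxSr _ _).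
- rewrite -[X in (X <= _)%MS](subrK (a2 *m T ^+ i) a1); apply: addmx_sub_adds.
    exact: self_kry.
  exact: mem_kry.
exact: submx_trans (self_kry nilT _) (addsmxSr _ _).
Qed.

(** er + en T^{p-r} replaces er. The second generator of the submodule becomes that of the arc (r,
    s), and the first minus T times the second that of the arc (m, p). *)
Lemma cov_move_C m p r s : (0 < s)%N -> (s < r)%N -> (r < p)%N -> (p < m)%N ->
  em *m T ^+ m = 0 -> en *m T ^+ p = 0 -> er *m T ^+ r = 0 -> es *m T ^+ s = 0 ->
  cov_items [:: Arc m p; Arc r s]
    ((kry T em + kry T er) + (kry T en + kry T es))%MS
    (kry T (em *m T ^+ (m - 2) + er *m T ^+ r.-1) +
     kry T (er *m T ^+ (r - 2) + (en *m T ^+ (p - 2) + es *m T ^+ s.-1)))%MS.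
Proof.
move=> s0 sr rp pm m0 n0 r0 s0'.
pose er' := er + en *m T ^+ (p - r).
have er'0 : er' *m T ^+ r = 0.
  by rewrite mulmxDl r0 add0r -mulmx_expD subnK ?n0 // ltnW.
have en0 : - en *m T ^+ p = 0 by rewrite mulNmx n0 oppr0.
have c1 := cov_items_arc (ltn_trans s0 (ltn_trans sr rp)) pm m0 en0.
have c2 := cov_items_arc s0 sr er'0 s0'.
have := cov_items_cons c1 c2.
have -> : er' *m T ^+ (r - 2) + es *m T ^+ s.-1 =
    er *m T ^+ (r - 2) + (en *m T ^+ (p - 2) + es *m T ^+ s.-1).
  rewrite mulmxDl -mulmx_expD (_ : p - r + (r - 2) = p - 2)%N; last by lia.
  by rewrite addrA.
have -> : em *m T ^+ (m - 2) + - en *m T ^+ p.-1 =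
    (em *m T ^+ (m - 2) + er *m T ^+ r.-1) -
    (er *m T ^+ (r - 2) + (en *m T ^+ (p - 2) + es *m T ^+ s.-1)) *m T ^+ 1.
  rewrite !mulmxDl -!mulmx_expD (_ : r - 2 + 1 = r.-1)%N; last by lia.
  rewrite (_ : p - 2 + 1 = p.-1)%N; last by lia.
  rewrite (_ : s.-1 + 1 = s)%N; last by lia.
  by rewrite s0' addr0 mulNmx opprD addrA addrK.
move: (em *m T ^+ (m - 2) + er *m T ^+ r.-1) (er *m T ^+ (r - 2) + _) => a1 a2.
move/cov_items_eqmx; apply.
- have [h1 h2 h3 h4] := mem4 em (- en) er' es.
  have [g1 g2 g3 g4] := mem4 em er en es.
  have Tg v i := @stable_exp _ _ _ _ _ _ v i (stab4 em er en es).
  have Th v i := @stable_exp _ _ _ _ _ _ v i (stab4 em (- en) er' es).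
  have h2' := h2; rewrite eqmx_opp in h2'.
  apply/eqmxP/andP; split; apply: sub4 => //; rewrite ?stab4 //.
  + by rewrite eqmx_opp.
  + by rewrite addmx_sub ?Tg.
  + have -> : er = er' + (- en) *m T ^+ (p - r) by rewrite mulNmx addrK.
    by rewrite addmx_sub ?Th.
- exact: gen2.
Qed.

Let stab3 (a b c : 'rV[k]_n) :
  (((kry T a + kry T b) + kry T c)%MS *m T <= ((kry T a + kry T b) + kry T c))%MS.
Proof. by do 2?apply: adds_stable; apply: kry_stable. Qed.

Let mem3 (a b c : 'rV[k]_n) : let S := ((kry T a + kry T b) + kry T c)%MS in
  [/\ (a <= S)%MS, (b <= S)%MS & (c <= S)%MS].
Proof.
split.
- exact: submx_trans (self_kry nilT a) (submx_trans (addsmxSl _ _) (addsmxSl _ _)).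
- exact: submx_trans (self_kry nilT b) (submx_trans (addsmxSr _ _) (addsmxSl _ _)).
exact: submx_trans (self_kry nilT c) (addsmxSr _ _).
Qed.

Let sub3 (a b c : 'rV[k]_n) (S : 'M[k]_n) : (S *m T <= S)%MS ->
  (a <= S)%MS -> (b <= S)%MS -> (c <= S)%MS -> ((kry T a + kry T b) + kry T c <= S)%MS.
Proof. by move=> TS aS bS cS; rewrite !addsmx_sub !kry_sub // aS bS. Qed.

(** With es + er T^{r-s} in place of es, the second generator becomes the pole at s and the
    difference of the two the arc (m, r). *)
Lemma cov_move_B m r s : (0 < s)%N -> (s < r)%N -> (r < m)%N ->
  em *m T ^+ m = 0 -> er *m T ^+ r = 0 -> es *m T ^+ s = 0 ->
  cov_items [:: Arc m r; Pole s]
    ((kry T em + kry T es) + kry T er)%MS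
    (kry T (em *m T ^+ (m - 2) + es *m T ^+ s.-1) +
     kry T (es *m T ^+ s.-1 + er *m T ^+ r.-1))%MS.
Proof.
move=> s0 sr rm m0 r0 s0'.
pose es' := es + er *m T ^+ (r - s).
have es'0 : es' *m T ^+ s = 0.
  by rewrite mulmxDl s0' add0r -mulmx_expD subnK ?r0 // ltnW.
have er0 : - er *m T ^+ r = 0 by rewrite mulNmx r0 oppr0.
have c1 := cov_items_arc (ltn_trans s0 sr) rm m0 er0.
have c2 := cov_items_pole s0 es'0.
have := cov_items_cons c1 c2.
have -> : es' *m T ^+ s.-1 = es *m T ^+ s.-1 + er *m T ^+ r.-1.
  by rewrite mulmxDl -mulmx_expD (_ : r - s + s.-1 = r.-1)%N //; lia.
have -> : em *m T ^+ (m - 2) + - er *m T ^+ r.-1 =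
    (em *m T ^+ (m - 2) + es *m T ^+ s.-1) - (es *m T ^+ s.-1 + er *m T ^+ r.-1) *m T ^+ 0.
  by rewrite expr0 mulmx1 mulNmx opprD addrA addrK.
move: (em *m T ^+ (m - 2) + es *m T ^+ s.-1) (es *m T ^+ s.-1 + _) => a1 a2.
move/cov_items_eqmx; apply.
- have [h1 h2 h3] := mem3 em (- er) es'; have [g1 g2 g3] := mem3 em es er.
  have Tg v i := @stable_exp _ _ _ _ _ _ v i (stab3 em es er).
  have Th v i := @stable_exp _ _ _ _ _ _ v i (stab3 em (- er) es').
  have h2' := h2; rewrite eqmx_opp in h2'.
  apply/eqmxP/andP; split; apply: sub3 => //; rewrite ?stab3 //.
  + by rewrite eqmx_opp.
  + by rewrite addmx_sub ?Tg.
  + have -> : es = es' + (- er) *m T ^+ (r - s) by rewrite mulNmx addrK.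
    by rewrite addmx_sub ?Th.
- exact: gen2.
Qed.

(** With er + em T^{m-r} in place of er, the second generator is that of the arc (r, s). Subtracting
    T times it from er T^{r-1} leaves - em T^{m-1}, the pole at m. *)
Lemma cov_move_D m r s : (0 < s)%N -> (s < r)%N -> (r < m)%N ->
  em *m T ^+ m = 0 -> er *m T ^+ r = 0 -> es *m T ^+ s = 0 ->
  cov_items [:: Pole m; Arc r s]
    (kry T er + (kry T em + kry T es))%MS
    (kry T (er *m T ^+ r.-1) +
     kry T (er *m T ^+ (r - 2) + (em *m T ^+ (m - 2) + es *m T ^+ s.-1)))%MS.
Proof.
move=> s0 sr rm m0 r0 s0'.
pose er' := er + em *m T ^+ (m - r).
have er'0 : er' *m T ^+ r = 0.
  by rewrite mulmxDl r0 add0r -mulmx_expD subnK ?m0 // ltnW.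
have em0 : - em *m T ^+ m = 0 by rewrite mulNmx m0 oppr0.
have c1 := cov_items_pole (ltn_trans s0 (ltn_trans sr rm)) em0.
have c2 := cov_items_arc s0 sr er'0 s0'.
have := cov_items_cons c1 c2.
have -> : er' *m T ^+ (r - 2) + es *m T ^+ s.-1 =
    er *m T ^+ (r - 2) + (em *m T ^+ (m - 2) + es *m T ^+ s.-1).
  rewrite mulmxDl -mulmx_expD (_ : m - r + (r - 2) = m - 2)%N; last by lia.
  by rewrite addrA.
have -> : - em *m T ^+ m.-1 = er *m T ^+ r.-1 -
    (er *m T ^+ (r - 2) + (em *m T ^+ (m - 2) + es *m T ^+ s.-1)) *m T ^+ 1.
  rewrite !mulmxDl -!mulmx_expD (_ : r - 2 + 1 = r.-1)%N; last by lia.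
  rewrite (_ : m - 2 + 1 = m.-1)%N; last by lia.
  rewrite (_ : s.-1 + 1 = s)%N; last by lia.
  by rewrite s0' addr0 mulNmx opprD addrA subrr sub0r.
move: (er *m T ^+ r.-1) (er *m T ^+ (r - 2) + _) => a1 a2.
move/cov_items_eqmx; apply.
- have [h1 h2 h3] := mem3 er' es (- em); have [g1 g2 g3] := mem3 em es er.
  have Tg v i := @stable_exp _ _ _ _ _ _ v i (stab3 em es er).
  have Th v i := @stable_exp _ _ _ _ _ _ v i (stab3 er' es (- em)).
  have h3' := h3; rewrite eqmx_opp in h3'.
  rewrite [X in (X :=: _)%MS]addsmxC [X in (_ :=: X)%MS]addsmxC.
  apply/eqmxP/andP; split; apply: sub3 => //; rewrite ?stab3 //.
  + by rewrite addmx_sub ?Tg.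
  + by rewrite eqmx_opp.
  + have -> : er = er' + (- em) *m T ^+ (m - r) by rewrite mulNmx addrK.
    by rewrite addmx_sub ?Th.
- exact: gen2.
Qed.

End Ambient.
End Moves.

(** * Moves realised by extensions *)

Section ArcDegenerates.
Variable k : fieldType.
Implicit Types X Y Z U V : sobj k.

Lemma chain_push n (T : 'M[k]_n) n' (T' : 'M[k]_n') (J : 'M[k]_(n, n')) v c :
  T *m J = J *m T' -> chain T v c *m J = chain T' (v *m J) c.
Proof.
move=> TJ; have TJi i : T ^+ i *m J = J *m T' ^+ i.
  elim: i => [|i IH]; first by rewrite !expr0 mul1mx mulmx1.
  by rewrite exprSr -[T ^+ i * T]/(T ^+ i *m T) -mulmxA TJ mulmxA IH -mulmxA exprSr.
by apply/row_matrixP => i; rewrite row_mul !rowK -!mulmxA TJi.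
Qed.

Lemma exp_push n (T : 'M[k]_n) n' (T' : 'M[k]_n') (J : 'M[k]_(n, n')) p (v : 'M[k]_(p, n)) i :
  T *m J = J *m T' -> v *m T ^+ i *m J = v *m J *m T' ^+ i.
Proof.
move=> TJ; elim: i => [|i IH]; first by rewrite !expr0 !mulmx1.
by rewrite !exprSr !mulmxA -(mulmxA _ T) TJ mulmxA IH.
Qed.

Lemma chainD n (T : 'M[k]_n) u v c : chain T u c + chain T v c = chain T (u + v) c.
Proof. by apply/row_matrixP => i; rewrite linearD /= !rowK mulmxDl. Qed.

Lemma kry_push n (T : 'M[k]_n) n' (T' : 'M[k]_n') (J : 'M[k]_(n, n')) v :
  T ^+ n = 0 -> T' ^+ n' = 0 -> T *m J = J *m T' -> (kry T v *m J :=: kry T' (v *m J))%MS.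
Proof.
move=> nilT nilT' TJ; rewrite /kry (chain_push _ _ TJ); apply: chain_kry => //.
by rewrite -(exp_push _ _ TJ) nilT mulmx0 mul0mx.
Qed.

Lemma kry2_push n (T : 'M[k]_n) n' (T' : 'M[k]_n') (J : 'M[k]_(n, n')) u v :
  T ^+ n = 0 -> T' ^+ n' = 0 -> T *m J = J *m T' ->
  ((kry T u + kry T v)%MS *m J :=: kry T' (u *m J) + kry T' (v *m J))%MS.
Proof.
move=> nilT nilT' TJ; apply: eqmx_trans (addsmxMr _ _ _) _.
by apply: adds_eqmx; apply: kry_push.
Qed.

Lemma push_eq0 n (T : 'M[k]_n) n' (T' : 'M[k]_n') (J : 'M[k]_(n, n')) (v : 'rV[k]_n) i :
  T *m J = J *m T' -> v *m T ^+ i = 0 -> v *m J *m T' ^+ i = 0.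
Proof. by move=> TJ v0; rewrite -(exp_push _ _ TJ) v0 mul0mx. Qed.

(** The dimension equality will turn the covering into an isomorphism; [zs] absorbs the empty
    pickets that arcs (m, m-1) bring along. *)
Definition degen_to X V xs := exists h : 'M[k]_(sumn (sa V), sumn (sb X)),
  jm k (sa V) *m h = h *m jm k (sb X) /\
  exists zs, covers (dsum_list (objs k xs zs)) (ext_obj h) /\
    sumn (sb (dsum_list (objs k xs zs))) = (sumn (sb X) + sumn (sb V))%N.

(* The extension is given by the map that sends the generator of the submodule of
   V to hv. *)
Lemma cov_ext_gens d bX (aX : 'rV[k]_(sumn bX)) c bV (aV : 'rV[k]_(sumn bV)) hv W W' xs :
  let X := @SObj k [:: d] bX (chain (jm k bX) aX (sumn [:: d])) in
  let V := @SObj k [:: c] bV (chain (jm k bV) aV (sumn [:: c])) in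
  let T := jm k (bX ++ bV) in
  aX *m jm k bX ^+ d = 0 -> aV *m jm k bV ^+ c = 0 -> hv *m jm k bX ^+ c = 0 ->
  (W :=: (1%:M : 'M_(sumn bX)))%MS -> (W' :=: (1%:M : 'M_(sumn bV)))%MS ->
  cov_items T xs ((W : 'M_(sumn bX)) *m inl_mx k bX bV + (W' : 'M_(sumn bV)) *m inr_mx k bX bV)%MS
      (kry T (aX *m inl_mx k bX bV) + kry T (hv *m inl_mx k bX bV + aV *m inr_mx k bX bV))%MS ->
  sumn (map item_dim xs) = (sumn bX + sumn bV)%N -> degen_to X V xs.
Proof.
move=> X V T aX0 aV0 hv0 eW eW' [zs [cv dm]] dxs.
exists (chain (jm k bX) hv (sumn [:: c])); split; first exact: jm1_chain.
exists zs; split; last by rewrite dm.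
have nilT := jm_nilp k (bX ++ bV).
apply: cov_eqmx cv.
  apply: eqmx_trans (inl_inr_full k bX bV).
  apply: adds_eqmx.
    by apply: eqmx_trans (eqmxMr _ eW) _; rewrite mul1mx.
  by apply: eqmx_trans (eqmxMr _ eW') _; rewrite mul1mx.
rewrite smap_extE; apply: eqmx_trans (eqmx_sym (glue_eqmx _ _)).
have JX := esym (inl_jm k bX bV); have JV := esym (inr_jm k bX bV).
apply: adds_eqmx; apply: eqmx_sym => /=.
  rewrite (chain_push _ _ JX); apply: chain_kry => //.
  rewrite -(exp_push _ _ JX) (mulmx_exp_ge0 _ aX0) ?mul0mx //= leq_addr //.
rewrite (chain_push _ _ JX) (chain_push _ _ JV) chainD; apply: chain_kry => //.
rewrite mulmxDl -(exp_push _ _ JX) -(exp_push _ _ JV).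
by rewrite (mulmx_exp_ge0 _ hv0) ?(mulmx_exp_ge0 _ aV0) ?mul0mx ?addr0 //= leq_addr.
Qed.

(** The class sends the generator of the submodule of B_2^{m,r} into the socle of the shorter chain
    of B_2^{p,s}; move (B) uses the same kind of class. *)
Lemma degen_A m p r s : (0 < s)%N -> (s < r)%N -> (r < p)%N -> (p < m)%N ->
  degen_to (bipicket k p s) (bipicket k m r) [:: Arc m s; Arc p r].
Proof.
move=> s0 sr rp pm.
have [en [es [n0 s0' eX ->]]] := bipicket_gens k s0 (ltn_trans sr rp).
have [em [er [m0 r0 eV ->]]] := bipicket_gens k (ltn_trans s0 sr) (ltn_trans rp pm).
set TX := jm k [:: p; s] in n0 s0' eX *; set TV := jm k [:: m; r] in m0 r0 eV *.
have nX : TX ^+ _ = 0 := jm_nilp k _; have nV : TV ^+ _ = 0 := jm_nilp k _.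
have nT := jm_nilp k ([:: p; s] ++ [:: m; r]).
have JX := esym (inl_jm k [:: p; s] [:: m; r]); have JV := esym (inr_jm k [:: p; s] [:: m; r]).
apply: (cov_ext_gens (hv := es *m TX ^+ s.-1) _ _ _ eX eV _ _); last by move=> /=; lia.
- exact: arc_gen_eq0 (ltn_trans sr rp) n0 s0'.
- exact: arc_gen_eq0 (ltn_trans s0 sr) (ltn_trans rp pm) m0 r0.
- by rewrite -mulmx_expD (@mulmx_exp_ge0 _ _ _ _ _ _ _ s0') //; lia.
have c := cov_move_A nT s0 sr rp pm (push_eq0 JV m0) (push_eq0 JX n0)
  (push_eq0 JV r0) (push_eq0 JX s0').
rewrite !mulmxDl !(exp_push _ _ JX) !(exp_push _ _ JV).
by apply: cov_items_eqmx c => //; apply: eqmx_sym; apply: adds_eqmx; apply: kry2_push.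
Qed.

(** Submodule and quotient are exchanged compared with (A), and the class now hits er T^{r-2}, one
    step above the socle of the chain of length r; move (D) again follows this pattern. *)
Lemma degen_C m p r s : (0 < s)%N -> (s < r)%N -> (r < p)%N -> (p < m)%N ->
  degen_to (bipicket k m r) (bipicket k p s) [:: Arc m p; Arc r s].
Proof.
move=> s0 sr rp pm.
have [en [es [n0 s0' eV ->]]] := bipicket_gens k s0 (ltn_trans sr rp).
have [em [er [m0 r0 eX ->]]] := bipicket_gens k (ltn_trans s0 sr) (ltn_trans rp pm).
set TV := jm k [:: p; s] in n0 s0' eV *; set TX := jm k [:: m; r] in m0 r0 eX *.
have nX : TX ^+ _ = 0 := jm_nilp k _; have nV : TV ^+ _ = 0 := jm_nilp k _.
have nT := jm_nilp k ([:: m; r] ++ [:: p; s]).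
have JX := esym (inl_jm k [:: m; r] [:: p; s]); have JV := esym (inr_jm k [:: m; r] [:: p; s]).
apply: (cov_ext_gens (hv := er *m TX ^+ (r - 2)) _ _ _ eX eV _ _); last by move=> /=; lia.
- exact: arc_gen_eq0 (ltn_trans s0 sr) (ltn_trans rp pm) m0 r0.
- exact: arc_gen_eq0 (ltn_trans sr rp) n0 s0'.
- by rewrite -mulmx_expD (@mulmx_exp_ge0 _ _ _ _ _ _ _ r0) //; lia.
have c := cov_move_C nT s0 sr rp pm (push_eq0 JX m0) (push_eq0 JV n0)
  (push_eq0 JX r0) (push_eq0 JV s0').
rewrite !mulmxDl !(exp_push _ _ JX) !(exp_push _ _ JV).
by apply: cov_items_eqmx c => //; apply: eqmx_sym; apply: adds_eqmx; apply: kry2_push.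
Qed.

Lemma degen_B m r s : (0 < s)%N -> (s < r)%N -> (r < m)%N ->
  degen_to (bipicket k m s) (picket k 1 r) [:: Arc m r; Pole s].
Proof.
move=> s0 sr rm.
have [em [es [m0 s0' eX ->]]] := bipicket_gens k s0 (ltn_trans sr rm).
have [er [r0 eV ->]] := picket_gens k (ltn_trans s0 sr) (ltn_trans s0 sr).
set TX := jm k [:: m; s] in m0 s0' eX *; set TV := jm k [:: r] in r0 eV *.
have nX : TX ^+ _ = 0 := jm_nilp k _; have nV : TV ^+ _ = 0 := jm_nilp k _.
have nT := jm_nilp k ([:: m; s] ++ [:: r]).
have JX := esym (inl_jm k [:: m; s] [:: r]); have JV := esym (inr_jm k [:: m; s] [:: r]).
apply: (cov_ext_gens (hv := es *m TX ^+ s.-1) _ _ _ eX eV _ _); last by move=> /=; lia.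
- exact: arc_gen_eq0 (ltn_trans sr rm) m0 s0'.
- by rewrite -mulmx_expD (@mulmx_exp_ge0 _ _ _ _ _ _ _ r0) //; lia.
- by rewrite -mulmx_expD (@mulmx_exp_ge0 _ _ _ _ _ _ _ s0') //; lia.
have c := cov_move_B nT s0 sr rm (push_eq0 JX m0) (push_eq0 JV r0) (push_eq0 JX s0').
rewrite subn1 !mulmxDl !(exp_push _ _ JX) !(exp_push _ _ JV).
apply: cov_items_eqmx c => //; apply: eqmx_sym; apply: adds_eqmx; first exact: kry2_push.
exact: kry_push.
Qed.

Lemma degen_D m r s : (0 < s)%N -> (s < r)%N -> (r < m)%N ->
  degen_to (picket k 1 r) (bipicket k m s) [:: Pole m; Arc r s].
Proof.
move=> s0 sr rm.
have [em [es [m0 s0' eV ->]]] := bipicket_gens k s0 (ltn_trans sr rm).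
have [er [r0 eX ->]] := picket_gens k (ltn_trans s0 sr) (ltn_trans s0 sr).
set TV := jm k [:: m; s] in m0 s0' eV *; set TX := jm k [:: r] in r0 eX *.
have nX : TX ^+ _ = 0 := jm_nilp k _; have nV : TV ^+ _ = 0 := jm_nilp k _.
have nT := jm_nilp k ([:: r] ++ [:: m; s]).
have JX := esym (inl_jm k [:: r] [:: m; s]); have JV := esym (inr_jm k [:: r] [:: m; s]).
apply: (cov_ext_gens (hv := er *m TX ^+ (r - 2)) _ _ _ eX eV _ _); last by move=> /=; lia.
- by rewrite -mulmx_expD (@mulmx_exp_ge0 _ _ _ _ _ _ _ r0) //; lia.
- exact: arc_gen_eq0 (ltn_trans sr rm) m0 s0'.
- by rewrite -mulmx_expD (@mulmx_exp_ge0 _ _ _ _ _ _ _ r0) //; lia.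
have c := cov_move_D nT s0 sr rm (push_eq0 JV m0) (push_eq0 JX r0) (push_eq0 JV s0').
rewrite subn1 !mulmxDl !(exp_push _ _ JX) !(exp_push _ _ JV).
apply: cov_items_eqmx c => //; apply: eqmx_sym; apply: adds_eqmx; first exact: kry_push.
exact: kry2_push.
Qed.

End ArcDegenerates.

Section ArcDegenerates2.
Variable k : fieldType.
Implicit Types X Y Z U V : sobj k.

Lemma is_obj_objs D zs : all item_ok D -> is_obj (dsum_list (objs k D zs)).
Proof.
elim: D => [|x D IH] /= => [_|/andP[okx okD]].
  by elim: zs => [|z zs IH]; [exact: is_obj_zero | apply: is_obj_dsum => //; apply: is_obj_picket].
by apply: is_obj_dsum; [apply: is_obj_item | apply: IH].
Qed.

Lemma iso_perm (l l' : seq (sobj k)) Y : is_obj (dsum_list l) -> is_obj (dsum_list l') ->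
  Permutation l l' -> iso (dsum_list l) Y -> iso (dsum_list l') Y.
Proof.
move=> ol ol' pl ll; apply: iso_of_cov => //; first exact: iso_obj ll ol.
  by rewrite -(dim_perm pl) (iso_dim ll).
exact: cov_perm pl _ _ _ _ (cov_of_iso ll).
Qed.

(* The crossing items of a move, as an ordered pair (submodule, quotient). *)
Lemma move_pair_degen x y x' y' : move_pair x y x' y' -> item_ok x -> item_ok y ->
  [/\ item_ok x', item_ok y' & exists X V, [/\ is_obj X, is_obj V, degen_to X V [:: x'; y'] &
     Permutation [:: X; V] [:: item_obj k x; item_obj k y]]].
Proof.
have arcE m r : (r.+1 < m)%N -> item_obj k (Arc m r) = bipicket k m r.
  by move=> rm /=; case: eqP => //; lia.
move=> mp okx oky; have ox := is_obj_item k okx; have oy := is_obj_item k oky.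
case: mp => [[m [p [r [s [/andP[sr rp] [pm [ex [ey h]]]]]]]]|[m [r [s [/andP[sr rm] [ex [ey h]]]]]]]; subst x y.
  have s0 : (0 < s)%N by move: oky => /= /andP[].
  have eX := arcE m r (leq_ltn_trans rp pm); have eY := arcE p s (leq_ltn_trans sr rp).
  rewrite eX in ox *; rewrite eY in oy *.
  case: h => -[-> ->]; split; try by move=> /=; lia.
    exists (bipicket k p s), (bipicket k m r); split=> //; first exact: degen_A.
    exact: perm_swap.
  exists (bipicket k m r), (bipicket k p s); split=> //; exact: degen_C.
have s0 : (0 < s)%N by move: okx => /= /andP[].
have eX := arcE m s (leq_ltn_trans sr rm).
rewrite eX in ox *.
case: h => -[-> ->]; split; try by move=> /=; lia.
  exists (bipicket k m s), (picket k 1 r); split=> //; exact: degen_B.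
exists (picket k 1 r), (bipicket k m s); split=> //; first exact: degen_D.
exact: perm_swap.
Qed.

(** The untouched summands R are put on the side of X. Composing h with the inclusion of X keeps
    them split off from the middle term. *)
Lemma cov_ext_dsum X R V (h : 'M[k]_(sumn (sa V), sumn (sb X))) xs ys (L := dsum_list xs) (S := dsum_list ys) :
  covers L (ext_obj h) -> covers S R ->
  covers (dsum L S) (@ext_obj k (dsum X R) V (h *m inl_mx k (sb X) (sb R))).
Proof.
move=> cL cS; set M := ext_obj _.
pose J := inl_mx k (sb (dsum X R)) (sb V); pose JV := inr_mx k (sb (dsum X R)) (sb V).
pose JX := inl_mx k (sb X) (sb R) *m J; pose JR := inr_mx k (sb X) (sb R) *m J.
have hJX : jm k (sb X) *m JX = JX *m jm k (sb M).
  by rewrite /JX mulmxA -inl_jm -!mulmxA /J inl_jm.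
have hJR : jm k (sb R) *m JR = JR *m jm k (sb M).
  by rewrite /JR mulmxA -inr_jm -!mulmxA /J inl_jm.
have hJV : jm k (sb V) *m JV = JV *m jm k (sb M) by rewrite /JV inr_jm.
have hG : jm k (sb (ext_obj h)) *m glue JX JV = glue JX JV *m jm k (sb M).
  by rewrite jm_glue glueM hJX hJV.
apply: cov_eqmx (cov_dsum (cov_push hG cL) (cov_push hJR cS)).
  rewrite !mul1mx; apply: eqmx_trans (inl_inr_full k (sb (dsum X R)) (sb V)).
  have eJ : (J :=: JX + JR)%MS.
    have -> : J = glue JX JR.
      by rewrite -glueM /glue prl_inl_prr_inr mul1mx.
    exact: glue_eqmx.
  apply: eqmx_trans (adds_eqmx (eqmx_sym eJ) (eqmx_refl JV)).
  apply: eqmx_trans (adds_eqmx (glue_eqmx JX JV) (eqmx_refl JR)) _.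
  by rewrite -addsmxA (addsmxC JV) addsmxA; apply: eqmx_refl.
rewrite smap_ext_glue smap_extE.
have -> : smap (dsum X R) *m J = glue (smap X *m JX) (smap R *m JR).
  by rewrite /JX /JR !mulmxA -glueM -smap_dsum_glue /glue prl_inl_prr_inr mulmx1.
apply: eqmx_sym; apply: eqmx_trans (glue_eqmx _ _) _.
apply: eqmx_trans (adds_eqmx (glue_eqmx _ _) (eqmx_refl _)) _.
apply: eqmx_sym; apply: eqmx_trans (adds_eqmx (glue_eqmx _ _) (eqmx_refl _)) _.
rewrite -(mulmxA h) -/J -/JX -/JV.
by rewrite -addsmxA (addsmxC (_ + _)) addsmxA; apply: eqmx_refl.
Qed.

Section SameType.
Variables a b : seq nat.
Hypotheses (pa : is_part a) (pb : is_part b).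
Implicit Types f g : 'M[k]_(sumn a, sumn b).

Lemma arc_move_degenerates D D' zs g z : all item_ok D -> arc_move D D' ->
  iso (dsum_list (objs k D zs)) (SObj g) -> degenerates g z ->
  exists zs' f, [/\ iso (dsum_list (objs k D' zs')) (SObj f), degenerates f z & all item_ok D'].
Proof.
move=> okD [x [y [x' [y' [rest [pD [pD' mp]]]]]]] ig gz.
have := okD; rewrite (Permutation_all _ pD) => /= /and3P[okx oky okr].
have [okx' oky' [X [V [oX oV [h [ch [zs0 [c0 d0]]]] pXV]]]] := move_pair_degen mp okx oky.
have okD' : all item_ok D'.
  by rewrite (Permutation_all _ pD') /= okx' oky'.
pose R := dsum_list (objs k rest zs).
have oR : is_obj R by apply: is_obj_objs.
pose h' := h *m inl_mx k (sb X) (sb R).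
have ch' : jm k (sa V) *m h' = h' *m jm k (sb (dsum X R)).
  by rewrite /h' mulmxA ch -mulmxA -inl_jm mulmxA.
have oU : is_obj (dsum X R) by apply: is_obj_dsum.
have pl : Permutation (objs k D zs) (X :: V :: objs k rest zs).
  apply: perm_trans (objs_perm k zs pD) _; rewrite /objs /=.
  exact: (Permutation_app_tail (l := [:: _; _]) (l' := [:: X; V]) _ (Permutation_sym pXV)).
have oD := is_obj_objs zs okD.
have og := iso_obj ig oD.
have iUV : iso (dsum (dsum X R) V) (SObj g).
  apply: iso_of_cov => //; first exact: is_obj_dsum.
    by rewrite -(iso_dim ig) (dim_perm pl) /= !sumn_cat -addnA; congr addn; apply: addnC.
  apply/cov_dsumA; have := cov_perm pl (cov_of_iso ig); apply: cov_dsum_map => // W A.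
  exact: cov_dsumC.
have [f iMf] := transport_iso iUV (Y := @ext_obj k (dsum X R) V h') erefl erefl.
exists (zs0 ++ zs), f; split=> //; last exact: (degenerates_step pa pb oU oV ch' iMf iUV gz).
have pl' : Permutation (objs k [:: x'; y'] zs0 ++ objs k rest zs) (objs k D' (zs0 ++ zs)).
  exact: perm_trans (objs_cat k [:: x'; y'] rest zs0 zs) (objs_perm k _ (Permutation_sym pD')).
apply: iso_trans iMf; apply: iso_of_cov.
- exact: is_obj_objs.
- exact: is_obj_ext.
- rewrite -(dim_perm pl') sumn_sb_list map_cat sumn_cat -!sumn_sb_list d0 /= !sumn_cat.
  by rewrite addnAC.
apply: (cov_perm pl'); apply/cov_list_cat.
exact: cov_ext_dsum c0 (cov_of_iso (iso_refl R)).
Qed.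

Lemma arc_moves_degenerates D D' zs g z : all item_ok D -> arc_moves D D' ->
  iso (dsum_list (objs k D zs)) (SObj g) -> degenerates g z ->
  exists zs' f, iso (dsum_list (objs k D' zs')) (SObj f) /\ degenerates f z.
Proof.
move=> okD mv; elim: mv zs g okD => [{}D|{}D D1 {}D' mv _ IH] zs g okD ig gz.
  by exists zs, g.
have [zs1 [g1 [i1 g1z ok1]]] := arc_move_degenerates okD mv ig gz.
exact: IH ok1 i1 g1z.
Qed.

End SameType.
End ArcDegenerates2.

(** * Ranks of powers, and recovery of the empty pickets *)

Section Uniqueness.
Variable k : fieldType.
Implicit Types X Y Z U V : sobj k.

Lemma rank_dsum b1 b2 p1 p2 (A : 'M[k]_(p1, sumn b1)) (B : 'M[k]_(p2, sumn b2)) :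
  \rank (A *m inl_mx k b1 b2 + B *m inr_mx k b1 b2)%MS = (\rank A + \rank B)%N.
Proof.
rewrite -(mxrankMfree A (inl_mx_free k b1 b2)) -(mxrankMfree B (inr_mx_free k b1 b2)) -mxrank_sum_cap.
suff -> : (A *m inl_mx k b1 b2 :&: B *m inr_mx k b1 b2)%MS = 0 by rewrite mxrank0 addn0.
apply/eqP; rewrite -submx0; apply/rV_subP => u; rewrite sub_capmx => /andP[/submxP[x ->] /submxP[y]].
rewrite !mulmxA => /(congr1 (mulmx^~ (prl_mx k b1 b2))).
by rewrite -!mulmxA inl_prl inr_prl !mulmx0 mulmx1 => xA; rewrite mulmxA xA mul0mx sub0mx.
Qed.

Lemma jm_exp_glue b1 b2 i : jm k (b1 ++ b2) ^+ i =
  glue (jm k b1 ^+ i *m inl_mx k b1 b2) (jm k b2 ^+ i *m inr_mx k b1 b2).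
Proof.
elim: i => [|i IH]; first by rewrite !expr0 !mul1mx /glue prl_inl_prr_inr.
rewrite exprS -[_ * _]/(_ *m _) IH jm_glue !mulmxA.
by rewrite -![_ *m _ ^+ i]/(_ * _ ^+ i) -!exprS.
Qed.

Lemma rank_jm1_exp m i : \rank (jm k [:: m] ^+ i) = (m - i)%N.
Proof.
case: m => [|m].
  by apply/eqP; rewrite sub0n -leqn0; exact: rank_leq_row.
have := mulmx1 (jm k [:: m.+1]).
rewrite -{2}(mul1mx (jm k [:: m.+1])) => /(jm1_chain_inv (ltn0Sn m))[v v0 e].
have nilT := jm_nilp k [:: m.+1].
have E1 : jm k [:: m.+1] ^+ i = chain (jm k [:: m.+1]) (v *m jm k [:: m.+1] ^+ i) (sumn [:: m.+1]).
  rewrite -[LHS]mul1mx {1}e; apply/row_matrixP => j; rewrite row_mul !rowK.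
  by rewrite -!mulmx_expD addnC.
have E2 : (jm k [:: m.+1] ^+ i :=: chain (jm k [:: m.+1]) (v *m jm k [:: m.+1] ^+ i) (m.+1 - i))%MS.
  rewrite {1}E1; apply: eqmx_trans (chain_kry nilT _) (eqmx_sym (chain_kry nilT _)).
    by rewrite -mulmx_expD; apply: mulmx_exp_ge0 v0; rewrite /=; lia.
  by rewrite -mulmx_expD; apply: mulmx_exp_ge0 v0; lia.
rewrite E2; apply/eqP; have [mi|im] := leqP m.+1 i.
  by rewrite eqn_leq rank_leq_row; apply: leq_trans (leq0n _); rewrite leqn0 subn_eq0.
apply: (@row_free_select _ _ _ _ i) => [|j l]; first by rewrite /=; lia.
have ijm : (i + j < sumn [:: m.+1])%N by have := ltn_ord j; rewrite /=; lia.
have -> : chain (jm k [:: m.+1]) (v *m jm k [:: m.+1] ^+ i) (m.+1 - i) j l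
   = (row (Ordinal ijm) (1%:M : 'M[k]_(sumn [:: m.+1]))) 0 l.
  by rewrite e rowK mxE -mulmx_expD.
by rewrite !mxE eq_sym -val_eqE /= (addnC i).
Qed.

Lemma rank_jm_exp b i : \rank (jm k b ^+ i) = sumn [seq (x - i)%N | x <- b].
Proof.
elim: b => [|x b IH]; first by apply/eqP; rewrite -leqn0; exact: rank_leq_row.
rewrite (jm_exp_glue [:: x] b) (glue_eqmx (b1 := [:: x])) (rank_dsum (b1 := [:: x])).
by rewrite rank_jm1_exp IH.
Qed.

Lemma jm_iso_rank b b' i : jm_iso k b b' -> \rank (jm k b ^+ i) = \rank (jm k b' ^+ i).
Proof.
move=> [P [Q [h1 h2 h3 h4]]].
have fP : row_free P by apply/row_freeP; exists Q.
have fuP : row_full P by apply/row_fullP; exists Q.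
have := exp_push 1%:M i h1; rewrite !mul1mx => E.
by rewrite -(mxrankMfree _ fP) E (eqmxMfull _ fuP).
Qed.

(** The ranks of the i-th and the next power of T differ by the number of parts above i. *)
Lemma jm_iso_count b b' i : jm_iso k b b' -> count (ltn i) b = count (ltn i) b'.
Proof.
move=> h; have := jm_iso_rank i h; have := jm_iso_rank i.+1 h; rewrite !rank_jm_exp.
have E c : sumn [seq (x - i)%N | x <- c] = (sumn [seq (x - i.+1)%N | x <- c] + count (ltn i) c)%N.
  elim: c => //= x c ->; rewrite -addnCAC ; case: ltnP; lia.
rewrite !E; lia.
Qed.

(** P_0^0 is the zero object; zero entries of [zs], which ranks cannot see, may thus be dropped. *)
Lemma cov_filter0 D zs n (T : 'M[k]_n) p (W : 'M_(p, n)) q (A : 'M_(q, n)) :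
  cov (dsum_list (objs k D zs)) T W A <-> cov (dsum_list (objs k D (filter (ltn 0) zs))) T W A.
Proof.
have pz : Permutation (objs k D zs)
    (nseq (count_mem 0%N zs) (picket k 0 0) ++ objs k D (filter (ltn 0) zs)).
  rewrite /objs catA.
  apply: (@perm_trans _ _ (map (@item_obj k) D ++ nseq (count_mem 0%N zs) (picket k 0 0) ++ map (picket k 0) (filter (ltn 0) zs))).
    apply: Permutation_app_head; elim: zs => //= z zs IH.
    case: z => [|z] /=; first by rewrite ?add1n; apply: perm_skip.
    rewrite ?add0n; apply: perm_trans (perm_skip _ IH) _; exact: Permutation_middle.
  by rewrite catA; apply: Permutation_app_tail; apply: Permutation_app_comm.
have E c : cov (dsum_list (nseq c (picket k 0 0) ++ objs k D (filter (ltn 0) zs))) T W A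
    <-> cov (dsum_list (objs k D (filter (ltn 0) zs))) T W A.
  by elim: c => //= c IH; split=> [/cov_dsum0 h|/IH h]; [apply/IH/h | apply/cov_dsum0].
split=> [/(cov_perm pz)/E // | /E h].
apply: (cov_perm (Permutation_sym pz)); exact: h.
Qed.

Lemma sb_objs D zs : sb (dsum_list (objs k D zs)) = sb (dsum_list (map (@item_obj k) D)) ++ zs.
Proof.
rewrite /objs; elim: D => [|x D IH] /=; first by elim: zs => //= z zs ->.
by rewrite IH catA.
Qed.

(** Arc diagrams forget the empty pickets. The ambient module and the diagram determine them up to
    zero parts, so they determine the object. *)
Lemma iso_objs_zs D zs zs' X Y : all item_ok D -> jm_iso k (sb X) (sb Y) ->
  iso (dsum_list (objs k D zs)) X -> iso (dsum_list (objs k D zs')) Y ->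
  iso (dsum_list (objs k D zs')) X.
Proof.
move=> okD hXY iX iY.
have cnt i : count (ltn i) zs = count (ltn i) zs'.
  have := jm_iso_count i (jm_iso_trans (iso_jm iX).2 (jm_iso_trans hXY (jm_iso_sym (iso_jm iY).2))).
  by rewrite !sb_objs !count_cat => /addnI.
have pf : perm_eq (filter (ltn 0) zs) (filter (ltn 0) zs').
  have cmE (s : seq nat) v : (count_mem v (filter (ltn 0) s) + count (ltn v) s = if v is v'.+1 then count (ltn v') s else count (ltn 0) s)%N.
    elim: s => [|u s IH]; first by case: v.
    by move: IH; case: v => [|v]; case: u => [|u] /=; rewrite ?eqSS; lia.
  apply/allP => v _; apply/eqP; apply: (@addIn (count (ltn v) zs)); rewrite cmE [in RHS](cnt v) cmE.
  by case: (v) => [|v']; apply: cnt.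
have pobj : Permutation (objs k D (filter (ltn 0) zs)) (objs k D (filter (ltn 0) zs')).
  apply: Permutation_app_head; apply: Permutation_map; exact: perm_eq_Permutation.
have oD := is_obj_objs k zs okD; have oD' := is_obj_objs k zs' okD.
apply: iso_of_cov => //; first exact: iso_obj iX oD.
  rewrite -(iso_dim iX) !sb_objs !sumn_cat; congr addn.
  have sf (s : seq nat) : sumn s = sumn (filter (ltn 0) s).
    by elim: s => //= -[|u] s /= ->.
  by rewrite (sf zs) (sf zs'); apply/esym/perm_sumn.
exact: (cov_filter0 _ _ _ _ _).2 (cov_perm pobj ((cov_filter0 _ _ _ _ _).1 (cov_of_iso iX))).
Qed.

Lemma arcdiag_objs D X : arcdiag X D <-> all item_ok D /\ exists zs, iso (dsum_list (objs k D zs)) X.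
Proof.
have E zs : all item_ok D -> iso (dsum_list (objs k D zs)) (dsum (dsum_list (map (@item_obj k) D)) (dsum_list (map (picket k 0) zs))).
  move=> okD; have o1 := is_obj_objs k zs okD.
  have o2 := is_obj_objs k [::] okD; rewrite /objs /= cats0 in o2.
  have o3 := is_obj_objs k (D := [::]) zs erefl.
  apply: iso_sym; apply: iso_of_cov => //; first exact: is_obj_dsum.
    by rewrite sb_objs /= !sumn_cat; congr addn; elim: zs {o1 o3} => //= z zs ->.
  by apply/cov_list_cat; apply: cov_of_iso; apply: iso_refl.
split=> -[okD [zs h]]; split=> //; exists zs.
  exact: iso_trans (E zs okD) (iso_sym h).
exact: iso_trans (iso_sym h) (E zs okD).
Qed.

(** The moves lead to some f' with the diagram of f but unknown empty pickets; [iso_objs_zs]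
    identifies it with f. *)
Theorem arc_degenerates a b (f g : 'M[k]_(sumn a, sumn b)) : is_part a -> is_part b ->
  is_obj (SObj f) -> is_obj (SObj g) -> leq_arc (SObj f) (SObj g) -> degenerates f g.
Proof.
move=> pa pb of_ og [DY [DZ [/arcdiag_objs[okY [zY iY]] [/arcdiag_objs[okZ [zZ iZ]] mv]]]].
have [zs' [f' [i' [d1 d2]]]] := arc_moves_degenerates pa pb okZ mv iZ (degenerates_iso pa pb og (iso_refl _)).
have ff' : iso (SObj f) (SObj f').
  apply: (iso_trans _ i'); apply: iso_sym.
  by apply: (@iso_objs_zs DY zY zs' (SObj f) (SObj f')) => //; exact: jm_iso_refl.
split.
  case: d1 => [s [M [U [V [h1 h2 h3 h4 h5]]]]]; exists s, M, U, V; split=> //.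
  exact: iso_trans ff' h3.
move=> clk g' gg' p p0; apply: (d2 clk g' gg') => y f'y; apply: p0.
by apply/iso_orbit; apply: iso_trans ff' _; apply/iso_orbit.
Qed.

End Uniqueness.

(** * Left exactness of Hom *)

Section HomDim.
Variable k : fieldType.
Implicit Types X Y Z U V M : sobj k.

Lemma hom_eqs_linear X Y : linear (@hom_eqs k X Y).
Proof.
move=> c [p1 p2] [q1 q2]; rewrite /hom_eqs /=; congr (_, _, _); rewrite /=.
- by rewrite mulmxDr mulmxDl -scalemxAr -scalemxAl scalerBr opprD addrACA.
- by rewrite mulmxDr mulmxDl -scalemxAr -scalemxAl scalerBr opprD addrACA.
by rewrite mulmxDr mulmxDl -scalemxAr -scalemxAl scalerBr opprD addrACA.
Qed.

HB.instance Definition _ X Y := GRing.isLinear.Build k _ _ _ (@hom_eqs k X Y) (@hom_eqs_linear X Y).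

Definition hom_space X Y := lker (linfun (@hom_eqs k X Y)).

Lemma hom_spaceP X Y p : (p \in hom_space X Y) = is_mor p.1 p.2.
Proof.
rewrite memv_ker lfunE /hom_eqs /= /is_mor.
by rewrite -[0]/((0, 0), 0) !xpair_eqE !subr_eq0 andbA.
Qed.

Definition post_comp X Y Z (m1 : 'M[k]_(sumn (sa Y), sumn (sa Z)))
  (m2 : 'M[k]_(sumn (sb Y), sumn (sb Z))) (p : 'M[k]_(sumn (sa X), sumn (sa Y)) * 'M[k]_(sumn (sb X), sumn (sb Y))) :=
  (p.1 *m m1, p.2 *m m2).

Lemma post_comp_linear X Y Z m1 m2 : linear (@post_comp X Y Z m1 m2).
Proof. by move=> c p q; congr (_, _); rewrite /= mulmxDl -scalemxAl. Qed.

HB.instance Definition _ X Y Z m1 m2 :=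
  GRing.isLinear.Build k _ _ _ (@post_comp X Y Z m1 m2) (@post_comp_linear X Y Z m1 m2).

Lemma dim_hom_mono X Y Z m1 m2 : row_free m1 -> row_free m2 -> @is_mor k Y Z m1 m2 ->
  (dim_hom X Y <= dim_hom X Z)%N.
Proof.
move=> f1 f2 mor; pose F := linfun (@post_comp X Y Z m1 m2).
have inj : lker F == 0%VS.
  apply/lker0P => p q; rewrite !lfunE /= /post_comp => -[e1 e2].
  rewrite [p]surjective_pairing [q]surjective_pairing.
  by rewrite (row_free_inj f1 e1) (row_free_inj f2 e2).
rewrite /dim_hom -/(hom_space X Y) -(limg_dim_eq (f := F)); last first.
  by rewrite (eqP inj) capv0.
apply: dimvS; apply/subvP => _ /memv_imgP[p pH ->].
rewrite hom_spaceP in pH; rewrite -/(hom_space X Z) hom_spaceP lfunE /=.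
exact: is_mor_comp pH mor.
Qed.

Lemma dim_hom_iso X Y Z : iso Y Z -> dim_hom X Y = dim_hom X Z.
Proof.
have free m n (P : 'M[k]_(m, n)) Q : P *m Q = 1%:M -> row_free P by move=> e; apply/row_freeP; exists Q.
move=> [p1 [p2 [q1 [q2 [hp hq [h1 h2] [h3 h4]]]]]]; apply/eqP; rewrite eqn_leq.
by rewrite (dim_hom_mono X (free _ _ _ _ h1) (free _ _ _ _ h3) hp)
           (dim_hom_mono X (free _ _ _ _ h2) (free _ _ _ _ h4) hq).
Qed.

(** Rank and nullity of composition with M -> V. A morphism killed by it factors through U in each
    component, and injectivity of U -> M makes the factors a morphism. *)
Lemma dim_hom_ses X U M V : ses U M V -> (dim_hom X M <= dim_hom X U + dim_hom X V)%N.
Proof.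
move=> [u1 [u2 [v1 [v2 [mu mv /and3P[fu1 fv1 /andP[e1 k1]] /and3P[fu2 fv2 /andP[e2 k2]]]]]]].
pose F := linfun (@post_comp X M V v1 v2); pose G := linfun (@post_comp X U M u1 u2).
rewrite {1}/dim_hom -/(hom_space X M) -(limg_ker_dim F (hom_space X M)); apply: leq_add.
  have : (hom_space X M :&: lker F <= G @: hom_space X U)%VS.
    apply/subvP => -[p1 p2]; rewrite memv_cap hom_spaceP memv_ker lfunE /= /post_comp.
    move=> /andP[/and3P[/= /eqP h1 /eqP h2 /eqP h3] /eqP [z1 z2]].
    have /submxP[q1 eq1] : (p1 <= u1)%MS by apply: submx_trans k1; apply/sub_kermxP.
    have /submxP[q2 eq2] : (p2 <= u2)%MS by apply: submx_trans k2; apply/sub_kermxP.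
    apply/memv_imgP; exists (q1, q2); last by rewrite lfunE /= /post_comp /= eq1 eq2.
    case/and3P: mu => /eqP g1 /eqP g2 /eqP g3.
    rewrite hom_spaceP /=; apply/and3P; split; apply/eqP.
    - by apply: (row_free_inj fu1); rewrite -!mulmxA g1 !mulmxA -(mulmxA _ q1) -eq1 h1.
    - by apply: (row_free_inj fu2); rewrite -!mulmxA g2 !mulmxA -(mulmxA _ q2) -eq2 h2.
    apply: (row_free_inj fu2).
    by rewrite -!mulmxA -g3 (mulmxA q1) -eq1 h3 eq2.
  by move/dimvS/leq_trans; apply; rewrite /dim_hom -/(hom_space X U) -(limg_ker_dim G (hom_space X U)) leq_addl.
apply: dimvS; apply/subvP => _ /memv_imgP[p pH ->].
rewrite hom_spaceP in pH; rewrite -/(hom_space X V) hom_spaceP lfunE /=.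
exact: is_mor_comp pH mv.
Qed.

(** With [dim_hom_ses] this closes one link of an ext chain: from M through the sum of the
    dimensions for U and V to their direct sum. *)
Lemma dim_hom_dsum X U V : (dim_hom X U + dim_hom X V <= dim_hom X (dsum U V))%N.
Proof.
have e := smap_dsumE U V.
have mU : @is_mor k U (dsum U V) (inl_mx k _ _) (inl_mx k _ _).
  by apply/and3P; split; apply/eqP; rewrite ?inl_jm // e inl_glue.
have mV : @is_mor k V (dsum U V) (inr_mx k _ _) (inr_mx k _ _).
  by apply/and3P; split; apply/eqP; rewrite ?inr_jm // e inr_glue.
pose F := linfun (@post_comp X U (dsum U V) (inl_mx k _ _) (inl_mx k _ _)).
pose G := linfun (@post_comp X V (dsum U V) (inr_mx k _ _) (inr_mx k _ _)).
have dF : \dim (F @: hom_space X U) = dim_hom X U.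
  apply: limg_dim_eq; apply/eqP; rewrite -subv0; apply/subvP => p.
  rewrite memv_cap => /andP[_]; rewrite memv_ker lfunE /= /post_comp memv0 => /eqP[].
  move=> /(congr1 (mulmx^~ (prl_mx k _ _))) + /(congr1 (mulmx^~ (prl_mx k _ _))).
  rewrite -!mulmxA !inl_prl !mulmx1 !mul0mx => p1 p2.
  by rewrite [p]surjective_pairing p1 p2.
have dG : \dim (G @: hom_space X V) = dim_hom X V.
  apply: limg_dim_eq; apply/eqP; rewrite -subv0; apply/subvP => p.
  rewrite memv_cap => /andP[_]; rewrite memv_ker lfunE /= /post_comp memv0 => /eqP[].
  move=> /(congr1 (mulmx^~ (prr_mx k _ _))) + /(congr1 (mulmx^~ (prr_mx k _ _))).
  rewrite -!mulmxA !inr_prr !mulmx1 !mul0mx => p1 p2.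
  by rewrite [p]surjective_pairing p1 p2.
have FG0 : (F @: hom_space X U :&: G @: hom_space X V = 0)%VS.
  apply/eqP; rewrite -subv0; apply/subvP => y; rewrite memv_cap memv0.
  move=> /andP[/memv_imgP[p _ ->] /memv_imgP[q _]]; rewrite !lfunE /= /post_comp => -[].
  move=> /(congr1 (mulmx^~ (prl_mx k _ _))) + /(congr1 (mulmx^~ (prl_mx k _ _))).
  rewrite -!mulmxA !inl_prl !inr_prl !mulmx1 !mulmx0 => -> ->.
  by rewrite !mul0mx.
rewrite -dF -dG -dimv_disjoint_sum //; apply: dimvS.
rewrite subv_add; apply/andP; split; apply/subvP => _ /memv_imgP[p pH ->];
  rewrite hom_spaceP in pH; rewrite -/(hom_space X (dsum U V)) hom_spaceP lfunE /=.
  exact: is_mor_comp pH mU.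
exact: is_mor_comp pH mV.
Qed.

Theorem ext_hom Y Z : leq_ext Y Z -> leq_hom Y Z.
Proof.
move=> [s [M [U [V [vM vUV iY ext iZ]]]]] X _.
rewrite (dim_hom_iso X iY) (dim_hom_iso X iZ).
have h i : (i <= s)%N -> (dim_hom X (M 1%N) <= dim_hom X (M i.+1))%N.
  elim: i => // i IH is_; apply: leq_trans (IH (ltnW is_)) _.
  have [|sesi isoi] := ext i.+1; first by rewrite is_.
  rewrite -(dim_hom_iso X isoi); apply: leq_trans (dim_hom_ses X sesi) _.
  exact: dim_hom_dsum.
exact: h.
Qed.

End HomDim.

(* A linear map has rank at least r if some r x r determinant of its coordinates is
   nonzero; for a given map of rank r this determinant can be normalised to 1. *)
Lemma rank_witness (k : fieldType) (D C : vectType k) (F : 'Hom(D, C)) :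
  let r := \dim (limg F) in
  exists (p : 'I_r -> D) (cf : 'I_r -> {scalar C}),
    (\matrix_(i, j) (cf j (F (p i)) : k) = 1%:M) /\
    forall G : 'Hom(D, C), \det (\matrix_(i, j) (cf j (G (p i)) : k)) != 0 ->
      (r <= \dim (limg G))%N.
Proof.
move=> r; pose q (i : 'I_r) := (vbasis (limg F))`_i.
have qP i : exists p, F p == q i.
  have /memv_imgP[p _ ->] : q i \in limg F.
    by apply: vbasis_mem; rewrite mem_nth // size_tuple.
  by exists p.
pose p i := xchoose (qP i).
have pE i : F (p i) = q i by apply/eqP/(xchooseP (qP i)).
exists p, (fun j => coord (vbasis (limg F)) j : {scalar C}); split.
  apply/matrixP => i j; rewrite [LHS]mxE [RHS]mxE pE.
  exact: (coord_free i j (basis_free (vbasisP _))).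
move=> G; set M := \matrix_(i, j) _ => d0.
pose w := [tuple G (p i) | i < r].
have wE (l : 'I_r) : w`_l = G (p l) by rewrite -(tnth_nth 0 w l) tnth_mktuple.
have fw : free w.
  apply/freeP => c cw i; pose cv : 'rV_r := \row_i c i.
  suff /rowP/(_ i) : cv = 0 by rewrite !mxE.
  apply: (row_free_inj (A := M)); first by rewrite row_free_unit unitmxE unitfE.
  apply/rowP => j; rewrite mul0mx !mxE.
  have := congr1 (coord (vbasis (limg F)) j) cw; rewrite linear_sum linear0 => e.
  apply: (etrans _ e); apply: eq_bigr => l _; rewrite linearZ /= !mxE wE //.
have dw : \dim <<w>>%VS = r by move: fw; rewrite /free size_tuple => /eqP.
rewrite -[X in (X <= _)%N]dw.
apply: dimvS; apply/span_subvP => z /mapP[i _ ->]; exact: memv_img (memvf _).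
Qed.

(** * Semicontinuity of Hom dimensions on orbit closures *)

Section Semicontinuity.
Variable k : fieldType.
Variables (X : sobj k) (a b : seq nat).
Implicit Types f g y : 'M[k]_(sumn a, sumn b).

Let DT : vectType k :=
  ('M[k]_(sumn (sa X), sumn a) * 'M[k]_(sumn (sb X), sumn b))%type.
Let CT : vectType k :=
  ('M[k]_(sumn (sa X), sumn a) * 'M[k]_(sumn (sb X), sumn b) * 'M[k]_(sumn (sa X), sumn b))%type.

Lemma third_sum (I : finType) (c : I -> k) (p1 : 'M[k]_(sumn (sa X), sumn a))
    (N : I -> 'M[k]_(sumn a, sumn b)) :
  (((0, 0), p1 *m \sum_l c l *: N l) : CT) = \sum_l c l *: (((0, 0), p1 *m N l) : CT).
Proof.
apply: (big_rec2 (fun z (w : CT) => (((0, 0), p1 *m z) : CT) = w)).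
  by rewrite mulmx0.
move=> i z w _ <-; rewrite mulmxDr -scalemxAr.
by congr (_, _, _); rewrite /= !scaler0 addr0.
Qed.

Let E y := linfun (@hom_eqs k X (SObj y)).

Let EE y p : E y p = @hom_eqs k X (SObj y) p.
Proof. exact: lfunE. Qed.

Lemma dim_hom_rank y : (dim_hom X (SObj y) + \dim (limg (E y)) =
  \dim (fullv : {vspace ('M[k]_(sumn (sa X), sumn a) * 'M[k]_(sumn (sb X), sumn b))%type}))%N.
Proof. by rewrite /dim_hom -[RHS](limg_ker_dim (E y) fullv) capfv. Qed.

(** The determinant normalised to 1 at g is a polynomial in the entries of the embedding. If the
    equations had smaller rank at f, it would vanish on the orbit of f and hence at g. *)
Lemma zariski_dim_hom f g : zariski_cl (Defs.orbit f) g ->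
  (dim_hom X (SObj f) <= dim_hom X (SObj g))%N.
Proof.
move=> cl; suff : (\dim (limg (E g)) <= \dim (limg (E f)))%N.
  by have := dim_hom_rank f; have := dim_hom_rank g; lia.
have [p [cf [Fg FG]]] := rank_witness (E g).
set r := \dim (limg (E g)) in p cf Fg FG *.
rewrite leqNgt; apply/negP => lt.
pose N l : 'M[k]_(sumn a, sumn b) := vec_mx (delta_mx 0 l).
(* Only the commuting square, the third component of the equations, involves y, and it does so
   linearly. *)
have affine y i : E y (p i) = E 0 (p i) + \sum_l mxvec y 0 l *: (((0, 0), (p i).1 *m N l) : CT).
  have -> : E y (p i) = E 0 (p i) + (((0, 0), (p i).1 *m y) : CT).
    by rewrite !EE /hom_eqs /=; congr (_, _, _); rewrite /= ?addr0 // mulmx0 sub0r addrC.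
  congr (_ + _).
  have ey : y = \sum_l mxvec y 0 l *: N l.
    rewrite -{1}(mxvecK y) {1}(row_sum_delta (mxvec y)) linear_sum; apply: eq_bigr => l _.
    exact: linearZ.
  by rewrite -third_sum -ey.
pose Q : 'M[{mpoly k[sumn a * sumn b]}]_r := \matrix_(i, j)
  ((cf j (E 0 (p i)))%:MP + \sum_l cf j (((0, 0), (p i).1 *m N l) : CT) *: 'X_l).
have QE y i j : (Q i j).@[fun l => mxvec y 0 l] = cf j (E y (p i)).
  rewrite mxE (affine y i) mevalD mevalC [RHS]linearD [X in _ = _ + X]linear_sum; congr (_ + _).
  rewrite [LHS](raddf_sum (meval _)); apply: eq_bigr => l _.
  by rewrite [RHS]linearZ /= mevalZ mevalXU mulrC.
have dQ y : (\det Q).@[fun l => mxvec y 0 l] = \det (\matrix_(i, j) (cf j (E y (p i)) : k)).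
  rewrite -det_map_mx; congr (\det _); apply/matrixP => i j.
  by rewrite [RHS]mxE -QE; apply: mxE.
have : (\det Q).@[fun l => mxvec g 0 l] = 0.
  apply: cl => y oy; rewrite dQ; apply/eqP; apply: contraTT lt => /(FG (E y)).
  rewrite -leqNgt; have -> : \dim (limg (E y)) = \dim (limg (E f)) => //.
  move/iso_orbit: oy => /(dim_hom_iso X); have := dim_hom_rank f; have := dim_hom_rank y.
  by lia.
by rewrite dQ Fg det1 => /eqP; rewrite oner_eq0.
Qed.

End Semicontinuity.

Theorem deg_hom (k : fieldType) (a b c : seq nat) (f g : 'M[k]_(sumn a, sumn b)) :
  leq_deg c f g -> leq_hom (SObj f) (SObj g).
Proof.
move=> deg X _; apply: zariski_dim_hom; apply: (deg g _).2.
by apply/iso_orbit; apply: iso_refl.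
Qed.

(** * Intersecting the submodule with natural subspaces *)

Section HomArc.
Variable k : fieldType.
Implicit Types X Y Z U V M : sobj k.

(* Subfunctors of the identity on k[T]-modules. *)
Definition natural (S : forall n, 'M[k]_n -> 'M[k]_n) :=
  forall n n' (T : 'M[k]_n) (T' : 'M[k]_n') (J : 'M[k]_(n, n')),
  T *m J = J *m T' -> (S n T *m J <= S n' T')%MS.

Definition phi (S : forall n, 'M[k]_n -> 'M[k]_n) X :=
  \rank (smap X :&: S (sumn (sb X)) (jm k (sb X)))%MS.

Section Phi.
Variable S : forall n, 'M[k]_n -> 'M[k]_n.
Hypothesis natS : natural S.

Lemma phi_iso X Y : iso X Y -> phi S X = phi S Y.
Proof.
have half X' Y' : iso X' Y' -> (phi S X' <= phi S Y')%N.
  move=> [p1 [p2 [q1 [q2 [/and3P[_ /eqP h2 /eqP h3] _ [e1 e2] [e3 e4]]]]]].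
  have fp : row_free p2 by apply/row_freeP; exists q2.
  rewrite /phi -(mxrankMfree _ fp); apply: mxrankS; rewrite sub_capmx; apply/andP; split.
    by apply: submx_trans (submxMr _ (capmxSl _ _)) _; rewrite -h3 submxMl.
  by apply: submx_trans (submxMr _ (capmxSr _ _)) _; apply: natS.
move=> h; apply/eqP; rewrite eqn_leq; apply/andP; split; apply: half => //.
exact: iso_sym.
Qed.

(** Naturality along injections and projections makes the subspace additive, so the intersection
    splits as well. *)
Lemma phi_dsum X Y : phi S (dsum X Y) = (phi S X + phi S Y)%N.
Proof.
rewrite /phi -(rank_dsum (b1 := sb X) (b2 := sb Y)).
have e := smap_dsumE X Y.
suff h : (smap (dsum X Y) :&: S (jm k (sb (dsum X Y))) :=:
   (smap X :&: S (jm k (sb X))) *m inl_mx k (sb X) (sb Y) +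
   (smap Y :&: S (jm k (sb Y))) *m inr_mx k (sb X) (sb Y))%MS by rewrite h.
apply/eqmxP/andP; split; last first.
  rewrite addsmx_sub !sub_capmx; apply/andP; split; apply/andP; split.
  - apply: submx_trans (submxMr _ (capmxSl _ _)) _.
    by rewrite -[X in (X <= _)%MS](inl_glue _ (smap Y *m inr_mx k (sb X) (sb Y))) -e submxMl.
  - by apply: submx_trans (submxMr _ (capmxSr _ _)) _; apply: natS; rewrite inl_jm.
  - apply: submx_trans (submxMr _ (capmxSl _ _)) _.
    by rewrite -[X in (X <= _)%MS](inr_glue (smap X *m inl_mx k (sb X) (sb Y))) -e submxMl.
  - by apply: submx_trans (submxMr _ (capmxSr _ _)) _; apply: natS; rewrite inr_jm.
apply/rV_subP => u; rewrite sub_capmx => /andP[uA uS].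
rewrite -[u]mulmx1 -(prl_inl_prr_inr k (sb X) (sb Y)) mulmxDr !mulmxA.
apply: addmx_sub_adds; apply: submxMr; rewrite sub_capmx; apply/andP; split.
- apply: submx_trans (submxMr _ uA) _.
  rewrite e glueM -!mulmxA inl_prl inr_prl mulmx1 mulmx0 /glue mulmx0 addr0.
  exact: submxMl.
- by apply: submx_trans (submxMr _ uS) _; apply: natS; rewrite jm_prl.
- apply: submx_trans (submxMr _ uA) _.
  rewrite e glueM -!mulmxA inl_prr inr_prr mulmx1 mulmx0 /glue mulmx0 add0r.
  exact: submxMl.
by apply: submx_trans (submxMr _ uS) _; apply: natS; rewrite jm_prr.
Qed.

Lemma phi_sa0 X : sumn (sa X) = 0%N -> phi S X = 0%N.
Proof.
move=> h; apply/eqP; rewrite -leqn0 -h.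
by apply: leq_trans (mxrankS (capmxSl _ _)) (rank_leq_row _).
Qed.

Lemma phi_objs D zs : phi S (dsum_list (objs k D zs)) = sumn [seq phi S (item_obj k x) | x <- D].
Proof.
elim: D => [|x D IH] /=; last by rewrite phi_dsum IH.
apply: phi_sa0; rewrite /objs /=; elim: zs => //= z zs; exact.
Qed.

(** For m = r + 1 the two objects differ by an empty picket, which [phi] does not see; so every arc
    can be computed on a bipicket. *)
Lemma phi_arc m r : (0 < r)%N -> (r < m)%N -> phi S (item_obj k (Arc m r)) = phi S (bipicket k m r).
Proof.
move=> r0 rm /=; case: eqP => // e; have em : m = r.+1 by lia.
subst m; have h : iso (dsum (picket k 2 r.+1) (picket k 0 r)) (bipicket k r.+1 r).
  apply: iso_of_cov.
  - by apply: is_obj_dsum; apply: is_obj_picket.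
  - exact: is_obj_bipicket.
  - by rewrite /= !addn0.
  exact: (cov_bipicket_succ (jm_nilp k [:: r.+1; r]) r0 (cov_of_iso (iso_refl (bipicket k r.+1 r)))).
by rewrite -(phi_iso h) phi_dsum (phi_sa0 (X := picket k 0 r)) ?addn0.
Qed.

Lemma natural_stable n (T : 'M[k]_n) : (S T *m T <= S T)%MS.
Proof. by apply: natS. Qed.

Lemma rank_kry_cap1 n (T A : 'M[k]_n) (a : 'rV[k]_n) : T ^+ n = 0 -> a != 0 -> a *m T = 0 ->
  \rank (kry T a :&: A)%MS = (a <= A)%MS.
Proof.
move=> nilT a0 aT; have ka : (kry T a :=: a)%MS.
  apply/eqmxP; rewrite kry_sub ?aT ?sub0mx // submx_refl /=.
  exact: self_kry.
rewrite (cap_eqmx ka (eqmx_refl A)); have [aA|aA] := boolP (a <= A)%MS.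
  by rewrite (capmx_idPl aA) rank_rV a0.
apply/eqP; rewrite mxrank_eq0 -submx0; apply/rV_subP => u; rewrite sub_capmx => /andP[/sub_rVP[c ->] ca].
have [->|c0] := eqVneq c 0; first by rewrite scale0r sub0mx.
by case/negP: aA; rewrite -(scalerK c0 a) scalemx_sub.
Qed.

(** The module generated by a is uniserial of length 2: its submodules are 0, the span of a T, and
    itself. *)
Lemma rank_kry_cap2 n (T A : 'M[k]_n) (a : 'rV[k]_n) : T ^+ n = 0 -> a *m T != 0 ->
  a *m T ^+ 2 = 0 -> (A *m T <= A)%MS ->
  \rank (kry T a :&: A)%MS = ((a *m T <= A)%MS + (a <= A)%MS)%N.
Proof.
move=> nilT aT0 aT2 TA.
have aTT : a *m T *m T = 0 by rewrite -mulmxA -[T *m T]/(T * T) -expr2.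
have ka : (kry T a :=: a + a *m T)%MS.
  apply/eqmxP; rewrite kry_sub ?addsmx_sub ?self_kry ?addsmxSl //=.
    by have := mem_kry nilT a 1; rewrite expr1.
  by rewrite addsmxMr aTT addsmx_sub sub0mx addsmxSr.
have rk : \rank (kry T a) = 2%N.
  have fr : row_free (chain T a 2).
    apply/inj_row_free => x; rewrite (mulmx_sum_row) !big_ord_recl big_ord0 addr0 !rowK expr0 expr1 mulmx1 => e.
    have e1 := congr1 (mulmx^~ T) e; rewrite mulmxDl mul0mx -!scalemxAl aTT scaler0 addr0 in e1.
    have x0 : x 0 ord0 = 0 by apply/eqP; move/eqP: e1; rewrite scaler_eq0 (negbTE aT0) orbF.
    rewrite x0 scale0r add0r in e.
    have x1 : x 0 (lift ord0 ord0) = 0 by apply/eqP; move/eqP: e; rewrite scaler_eq0 (negbTE aT0) orbF.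
    apply/rowP => i; rewrite mxE; have [->|/eqP] := eqVneq i ord0; first by [].
    by case: (unliftP ord0 i) => [j ->|-> //]; rewrite (ord1 j) x1.
  by rewrite -(chain_kry nilT aT2) (eqP fr).
have [aA|aA] := boolP (a <= A)%MS.
  have aTA : (a *m T <= A)%MS by apply: submx_trans TA; apply: submxMr.
  by rewrite aTA (capmx_idPl _) ?rk // kry_sub.
rewrite addn0.
have E : (kry T a :&: A :=: kry T (a *m T) :&: A)%MS.
  apply/eqmxP/andP; split; last first.
    by apply: capmxS => //; rewrite kry_sub ?kry_stable // -[a *m T]mulmx1 -mulmxA -[T *m _]/(T * 1) mulr1 -[T]expr1 mem_kry.
  apply/rV_subP => u; rewrite !sub_capmx => /andP[uk uA]; rewrite uA andbT.
  move: uk uA; rewrite ka => /sub_addsmxP[[x y] /= ->] uA.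
  have x0 : x = 0.
    rewrite [x]mx11_scalar; have [->|x0] := eqVneq (x 0 0) 0; first by rewrite raddf0.
    have : (x *m (a *m T) <= A)%MS.
      apply: submx_trans TA; have := submxMr T uA; rewrite mulmxDl -!mulmxA (mulmxA a T) aTT mulmx0 addr0.
      by [].
    rewrite [x]mx11_scalar mul_scalar_mx => h; case/negP: aA.
    have aTA : (a *m T <= A)%MS by rewrite -(scalerK x0 (a *m T)) scalemx_sub.
    have : (x *m a <= A)%MS.
      rewrite -[x *m a](addrK (y *m (a *m T))) addmx_sub // eqmx_opp.
      exact: submx_trans (submxMl _ _) aTA.
    rewrite {1}[x]mx11_scalar mul_scalar_mx => h'.
    by rewrite -(scalerK x0 a) scalemx_sub.
  rewrite x0 mul0mx add0r; exact: submx_trans (submxMl _ _) (self_kry nilT _).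
rewrite E rank_kry_cap1 //.
Qed.

End Phi.
End HomArc.

(** * Values on poles and arcs *)

Section ItemValues.
Variable k : fieldType.

Definition power_im j n (T : 'M[k]_n) : 'M[k]_n := T ^+ j.

(** The possible images of delta(1) under k[T]-maps out of N_(m,r): the two generators may go to
    arbitrary elements of ker T^m and ker T^r. *)
Definition bip_image m r n (T : 'M[k]_n) : 'M[k]_n :=
  (kermx (T ^+ m) *m T ^+ (m - 2) + kermx (T ^+ r) *m T ^+ r.-1)%MS.

Lemma natural_power_im j : natural (power_im j).
Proof.
move=> n n' T T' J TJ; have := exp_push 1%:M j TJ; rewrite !mul1mx /power_im => ->.
exact: submxMl.
Qed.

Lemma ker_push n n' (T : 'M[k]_n) (T' : 'M[k]_n') (J : 'M[k]_(n, n')) i j :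
  T *m J = J *m T' -> (kermx (T ^+ i) *m T ^+ j *m J <= kermx (T' ^+ i) *m T' ^+ j)%MS.
Proof.
move=> TJ; rewrite (exp_push _ _ TJ) submxMr //; apply/sub_kermxP.
by rewrite -(exp_push _ _ TJ) mulmx_ker mul0mx.
Qed.

Lemma natural_bip_image m r : natural (bip_image m r).
Proof.
by move=> n n' T T' J TJ; rewrite /bip_image addsmxMr addsmxS // ker_push.
Qed.

Lemma bip_imageP m r n (T : 'M[k]_n) (u : 'rV[k]_n) :
  reflect (exists v w : 'rV[k]_n, [/\ v *m T ^+ m = 0, w *m T ^+ r = 0 &
             u = v *m T ^+ (m - 2) + w *m T ^+ r.-1]) (u <= bip_image m r T)%MS.
Proof.
apply: (iffP sub_addsmxP) => [[[x y] /= ->]|[v [w [/sub_kermxP/submxP[x ->] /sub_kermxP/submxP[y ->] ->]]]].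
  exists (x *m kermx (T ^+ m)), (y *m kermx (T ^+ r)).
  by rewrite -(mulmxA x) -(mulmxA y) !mulmx_ker !mulmx0 -(mulmxA x) -(mulmxA y).
by exists (x, y); rewrite /= (mulmxA x) (mulmxA y).
Qed.

Lemma power_im_mem n (T : 'M[k]_n) (v : 'rV[k]_n) i j : (j <= i)%N -> (v *m T ^+ i <= power_im j T)%MS.
Proof. by move=> ji; rewrite -(subnK ji) mulmx_expD submxMl. Qed.

Lemma bip_image_mem n (T : 'M[k]_n) (v : 'rV[k]_n) m r i : (0 < r)%N -> (r <= i)%N ->
  v *m T ^+ i = 0 -> (v *m T ^+ i.-1 <= bip_image m r T)%MS.
Proof.
move=> r0 ri v0; apply/bip_imageP; exists 0, (v *m T ^+ (i - r)).
rewrite !mul0mx add0r -!mulmx_expD; split=> //; first by rewrite subnK.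
by congr (_ *m _ ^+ _); clear -r0 ri; lia.
Qed.

Lemma bip_image_power n (T : 'M[k]_n) m r : (r.+1 < m)%N ->
  (bip_image m r T <= power_im r.-1 T)%MS.
Proof.
move=> rm; rewrite addsmx_sub submxMl andbT.
rewrite (_ : m - 2 = (m - 2 - r.-1) + r.-1)%N; last by lia.
by rewrite exprD mulmxA submxMl.
Qed.

Lemma powers_decrease n (T : 'M[k]_n) i j : (j <= i)%N -> (T ^+ i <= T ^+ j)%MS.
Proof. by move=> ji; rewrite -(subnK ji) exprD submxMl. Qed.

Lemma kry_exp0 n (T : 'M[k]_n) (v : 'rV[k]_n) i : v *m T ^+ i = 0 -> kry T v *m T ^+ i = 0.
Proof.
move=> v0; apply/row_matrixP => j; rewrite row_mul rowK -mulmx_expD row0.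
by apply: mulmx_exp_ge0 v0; apply: leq_addl.
Qed.

(** The component T^{s-1} of delta(1) in N_(s) is nonzero, while T^s kills N_(s). [X] is a variable
    so that the embedding can be supplied in the form of a chain. *)
Lemma bipicket_top (X : sobj k) n s (i0 : 'I_(sumn (sa X))) : (0 < s)%N -> (s < n)%N ->
  X = bipicket k n s -> i0 = 0%N :> nat -> ~~ (row i0 (smap X) <= jm k (sb X) ^+ s)%MS.
Proof.
move=> s0 sn eX; move: i0; rewrite {}eX => i0 i00; apply/negP => /submxP[z e].
have := congr1 (mulmx^~ (prr_mx k [:: n] [:: s])) e.
rewrite (exp_push _ _ (jm_prr k [:: n] [:: s])).
have -> : jm k [:: s] ^+ s = 0.
  have h j : j = sumn [:: s] -> jm k [:: s] ^+ j = 0 by move=> ->; apply: jm_nilp.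
  by apply: h; rewrite /= addn0.
have sl : (s.-1 < sumn [:: s])%N by rewrite /=; clear -s0; lia.
have ll : (n + s.-1 < sumn ([:: n] ++ [:: s]))%N by rewrite /=; clear -s0; lia.
move/matrixP/(_ 0 (Ordinal sl)); rewrite mulmx0 (@mul_prrE _ _ [:: n] [:: s] _ _ _ (Ordinal ll)).
  rewrite !mxE /= i00 addn0 eqxx orbT => /eqP; by rewrite oner_eq0.
by rewrite /= (addn0 n).
Qed.

Lemma phi_pole S n : natural S -> (0 < n)%N -> exists v : 'rV[k]_(sumn [:: n]),
  [/\ v *m jm k [:: n] ^+ n = 0, jm k [:: n] ^+ n = 0, v *m jm k [:: n] ^+ n.-1 != 0 &
   phi S (item_obj k (Pole n)) = (v *m jm k [:: n] ^+ n.-1 <= S _ (jm k [:: n]))%MS].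
Proof.
move=> natS n0; have nilT := jm_nilp k [:: n].
have [v [v0 e1 e]] := picket_gens k n0 n0; exists v.
have := is_obj_picket k n0; rewrite /= e => /is_objP[fr _].
rewrite subn1 in fr *; set a := v *m _ in fr *.
have a1 : a *m jm k [:: n] = 0 by rewrite -mulmx_expS prednK.
have a0 : a != 0.
  apply/eqP => a0; move: fr; rewrite a0.
  have -> : chain (jm k [:: n]) 0 (sumn [:: 1%N]) = 0 by apply/row_matrixP => i; rewrite rowK mul0mx row0.
  by rewrite /row_free mxrank0.
split=> //.
  by rewrite -[LHS]mul1mx; apply/eqP; rewrite -submx0 -(eqmxMr _ e1) kry_exp0 ?sub0mx.
rewrite -(rank_kry_cap1 _ nilT a0 a1) /phi /=.
have ka : (chain (jm k [:: n]) a (sumn [:: 1%N]) :=: kry (jm k [:: n]) a)%MS.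
  by apply: chain_kry => //; rewrite /= expr1.
by rewrite (cap_eqmx ka (eqmx_refl _)).
Qed.

Lemma phi_bipicket S n s : natural S -> (0 < s)%N -> (s < n)%N ->
  exists v w : 'rV[k]_(sumn [:: n; s]), let T := jm k [:: n; s] in
   let a := v *m T ^+ (n - 2) + w *m T ^+ s.-1 in
  [/\ [/\ v *m T ^+ n = 0, w *m T ^+ s = 0 & T ^+ n = 0], a *m T = v *m T ^+ n.-1,
      a *m T != 0, ~~ (a <= T ^+ s)%MS &
      phi S (bipicket k n s) = ((a *m T <= S _ T)%MS + (a <= S _ T)%MS)%N].
Proof.
move=> natS s0 sn; have nilT := jm_nilp k [:: n; s].
have [v [w [v0 w0 e1 e]]] := bipicket_gens k s0 sn; exists v, w => T a.
have i00 : (0 < sumn [:: 2%N])%N by [].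
have a2 : a *m T ^+ 2 = 0 by apply: arc_gen_eq0.
have eaT : a *m T = v *m T ^+ n.-1.
  rewrite mulmxDl -!mulmx_expS prednK // w0 addr0; congr (_ *m _ ^+ _); clear -s0 sn; lia.
have aT0 : a *m T != 0.
  have := is_obj_bipicket k s0 sn; rewrite e => /is_objP[/= fr _].
  apply/eqP => aT0; have i1 : (1 < sumn [:: 2%N])%N by [].
  have /(row_free_inj fr) : (delta_mx 0 (Ordinal i1) : 'rV_(sumn [:: 2%N])) *m chain T a (sumn [:: 2%N]) = 0 *m chain T a (sumn [:: 2%N]).
    by rewrite mul0mx -rowE rowK expr1 aT0.
  by move/matrixP/(_ 0 (Ordinal i1)); rewrite !mxE !eqxx => /eqP; rewrite oner_eq0.
split=> //.
- split=> //; rewrite -[LHS]mul1mx; apply/eqP; rewrite -submx0 -(eqmxMr _ e1) addsmxMr.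
  by rewrite !kry_exp0 ?adds0mx ?sub0mx // (mulmx_exp_ge0 _ w0) // ltnW.
- have := @bipicket_top (@SObj k [:: 2%N] [:: n; s] (chain T a (sumn [:: 2%N]))) n s (Ordinal i00) s0 sn (esym e) erefl.
  by rewrite /= rowK expr0 mulmx1.
rewrite -(rank_kry_cap2 nilT aT0 a2 (natural_stable natS T)) /phi e /=.
have ka : (chain T a (sumn [:: 2%N]) :=: kry T a)%MS by apply: chain_kry.
by rewrite (cap_eqmx ka (eqmx_refl _)).
Qed.

Lemma exp0_ge n (T : 'M[k]_n) i j : (i <= j)%N -> T ^+ i = 0 -> T ^+ j = 0.
Proof. by move=> ij T0; rewrite -(subnK ij) exprD T0 mulr0. Qed.

Lemma phi_power_im v x : (0 < v)%N -> item_ok x ->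
  phi (power_im v.-1) (item_obj k x) = item_ge v x.
Proof.
move=> v0; have nat1 := natural_power_im v.-1.
case: x => [n s|n] ok; last first.
  have [z [z0 T0 t0 ->]] := phi_pole nat1 ok; rewrite /item_ge; congr nat_of_bool.
  have [vn|nv] := leqP v n; first by rewrite power_im_mem //; clear -vn; lia.
  apply/negbTE; apply: contra t0; rewrite /power_im (@exp0_ge _ _ _ v.-1 _ T0) ?submx0 //.
  by clear -nv; lia.
have s0 : (0 < s)%N by move: ok => /=; lia.
have sn : (s < n)%N by move: ok => /=; lia.
rewrite phi_arc //; have [x [y [[x0 y0 T0] eaT aT0 top ->]]] := phi_bipicket nat1 s0 sn.
rewrite /item_ge; congr addn; congr nat_of_bool.
  have [vn|nv] := leqP v n; first by rewrite eaT power_im_mem //; clear -vn; lia.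
  apply/negbTE; apply: contra aT0; rewrite /power_im (@exp0_ge _ _ _ v.-1 _ T0) ?submx0 //.
  by clear -nv; lia.
have [vs|sv] := leqP v s.
  by rewrite addmx_sub // power_im_mem //; clear -vs sn; lia.
apply/negbTE; apply: contra top => /submx_trans; apply; apply: powers_decrease.
by clear -sv; lia.
Qed.

Lemma phi_bip_image m r x : (0 < r)%N -> (r.+1 < m)%N -> item_ok x ->
  phi (bip_image m r) (item_obj k x) = item_phi m r x.
Proof.
move=> r0 rm; have nat2 := natural_bip_image m r.
have zero n (T : 'M[k]_n) i : (i < r)%N -> T ^+ i = 0 -> bip_image m r T = 0.
  move=> ir T0; apply/eqP; rewrite -submx0; apply: submx_trans (bip_image_power _ rm) _.
  by rewrite /power_im (@exp0_ge _ _ _ r.-1 _ T0) //; clear -ir; lia.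
case: x => [n s|n] ok; last first.
  have [z [z0 T0 t0 ->]] := phi_pole nat2 ok; rewrite /item_phi; congr nat_of_bool.
  have [rn|nr] := leqP r n; first by rewrite bip_image_mem.
  by apply/negbTE; apply: contra t0; rewrite (zero _ _ _ nr T0) submx0.
have s0 : (0 < s)%N by move: ok => /=; lia.
have sn : (s < n)%N by move: ok => /=; lia.
rewrite phi_arc //; have [x [y [[x0 y0 T0] eaT aT0 top ->]]] := phi_bipicket nat2 s0 sn.
rewrite /item_phi; congr addn; congr nat_of_bool.
  have [rn|nr] := leqP r n; first by rewrite eaT bip_image_mem.
  by apply/negbTE; apply: contra aT0; rewrite (zero _ _ _ nr T0) submx0.
have [rs|sr] := leqP r s; last first.
  rewrite andbF; apply/negbTE; apply: contra top => /submx_trans; apply.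
  apply: submx_trans (bip_image_power _ rm) _; apply: powers_decrease.
  by clear -sr; lia.
rewrite andbT; have [mn|nm] := leqP m n; last first.
  (* T times an element of the image is v T^{m-1}, which is zero since T^n = 0 and n < m. *)
  apply/negbTE; apply: contra aT0 => /bip_imageP[v [w [v0 w0 ->]]].
  rewrite mulmxDl -!mulmx_expS prednK // w0 addr0 (exp0_ge _ T0) ?mulmx0 //.
  by clear -nm rm; lia.
apply/bip_imageP; exists (x *m jm k [:: n; s] ^+ (n - m)), (y *m jm k [:: n; s] ^+ (s - r)).
rewrite -!mulmx_expD; split; rewrite ?subnK //.
by congr (_ *m _ ^+ _ + _ *m _ ^+ _); clear -mn rs rm r0; lia.
Qed.

End ItemValues.

(** * Maps out of a bipicket *)

Section HomBipicket.
Variable k : fieldType.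

Lemma dim_rowspace n p (U : {vspace 'rV[k]_n}) (A : 'M[k]_(p, n)) :
  (forall u, (u \in U) = (u <= A)%MS) -> \dim U = \rank A.
Proof.
move=> UA; pose L := linfun (mulmxr (row_base A) : 'rV[k]_(\rank A) -> 'rV[k]_n).
have LE x : L x = x *m row_base A by rewrite lfunE.
have kL : lker L == 0%VS.
  by apply/lker0P => x y; rewrite !LE; apply: row_free_inj; apply: row_base_free.
have -> : U = (L @: fullv)%VS.
  apply/vspaceP => u; rewrite UA -(eq_row_base A); apply/submxP/memv_imgP => [[x ->]|[x _ ->]].
    by exists x; rewrite ?memvf ?LE.
  by exists x; rewrite LE.
by rewrite limg_dim_eq ?(eqP kL) ?capv0 // dimvf /dim /= mul1n.
Qed.

Definition gen_image (X Y : sobj k) (u : 'rV[k]_(sumn (sb X)))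
  (p : 'M[k]_(sumn (sa X), sumn (sa Y)) * 'M[k]_(sumn (sb X), sumn (sb Y))) := u *m p.2.

Lemma gen_image_linear X Y u : linear (@gen_image X Y u).
Proof. by move=> c p q; rewrite /gen_image /= mulmxDr scalemxAr. Qed.

HB.instance Definition _ X Y u :=
  GRing.isLinear.Build k _ _ _ (@gen_image X Y u) (@gen_image_linear X Y u).

(** The matrix sizes depend on the sequences; the casts run along equalities of naturals, which
    [castmx_id] erases. *)
Lemma SObj_inj a b (f g : 'M[k]_(sumn a, sumn b)) : SObj f = SObj g -> f = g.
Proof.
have cast (X Y : sobj k) (e : X = Y) :
  castmx (congr1 (fun Z => sumn (sa Z)) e, congr1 (fun Z => sumn (sb Z)) e) (smap X) = smap Y.
  by case: Y / e; rewrite castmx_id.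
by move=> e; have := cast _ _ e; rewrite castmx_id.
Qed.

(* The bipicket represents the functor sending a submodule to its intersection with
   [bip_image m r], up to a part that does not see the embedding. *)
Definition represents m r (B : sobj k) (u : 'rV[k]_(sumn (sb B))) :=
  [/\ (0 < sumn (sa B))%N, smap B = chain (jm k (sb B)) u (sumn (sa B)),
      (u <= bip_image m r (jm k (sb B)))%MS &
      forall n (T : 'M[k]_n) (x : 'rV_n), (x <= bip_image m r T)%MS ->
        jm k (sa B) *m chain T x (sumn (sa B)) = chain T x (sumn (sa B)) *m T /\
        exists2 p : 'M_(sumn (sb B), n), jm k (sb B) *m p = p *m T & u *m p = x].

Lemma bipicket_represents m r : (0 < r)%N -> (r < m)%N ->
  exists u, represents m r (B := bipicket k m r) u.
Proof.
move=> r0 rm; have [v [w [v0 w0 _ eB]]] := bipicket_gens k r0 rm.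
have esm := SObj_inj eB; rewrite eB.
pose u := v *m jm k [:: m; r] ^+ (m - 2) + w *m jm k [:: m; r] ^+ r.-1.
exists u; split=> //; first by apply/bip_imageP; exists v, w.
move=> n T x /bip_imageP[y [z [y0 z0 ex]]].
have x2 : x *m T ^+ 2 = 0 by rewrite ex; apply: arc_gen_eq0.
split; first exact: jm1_chain.
pose p := @glue k [:: m] [:: r] _ (chain T y (sumn [:: m])) (chain T z (sumn [:: r])).
exists p; first by rewrite /p (@jm_glue k [:: m] [:: r]) (@glueM k [:: m] [:: r]) !jm1_chain.
have i00 : (0 < sumn [:: 2%N])%N by [].
have gl := smap_bipicket_glue r0 (leq_ltn_trans r0 rm) y0 z0.
have ru c n' (T' : 'M[k]_n') (t : 'rV_n') (i : 'I_c) : i = 0%N :> nat -> row i (chain T' t c) = t.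
  by move=> i0; rewrite rowK i0 expr0 mulmx1.
have eu : row (Ordinal i00) (smap (bipicket k m r)) = u.
  by transitivity (row (Ordinal i00) (chain (jm k [:: m; r]) u (sumn [:: 2%N]))); [rewrite -esm | rewrite ru].
by rewrite -eu -row_mul gl ru.
Qed.

Section Represented.
Variables (m r : nat) (B : sobj k) (u : 'rV[k]_(sumn (sb B))).
Hypothesis repB : represents m r u.

(** A morphism that kills the generator kills the whole submodule, so its first component is zero by
    injectivity of the embedding of Y. The remaining conditions see only the ambient module of Y. *)
Lemma mem_gen_kernel Y p : is_obj Y ->
  (p \in (hom_space B Y :&: lker (linfun (@gen_image B Y u)))%VS) =
  [&& p.1 == 0, jm k (sb B) *m p.2 == p.2 *m jm k (sb Y) & smap B *m p.2 == 0].
Proof.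
move=> /is_objP[ff _]; have [i00 eB _ _] := repB.
rewrite memv_cap hom_spaceP memv_ker lfunE /= /gen_image /is_mor.
have eu : u = row (Ordinal i00) (smap B) by rewrite eB rowK expr0 mulmx1.
apply/andP/and3P => [[/and3P[/eqP h1 h2 /eqP h3] /eqP z]|[/eqP z1 h2 /eqP z2]].
  have z2 : smap B *m p.2 = 0.
    by rewrite eB (chain_push _ _ (eqP h2)) z; apply/row_matrixP => i; rewrite rowK mul0mx row0.
  by split; rewrite ?z2 //; apply/eqP; apply: (row_free_inj ff); rewrite mul0mx h3.
by rewrite eu -row_mul z1 z2 row0 !mul0mx mulmx0 h2 !eqxx.
Qed.

(** Representability supplies the map of ambient modules; as x lies in the submodule of Y, so does
    its chain, and this gives the map of submodules. *)
Lemma gen_image_sub Y x : is_obj Y ->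
  (x \in (linfun (@gen_image B Y u) @: hom_space B Y)%VS) =
  (x <= smap Y :&: bip_image m r (jm k (sb Y)))%MS.
Proof.
move=> /is_objP[ff fT]; have [i00 eB uS ext] := repB; rewrite sub_capmx; apply/idP/idP.
  case/memv_imgP=> -[p1 p2]; rewrite hom_spaceP => /and3P[/= /eqP h1 /eqP h2 /eqP h3].
  rewrite lfunE /= /gen_image /= => ->; apply/andP; split.
    have eu : u = row (Ordinal i00) (smap B) by rewrite eB rowK expr0 mulmx1.
    by rewrite {1}eu -row_mul -h3 row_mul submxMl.
  apply: submx_trans (natural_bip_image m r h2); exact: submxMr.
case/andP=> xf /ext[cx [p2 p2T up2]].
have cf : (chain (jm k (sb Y)) x (sumn (sa B)) <= smap Y)%MS.
  by apply: chain_sub => //; rewrite -fT submxMl.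
pose p1 := chain (jm k (sb Y)) x (sumn (sa B)) *m pinvmx (smap Y).
have p1f : p1 *m smap Y = chain (jm k (sb Y)) x (sumn (sa B)) by rewrite /p1 mulmxKpV.
clearbody p1; apply/memv_imgP; exists (p1, p2); last by rewrite lfunE.
rewrite hom_spaceP; apply/and3P; split; apply/eqP => //=.
  by apply: (row_free_inj ff); rewrite -!mulmxA p1f fT (mulmxA p1) p1f.
by rewrite p1f eB (chain_push _ _ p2T) up2.
Qed.

Lemma dim_hom_represented Y : is_obj Y -> dim_hom B Y =
  (\dim (hom_space B Y :&: lker (linfun (@gen_image B Y u))) + phi (bip_image m r) Y)%N.
Proof.
move=> oY; rewrite /phi -(dim_rowspace (fun x => gen_image_sub x oY)).
by rewrite limg_ker_dim.
Qed.

End Represented.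

(** f and g have the same underlying modules, so the two kernels of evaluation are the same space
    and cancel from the Hom dimensions. *)
Lemma hom_phi m r a b (f g : 'M[k]_(sumn a, sumn b)) : (0 < r)%N -> (r < m)%N ->
  is_obj (SObj f) -> is_obj (SObj g) -> leq_hom (SObj f) (SObj g) ->
  (phi (bip_image m r) (SObj f) <= phi (bip_image m r) (SObj g))%N.
Proof.
move=> r0 rm of_ og le; have [u rep] := bipicket_represents r0 rm.
have := le (bipicket k m r); rewrite (dim_hom_represented rep of_) (dim_hom_represented rep og).
have -> : (hom_space (bipicket k m r) (SObj f) :&: lker (linfun (@gen_image (bipicket k m r) (SObj f) u))
   = hom_space (bipicket k m r) (SObj g) :&: lker (linfun (@gen_image (bipicket k m r) (SObj g) u)))%VS.
  apply/vspaceP => p.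
  have h1 := @mem_gen_kernel _ _ _ _ rep (SObj f) p of_.
  have h2 := @mem_gen_kernel _ _ _ _ rep (SObj g) p og.
  exact: (etrans h1 (esym h2)).
rewrite leq_add2l; apply; apply/and3P; split=> //=.
  by rewrite /is_part /= andbT ltnW.
exact: is_obj_bipicket.
Qed.

End HomBipicket.

(** * From Hom inequalities to moves *)

Section HomToArc.
Variable k : fieldType.
Implicit Types X Y : sobj k.

(** T^j of the ambient module maps onto T^j of the cokernel, with the intersection as kernel; hence
    its dimension depends on the type only. *)
Lemma rank_cap_coker a b c (f : 'M[k]_(sumn a, sumn b)) j : coker_type c f ->
  (\rank (jm k c ^+ j) + \rank (f :&: jm k b ^+ j)%MS)%N = \rank (jm k b ^+ j).
Proof.
move=> [p /and3P[/eqP pT fp /eqmxP kp]].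
rewrite (cap_eqmx kp (eqmx_refl _)) capmxC -(mxrank_mul_ker (jm k b ^+ j) p).
have := exp_push 1%:M j pT; rewrite !mul1mx => ->.
by rewrite (eqmxMfull _ fp).
Qed.

Lemma jm_sqr0 a : all (fun x => x <= 2)%N a -> jm k a ^+ 2 = 0.
Proof.
move=> a2; apply/eqP; rewrite -mxrank_eq0 rank_jm_exp.
elim: a a2 => //= x a IH /andP[x2 /IH/eqP->]; by rewrite addn0 subn_eq0.
Qed.

Lemma classify_obj X : is_obj X -> all (fun x => x <= 2)%N (sa X) ->
  exists D zs, all item_ok D /\ iso (dsum_list (objs k D zs)) X.
Proof.
move=> oX a2; have /is_objP[_ fT] := oX.
have nilT := jm_nilp k (sb X).
have eA := genmxE (smap X).
have [] := @classify k _ _ nilT 1%:M <<smap X>>%MS.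
- exact: submx1.
- exact: submx1.
- by rewrite eA (eqmxMr _ eA) -fT submxMl.
- apply/eqP; rewrite -submx0 -mulmxA (eqmxMr _ eA) mulmxA -fT -mulmxA -fT mulmxA.
  by rewrite -[jm _ _ *m _]/(_ * _) -expr2 jm_sqr0 // mul0mx sub0mx.
move=> D [zs [okD cv rk]]; exists D, zs; split=> //.
apply: iso_of_cov => //; first exact: is_obj_objs.
  by rewrite -rk mxrank1.
exact: cov_eqmx cv.
Qed.

(** Arcs are the parts 2 and poles the parts 1 of alpha, while empty pickets contribute zeros; so
    alpha fixes the number of poles. *)
Lemma count_sa_objs D zs :
  (count (ltn 1) (sa (dsum_list (objs k D zs))) + count is_pole D)%N =
  count (ltn 0) (sa (dsum_list (objs k D zs))).
Proof.
rewrite /objs; elim: D => [|x D IH] /=; first by elim: zs => //= z zs ->.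
by move: IH; rewrite !count_cat; case: x => [m r|m] /=; [case: eqP|]; rewrite /=; lia.
Qed.

Lemma count_poles D zs X : iso (dsum_list (objs k D zs)) X ->
  (count (ltn 1) (sa X) + count is_pole D)%N = count (ltn 0) (sa X).
Proof.
move=> /iso_jm[h _]; rewrite -(jm_iso_count 0 h) -(jm_iso_count 1 h).
exact: count_sa_objs.
Qed.

Lemma phi_diagram S (val : item -> nat) D zs X : natural S -> iso (dsum_list (objs k D zs)) X ->
  (forall x, item_ok x -> phi S (item_obj k x) = val x) -> all item_ok D ->
  phi S X = sumn (map val D).
Proof.
move=> natS iX hval okD; rewrite -(phi_iso natS iX) phi_objs //.
by elim: D okD {iX} => //= x D IH /andP[/hval-> /IH->].
Qed.

(** The three inputs of the combinatorics: beta and gamma fix the endpoints through powers of T,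
    alpha fixes the number of poles, and Hom gives the inequalities. *)
Theorem hom_arc a b c (f g : 'M[k]_(sumn a, sumn b)) : all (fun x => x <= 2)%N a ->
  is_obj (SObj f) -> is_obj (SObj g) -> coker_type c f -> coker_type c g ->
  leq_hom (SObj f) (SObj g) -> leq_arc (SObj f) (SObj g).
Proof.
move=> a2 of_ og cf cg le.
have [DY [zY [okY iY]]] := classify_obj of_ a2.
have [DZ [zZ [okZ iZ]]] := classify_obj og a2.
have [|||D'' [mv pD]] := arc_moves_of_phi okY okZ.
- move=> v v0; have nat1 := @natural_power_im k v.-1.
  rewrite -(phi_diagram nat1 iY (fun x => phi_power_im k v0) okY).
  rewrite -(phi_diagram nat1 iZ (fun x => phi_power_im k v0) okZ).
  have := rank_cap_coker v.-1 cf; rewrite -(rank_cap_coker v.-1 cg); exact: addnI.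
- have := count_poles iY; rewrite -(count_poles iZ) => /=; exact: addnI.
- move=> m r r0 rm; have nat2 := @natural_bip_image k m r.
  rewrite -(phi_diagram nat2 iY (fun x => phi_bip_image k r0 rm) okY).
  rewrite -(phi_diagram nat2 iZ (fun x => phi_bip_image k r0 rm) okZ).
  by apply: hom_phi => //; apply: ltnW.
exists D'', DZ; split; last by split=> //; apply/arcdiag_objs; split=> //; exists zZ.
have okD'' : all item_ok D''.
  by move: okY; rewrite (Permutation_all _ pD).
apply/arcdiag_objs; split=> //; exists zY.
apply: iso_perm iY; try exact: is_obj_objs.
exact/objs_perm/Permutation_sym.
Qed.

End HomToArc.

Theorem theorem3p4 (k : fieldType) (a b c : seq nat)
  (f g : 'M[k]_(sumn a, sumn b)) :
  is_part a -> is_part b -> is_part c ->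
  all (fun x => x <= 2)%N a ->
  is_obj_map f -> is_obj_map g ->
  coker_type c f -> coker_type c g ->
  (leq_arc (SObj f) (SObj g) <-> leq_ext (SObj f) (SObj g)) /\
  (leq_ext (SObj f) (SObj g) <-> leq_hom (SObj f) (SObj g)) /\
  (GRing.closed_field_axiom k ->
     (leq_hom (SObj f) (SObj g) <-> leq_deg c f g)).
Proof.
move=> pa pb _ a2 of_ og cf cg.
have arc_deg := arc_degenerates pa pb of_ og.
have hom_arc_fg := hom_arc a2 of_ og cf cg.
split; first by split=> [/arc_deg[]|/ext_hom].
split; first by split=> [/ext_hom|/hom_arc_fg/arc_deg[]].
move=> clk; split; last exact: deg_hom.
move=> /hom_arc_fg/arc_deg[_ /(_ clk) zs] h gh; split; last exact: zs.
split; first exact: (iso_obj (X := SObj g) (Y := SObj h)) (proj2 (iso_orbit g h) gh) og.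
case: gh => [u [w [/andP[_ uu] /andP[/eqP wT wu] ->]]].
have [p /and3P[/eqP pT fp /eqmxP kp]] := cg.
(* A point of the orbit is u^-1 g w, so the projection for g preceded by w^-1 exhibits the same
   cokernel. *)
exists (invmx w *m p); apply/and3P; split.
- apply/eqP; rewrite !mulmxA -(mulmxA _ p) -pT mulmxA; congr (_ *m _).
  by apply: (row_free_inj (A := w)); rewrite ?row_free_unit // mulmxKV // -(mulmxA (invmx w)) wT mulmxA mulVmx // mul1mx.
- have fw : row_full (invmx w) by rewrite row_full_unit unitmx_inv.
  by rewrite /row_full (eqmxMfull _ fw).
apply/andP; split.
  apply/sub_kermxP; rewrite !mulmxA mulmxK // -(mulmxA _ g).
  have /sub_kermxP-> : (g <= kermx p)%MS by rewrite -kp.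
  by rewrite mulmx0.
apply/rV_subP => x /sub_kermxP; rewrite mulmxA => /sub_kermxP; rewrite -kp => /submxP[y ey].
apply/submxP; exists (y *m u); rewrite !mulmxA mulmxK // -ey mulmxKV //.
Qed.
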